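(* Let $p_1,p_2,q$ be distinct primes with $p_1\equiv p_2\equiv -q\equiv1\pmod 4$, $k=\mathbb{Q}(\sqrt{p_1p_2q},i)$, $\mathbb{K}_1=k(\sqrt{p_1})$, $\mathbb{K}_2=k(\sqrt{p_2})$, $\mathbb{K}_3=k(\sqrt q)$, and $\epsilon_{p_1p_2q}=x+y\sqrt{p_1p_2q}$ with $x,y\in\mathbb{Z}$. 1. Let $\epsilon_{p_2q}=a+b\sqrt{p_2q}$. (i) If $x\pm1$ is a square in $\mathbb{N}$ and neither $a+1$ nor $a-1$ is, then $|\kappa_{\mathbb{K}_1}|=8$. (ii) If $a\pm1$ and ($2p_1(x\pm1)$ or $p_1(x\pm1)$) are squares in $\mathbb{N}$, then $|\kappa_{\mathbb{K}_1}|=2$. (iii) In all other cases $|\kappa_{\mathbb{K}_1}|=4$. 2. Let $\epsilon_{p_1q}=a+b\sqrt{p_1q}$. (i) If $x\pm1$ is a square in $\mathbb{N}$ and neither $a+1$ nor $a-1$ is, then $|\kappa_{\mathbb{K}_2}|=8$. (ii) If $a\pm1$ and ($2p_2(x\pm1)$ or $p_2(x\pm1)$) are squares in $\mathbb{N}$, then $|\kappa_{\mathbb{K}_2}|=2$. (iii) In all other cases $|\kappa_{\mathbb{K}_2}|=4$. 3. (i) If $N(\epsilon_{p_1p_2})=1$: if $x\pm1$ is a square in $\mathbb{N}$ then $|\kappa_{\mathbb{K}_3}|=4$, and otherwise $|\kappa_{\mathbb{K}_3}|=2$. (ii) If $N(\epsilon_{p_1p_2})=-1$: if $q(x\pm1)$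 or $2q(x\pm1)$ is a square in $\mathbb{N}$ then $|\kappa_{\mathbb{K}_3}|=2$, and otherwise $|\kappa_{\mathbb{K}_3}|=4$.
   Context: $i=\sqrt{-1}$. For a square-free integer $m>1$, $\epsilon_m>1$ is the fundamental unit of $\mathbb{Q}(\sqrt m)$ and $N(\epsilon_m)$ its norm to $\mathbb{Q}$; here $a,b\in\mathbb{Z}$. For integers $c,u$, ''$c(u\pm1)$ is a square in $\mathbb{N}$'' means at least one of $c(u+1)$, $c(u-1)$ is the square of a natural number; signs in conjunctions are independent. For an extension $L/k$, $\kappa_L$ is the kernel of the map $\mathrm{Cl}(k)\to\mathrm{Cl}(L)$ induced by extension of ideals. *)

(* Defs.v *)
From mathcomp Require Export all_boot all_order all_algebra all_field.
From mathcomp Require Export boolp classical_sets functions cardinality.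

Set Implicit Arguments.
Unset Strict Implicit.
Unset Printing Implicit Defensive.

Import Order.TTheory GRing.Theory Num.Theory.

Local Open Scope classical_set_scope.
Local Open Scope ring_scope.

(* Number fields are subfields of algC, represented by their carriers. *)
Definition is_subfield (F : set algC) : Prop := divring_closed (mem F).

(* For a set A of algebraic numbers this is Q(A), and for a subfield F it is
   F(z) when A = F `|` [set z]. *)
Definition gen_field (A : set algC) : set algC := smallest is_subfield A.

Definition adjoin (F : set algC) (z : algC) : set algC :=
  gen_field (F `|` [set z]).

Definition int_ring (K : set algC) : set algC := K `&` [set` Aint].

Definition unit_group (K : set algC) : set algC :=
  [set u | [/\ u != 0, int_ring K u & int_ring K u^-1]].

(* All finite sums of products a * b with a in A and b in B: the product of
   two ideals, and also the extension of an ideal A when B is the ring of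
   integers of a larger field. *)
Definition ideal_mul (A B : set algC) : set algC :=
  [set z | exists s : seq (algC * algC),
     (forall t, t \in s -> A t.1 /\ B t.2) /\ z = \sum_(t <- s) t.1 * t.2].

Definition fractional_ideal (K I : set algC) : Prop :=
  [/\ I `<=` K,
      exists2 a, I a & a != 0,
      forall a b, I a -> I b -> I (a + b),
      forall r a, int_ring K r -> I a -> I (r * a)
    & exists2 d, int_ring K d & d != 0 /\ forall a, I a -> int_ring K (d * a)].

Definition principal_ideal (K : set algC) (c : algC) : set algC :=
  [set c * r | r in int_ring K].

(* The coset of I modulo the group of nonzero principal fractional ideals. *)
Definition ideal_class (K I : set algC) : set (set algC) :=
  [set ideal_mul I (principal_ideal K c) | c in K `\ 0].

Definition class_group (K : set algC) : set (set (set algC)) :=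
  [set ideal_class K I | I in fractional_ideal K].

(* All representatives I of C give the same class of I O_L when k is contained
   in L and C is an ideal class of k, so the union is that single class. *)
Definition class_extension (L : set algC) (C : set (set algC)) :
    set (set algC) :=
  \bigcup_(I in C) ideal_class L (ideal_mul I (int_ring L)).

Definition capitulation_kernel (k L : set algC) : set (set (set algC)) :=
  [set C | class_group k C /\
           class_extension L C = ideal_class L (int_ring L)].

Definition has_card (T : Type) (A : set T) (n : nat) : Prop := (A #= `I_n)%card.

Definition quad_field (m : nat) : set algC := gen_field [set sqrtC m%:R].

(* In algC, 1 < e entails that e is real; sqrtC is the nonnegative root. *)
Definition fundamental_unit (m : nat) (e : algC) : Prop :=
  [/\ unit_group (quad_field m) e, 1 < e
    & forall u, unit_group (quad_field m) u ->
        exists n : int, u = e ^ n \/ u = - e ^ n].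

Definition quad_int (m : nat) (a b : int) : algC :=
  a%:~R + b%:~R * sqrtC m%:R.

Definition quad_rat (m : nat) (r s : rat) : algC :=
  ratr r + ratr s * sqrtC m%:R.

(* Norm to Q of quad_rat m r s, for m not a square. *)
Definition quad_norm (m : nat) (r s : rat) : rat :=
  r ^+ 2 - m%:R * s ^+ 2.

Definition nat_square (z : int) : Prop := exists n : nat, z = n%:Z ^+ 2.

(* "c (u +- 1) is a square in N" *)
Definition square_pm (c u : int) : Prop :=
  nat_square (c * (u + 1)) \/ nat_square (c * (u - 1)).

(* Main.v *)
(* Each K_j is L = Q(sqrt m1, sqrt m2, i) with m1 = 1 mod 4, m2 = 3 mod 4 and
   m1 m2 = p1 p2 q, a quadratic extension of k unramified at every prime. Let sigma
   generate Gal(L/k) and let E denote unit groups.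

   An ideal I of k that becomes principal in L, I O_L = a O_L, gives the unit
   u = a / sigma a of norm 1. Since L/k is unramified, every sigma-stable ideal
   of O_L comes from k (Galois descent, without unique factorization), so by
   Hilbert 90 the kernel is M / TE_L, where M is the group of units of norm 1
   over k and T v = v / sigma v.

   If e1, e2 are the fundamental units of Q(sqrt m1), Q(sqrt m2), then M / M^2
   has order 8 with basis -1, alpha, e2, where alpha is e1 or i e1 according to
   the sign of the norm of e1. The maps T and the norm N identify TE_L / M^2
   with NE_L / E_k^2, so the kernel has order 8 / |NE_L / E_k^2|. As
   v^2 = N v T v, a unit of k is a norm modulo squares if and only if its
   product with some alpha^a e2^b is a square in L.

   Squares in L are decided over Q: i is 2 up to a square, a unit e of norm 1
   and trace t - 2 is t up to a square because (1 + e)^2 = t e, and a natural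
   number is a square in L if and only if its product with some m1^a m2^b is a
   perfect square. What remains is a finite computation with the parities of
   the exponents of 2, p1, p2, q. *)

Require Import Defs.
From HB Require Import structures.
From mathcomp Require Import all_boot all_order all_algebra all_field.
From mathcomp Require Import boolp classical_sets functions cardinality.
From mathcomp Require Import ring lra zify.
Import Order.TTheory GRing.Theory Num.Theory.
Set Implicit Arguments.
Unset Strict Implicit.
Unset Printing Implicit Defensive.
Local Open Scope classical_set_scope.
Local Open Scope ring_scope.

(** * Subfields of the algebraic numbers and their automorphisms *)

(** No unit theorem is used; a basis of M / M^2 comes from an identity. Let tau fix i and sqrt m1
    and change the sign of sqrt m2. For u in M the element tau u * sigma (tau u) is 1, so u^2 is the
    product of u tau u and u sigma (tau u), units of Q(i, sqrt m1) and Q(i, sqrt m2) of relative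
    norm 1. The sixth power of such a unit is, up to sign, a power of the fundamental unit: its
    squared absolute value is one, and the remaining root of unity becomes a sign when cubed. This
    determines u^12. Two square roots can be extracted because alpha and e2 are independent modulo
    squares; they lead to u^3, which agrees with u modulo squares.

    The units of k modulo squares are not always generated by i and e: i e is a square in k exactly
    when 2 t or 2 t m1 m2 is a perfect square, t being the trace of e plus 2. A square root eta of i
    e then replaces e. No i^h eta is a norm from L: if v^2 = i^h eta alpha^a e2^b, forming v tau v
    would make i or -i a square in L. Hence the count has two branches. *)

Section Subfield.
Variables (F : set algC) (sfF : is_subfield F).
Implicit Types u v : algC.

Lemma subfield1 : F 1.
Proof. by have [/set_mem] := sfF. Qed.

Lemma subfieldB u v : F u -> F v -> F (u - v).
Proof. by have [_ h _] := sfF => /mem_set fu /mem_set fv; apply/set_mem/h. Qed.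

Lemma subfield_div u v : F u -> F v -> F (u / v).
Proof. by have [_ _ h] := sfF => /mem_set fu /mem_set fv; apply/set_mem/h. Qed.

Lemma subfield0 : F 0.
Proof. by rewrite -(subrr 1); apply: subfieldB; apply: subfield1. Qed.

Lemma subfieldN u : F u -> F (- u).
Proof. by move=> fu; rewrite -sub0r; apply: subfieldB => //; apply: subfield0. Qed.

Lemma subfieldD u v : F u -> F v -> F (u + v).
Proof. by move=> fu fv; rewrite -[v]opprK; apply/subfieldB/subfieldN. Qed.

Lemma subfieldV u : F u -> F u^-1.
Proof. by move=> fu; rewrite -div1r; apply/subfield_div/fu/subfield1. Qed.

Lemma subfieldM u v : F u -> F v -> F (u * v).
Proof. by move=> fu fv; rewrite -[v]invrK; apply/subfield_div/subfieldV. Qed.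

Lemma subfieldX n u : F u -> F (u ^+ n).
Proof.
move=> fu; elim: n => [|n ih]; first exact: subfield1.
by rewrite exprS; apply: subfieldM.
Qed.

Lemma subfieldXz (n : int) u : F u -> F (u ^ n).
Proof.
by move=> fu; case: n => n; [|apply: subfieldV]; apply: subfieldX.
Qed.

Lemma subfield_nat n : F n%:R.
Proof.
elim: n => [|n ih]; first exact: subfield0.
by rewrite -natr1; apply/subfieldD/subfield1.
Qed.

Lemma subfield_int n : F n%:~R.
Proof. by case: n => n; [|apply: subfieldN]; apply: subfield_nat. Qed.

Lemma subfield_rat r : F (ratr r).
Proof. by apply: subfield_div; apply: subfield_int. Qed.

End Subfield.

Lemma is_subfieldP (F : set algC) : F 1 ->
  (forall u v, F u -> F v -> F (u - v)) -> (forall u v, F u -> F v -> F (u / v)) ->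
  is_subfield F.
Proof.
move=> f1 fB fV; split; first exact/mem_set.
  by move=> u v /set_mem fu /set_mem fv; apply/mem_set/fB.
by move=> u v /set_mem fu /set_mem fv; apply/mem_set/fV.
Qed.

Lemma gen_field_subfield (A : set algC) : is_subfield (gen_field A).
Proof.
apply: is_subfieldP => [M [sM _]|u v gu gv M M1|u v gu gv M M1].
- exact: subfield1.
- by apply: subfieldB; [apply: M1.1|apply: gu|apply: gv].
- by apply: subfield_div; [apply: M1.1|apply: gu|apply: gv].
Qed.

Lemma mem_gen_field (A : set algC) u : A u -> gen_field A u.
Proof. exact: sub_gen_smallest. Qed.

Lemma gen_field_sub (A F : set algC) :
  is_subfield F -> A `<=` F -> gen_field A `<=` F.
Proof. exact: smallest_sub. Qed.

Definition quad_ext (F : set algC) (z : algC) : set algC :=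
  [set w | exists a b, [/\ F a, F b & w = a + b * z]].

Lemma quad_ext_subfield (F : set algC) z :
  is_subfield F -> F (z ^+ 2) -> is_subfield (quad_ext F z).
Proof.
move=> sF Fz2.
have FM : forall u v, F u -> F v -> F (u * v) := subfieldM sF.
have FD : forall u v, F u -> F v -> F (u + v) := subfieldD sF.
have FB : forall u v, F u -> F v -> F (u - v) := subfieldB sF.
have FV : forall u, F u -> F u^-1 := subfieldV sF.
have F0 : F 0 := subfield0 sF.
have quadM u v : quad_ext F z u -> quad_ext F z v -> quad_ext F z (u * v).
  move=> [a [b [fa fb ->]]] [a' [b' [fa' fb' ->]]].
  exists (a * a' + b * b' * z ^+ 2), (a * b' + b * a').
  split; [apply/FD; [exact: FM|apply/FM => //; exact: FM]| |ring].
  by apply/FD; exact: FM.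
apply: is_subfieldP.
- by exists 1, 0; split=> //; [exact: subfield1|rewrite mul0r addr0].
- move=> _ _ [a [b [fa fb ->]]] [a' [b' [fa' fb' ->]]].
  by exists (a - a'), (b - b'); split; [exact: FB|exact: FB|ring].
- move=> u v qu [a [b [fa fb ->]]]; apply: quadM => //.
  have [ab0|abN0] := eqVneq (a ^+ 2 - b ^+ 2 * z ^+ 2) 0; last first.
    have abzN0 : a + b * z != 0.
      by apply: contraNneq abN0 => h; rewrite -exprMn subr_sqr h mulr0.
    exists (a / (a ^+ 2 - b ^+ 2 * z ^+ 2)), (- b / (a ^+ 2 - b ^+ 2 * z ^+ 2)).
    have ff : F (a ^+ 2 - b ^+ 2 * z ^+ 2)^-1.
      by apply/FV/FB; [|apply/FM => //]; exact: subfieldX.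
    split; [exact: FM| by apply/FM => //; exact: subfieldN|].
    apply: (mulfI abzN0); rewrite mulfV // -[LHS](mulfV abN0).
    by set D := (X in _ = _ * (_ / X + _)); rewrite -/D {1}/D; ring.
  (* A vanishing norm means b = 0 or z = a / b up to sign, so a + b z already lies in F. *)
  suff fab : F (a + b * z).
    by exists (a + b * z)^-1, 0; split=> //; [exact: FV|rewrite mul0r addr0].
  have [b0|bN0] := eqVneq b 0; first by rewrite b0 mul0r addr0.
  suff fz : F z by apply/FD => //; exact: FM.
  move/eqP: ab0; rewrite -exprMn subr_eq0 eqf_sqr => /orP[]/eqP h.
    by rewrite -(mulKf bN0 z) -h; apply/FM => //; exact: FV.
  rewrite -(mulKf bN0 z) -[b * z]opprK -h; apply/FM => //; first exact: FV.
  exact: subfieldN.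
Qed.

Lemma sub_quad_ext (F : set algC) z : is_subfield F -> F `<=` quad_ext F z.
Proof.
move=> sF a fa; exists a, 0; split=> //; last by rewrite mul0r addr0.
exact: subfield0.
Qed.

Lemma mem_quad_ext (F : set algC) z : is_subfield F -> quad_ext F z z.
Proof.
move=> sF; exists 0, 1; rewrite add0r mul1r.
by split=> //; [exact: subfield0|exact: subfield1].
Qed.

Lemma quad_ext_sub (F K : set algC) z :
  is_subfield K -> F `<=` K -> K z -> quad_ext F z `<=` K.
Proof.
move=> sK FK Kz _ [a [b [/FK Ka /FK Kb ->]]].
by apply: subfieldD => //; apply: subfieldM.
Qed.

(** Expanding w = a + b z gives 2 a b z = w^2 - a^2 - b^2 z^2 in F, so a = 0, b = 0 or z itself is
    in F. *)
Lemma quad_ext_sqrt (F : set algC) z w : is_subfield F -> F (z ^+ 2) ->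
  F (w ^+ 2) -> quad_ext F z w -> F w \/ F (w * z).
Proof.
move=> sF Fz2 Fw2 [a [b [fa fb wE]]].
have [fz|nfz] := pselect (F z).
  by left; rewrite wE; apply: subfieldD => //; apply: subfieldM.
have [a0|aN0] := eqVneq a 0.
  right; rewrite wE a0 add0r -mulrA -expr2; exact: subfieldM.
have [b0|bN0] := eqVneq b 0; first by left; rewrite wE b0 mul0r addr0.
case: nfz; have abN0 : 2 * a * b != 0 by rewrite !mulf_neq0 ?pnatr_eq0.
rewrite -(mulKf abN0 z).
have -> : 2 * a * b * z = w ^+ 2 - a ^+ 2 - b ^+ 2 * z ^+ 2 by rewrite wE; ring.
have FM : forall u v, F u -> F v -> F (u * v) := subfieldM sF.
have FB : forall u v, F u -> F v -> F (u - v) := subfieldB sF.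
apply/FM; first by apply: subfieldV => //; do 2!apply/FM => //; exact: subfield_nat.
by apply/FB; [apply/FB => //|apply/FM => //]; apply: subfieldX.
Qed.

Lemma quad_ext_fixed (F : set algC) z (nu : {rmorphism algC -> algC}) w :
    is_subfield F -> (forall u, F u -> nu u = u) -> nu z = - z -> z != 0 ->
  quad_ext F z w -> nu w = w -> F w.
Proof.
move=> sF nuF nuz zN0 [a [b [fa fb ->]]].
rewrite rmorphD rmorphM nuz !nuF // => h.
suff -> : b = 0 by rewrite mul0r addr0.
apply/eqP; rewrite -(inj_eq (mulIf zN0)) mul0r.
have : 2 * (b * z) == 0.
  apply/eqP; have -> : 2 * (b * z) = (a + b * z) - (a + b * - z) by ring.
  by rewrite h subrr.
by rewrite mulf_eq0 pnatr_eq0.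
Qed.

Lemma gen_field_eq_rmorph (A : set algC) (f g : {rmorphism algC -> algC}) :
  (forall u, A u -> f u = g u) -> forall u, gen_field A u -> f u = g u.
Proof.
move=> fg; apply: (@gen_field_sub A [set u | f u = g u]) => //.
apply: is_subfieldP => /= [|u v fu fv|u v fu fv]; first by rewrite !rmorph1.
  by rewrite !rmorphB fu fv.
by rewrite !rmorphM !fmorphV fu fv.
Qed.

Lemma gen_field_rmorph (A F : set algC) (f : {rmorphism algC -> algC}) :
  is_subfield F -> (forall u, A u -> F (f u)) ->
  forall u, gen_field A u -> F (f u).
Proof.
move=> sF fA; apply: (@gen_field_sub A [set u | F (f u)]) => //.
apply: is_subfieldP => /= [|u v fu fv|u v fu fv].
- by rewrite rmorph1; exact: subfield1.
- by rewrite rmorphB; exact: subfieldB.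
- by rewrite rmorphM fmorphV; exact: subfield_div.
Qed.

Lemma gen_field_rat r (A : set algC) : gen_field A (ratr r).
Proof. exact: subfield_rat (gen_field_subfield A) _. Qed.

(** A bridge to finite extensions of the rationals, where minimal polynomials and K-homomorphisms
    are available. *)
Lemma num_field_gen_field (Q : fieldExtType rat) (f : {rmorphism Q -> algC})
    (s : seq Q) (w : Q) :
  w \in <<1 & s>>%VS <-> gen_field [set` map f s] (f w).
Proof.
split.
  elim/last_ind: s w => [|s z ih] w.
    rewrite Fadjoin_nil => /vlineP[r ->]; rewrite rmorphZ_num rmorph1 mulr1.
    exact: gen_field_rat.
  rewrite adjoin_rcons => /Fadjoin_polyP[p /polyOverP pK ->].
  have sub : gen_field [set` [seq f i | i <- s]] `<=`
      gen_field [set` [seq f i | i <- rcons s z]].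
    apply: gen_field_sub; first exact: gen_field_subfield.
    move=> t ts; apply: mem_gen_field; move: ts.
    by rewrite /= map_rcons mem_rcons inE orbC => ->.
  have sg := gen_field_subfield [set` [seq f i | i <- rcons s z]].
  rewrite horner_coef rmorph_sum; apply: big_ind => [||i _].
  - exact: subfield0.
  - exact: subfieldD.
  rewrite rmorphM rmorphXn; apply: (subfieldM sg); first exact: sub (ih _ (pK i)).
  apply: (subfieldX sg); apply: mem_gen_field.
  by rewrite /= map_rcons mem_rcons inE eqxx.
have : gen_field [set` map f s] `<=` [set t | exists2 v, v \in <<1 & s>>%VS & t = f v].
  apply: gen_field_sub => [|t /= /mapP[v vs ->]]; last first.
    by exists v => //; exact: seqv_sub_adjoin.
  apply: is_subfieldP => [|_ _ [u uK ->] [v vK ->]|_ _ [u uK ->] [v vK ->]] /=.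
  - by exists 1; rewrite ?rmorph1 ?mem1v.
  - by exists (u - v); rewrite ?rmorphB ?rpredB.
  - by exists (u / v); rewrite ?rmorphM ?fmorphV // rpredM ?rpredV.
by move=> h /h[v vK /fmorph_inj ->].
Qed.

(** As z is not in the field K generated by s, its minimal polynomial over K is X^2 - z^2, with
    other root - z. The K-homomorphism sending z to - z is defined on K(z) and then extended to
    algC. *)
Lemma quad_aut_exists (s : seq algC) (z : algC) :
    ~ gen_field [set` s] z -> gen_field [set` s] (z ^+ 2) ->
  exists nu : {rmorphism algC -> algC},
    (forall u, gen_field [set` s] u -> nu u = u) /\ nu z = - z.
Proof.
have [Q [f [s1 fs1 full]]] := num_field_exists (rcons s z).
move: fs1 full; case/lastP: s1 => [|s1 z1]; first by move/(congr1 size); rewrite size_rcons.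
rewrite map_rcons => /rcons_inj[<- <-] {s z} full nz.
rewrite -rmorphXn -num_field_gen_field => z2; move/num_field_gen_field: nz => nz.
pose K := <<1 & s1>>%AS.
have p_size : size ('X^2 - (z1 ^+ 2)%:P : {poly Q}) = 3 by rewrite size_XnsubC.
have p_monic : ('X^2 - (z1 ^+ 2)%:P : {poly Q}) \is monic by rewrite monicXnsubC.
have p_over : 'X^2 - (z1 ^+ 2)%:P \is a polyOver K.
  by rewrite rpredB ?rpredX ?polyOverX ?polyOverC.
have p_root w : root ('X^2 - (z1 ^+ 2)%:P) w = (w ^+ 2 == z1 ^+ 2).
  by rewrite /root !hornerE subr_eq0.
have p_min : minPoly K z1 = 'X^2 - (z1 ^+ 2)%:P.
  have dv : minPoly K z1 %| 'X^2 - (z1 ^+ 2)%:P by rewrite minPoly_dvdp ?p_root.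
  apply/eqP; rewrite -eqp_monic ?monic_minPoly // -dvdp_size_eqp //.
  rewrite eqn_leq dvdp_leq ?monic_neq0 //= p_size size_minPoly ltnS.
  rewrite ltn_neqAle andbT eq_sym.
  (* Degree one would make the minimal polynomial X - z and put z in K. *)
  apply/negP => /eqP deg1; case: nz.
  have := size_minPoly K z1; rewrite deg1 => sz.
  have dvX : 'X - z1%:P %| minPoly K z1.
    by rewrite -root_factor_theorem root_minPoly.
  have := dvdp_size_eqp dvX; rewrite size_XsubC sz eqxx => /esym.
  rewrite eqp_monic ?monicXsubC ?monic_minPoly // => /eqP h.
  exact/minPoly_XsubC.
pose g := kHomExtend K \1 z1 (- z1).
have rt : root (map_poly \1%VF (minPoly K z1)) (- z1).
  by rewrite lfun1_poly p_min p_root sqrrN.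
have gK : kHom K <<K; z1>> g by apply: kHomExtendP; rewrite ?kHom1.
have full' : <<K; z1>>%VS = fullv by rewrite -full adjoin_rcons.
have g_hom : kHom 1 {:Q} g by rewrite -full'; apply: kHomSl gK; apply: sub1v.
have gM : monoid_morphism g by exact/kHom_monoid_morphism.
pose gR := GRing.isMonoidMorphism.Build _ _ g gM.
pose G : {rmorphism Q -> Q} := HB.pack (fun_of_lfun g) gR.
have [nu nuE] := extend_algC_subfield_aut f G.
have gE u : u \in K -> g u = u.
  by move=> uK; rewrite /g kHomExtend_id ?kHom1 // lfunE.
have gz : g z1 = - z1 by apply: (kHomExtend_val (kHom1 K K)).
exists nu; split; last by rewrite -nuE /= gz rmorphN.
move=> u; apply: (@gen_field_eq_rmorph _ nu idfun) => t /mapP[v vs ->] /=.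
by rewrite -nuE /= gE // seqv_sub_adjoin.
Qed.

(** * Quadratic fields and units *)

Definition rat_field : set algC := [set` Crat].

Lemma rat_field_subfield : is_subfield rat_field.
Proof.
apply: is_subfieldP => [|u v|u v]; rewrite /rat_field /=; first exact: rpred1.
  exact: rpredB.
exact: rpred_div.
Qed.

Lemma rat_field_sub F : is_subfield F -> rat_field `<=` F.
Proof. by move=> sF _ /CratP[r ->]; exact: subfield_rat. Qed.

Lemma gen_field_nil : gen_field [set` [::]] = rat_field.
Proof.
apply/seteqP; split; first by apply: gen_field_sub => //; exact: rat_field_subfield.
exact: rat_field_sub (gen_field_subfield _).
Qed.

Lemma gen_field_cons s z : gen_field [set` s] (z ^+ 2) ->
  gen_field [set` z :: s] = quad_ext (gen_field [set` s]) z.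
Proof.
move=> z2; have sgs := gen_field_subfield [set` s].
apply/seteqP; split.
  apply: gen_field_sub => [|w /=]; first exact: quad_ext_subfield.
  rewrite inE => /orP[/eqP ->|ws]; first exact: mem_quad_ext.
  by apply: sub_quad_ext => //; exact: mem_gen_field.
have sgz := gen_field_subfield [set` z :: s].
apply: quad_ext_sub => //; last by apply: mem_gen_field; rewrite /= mem_head.
apply: gen_field_sub => // w /= ws; apply: mem_gen_field.
by rewrite /= inE ws orbT.
Qed.

Lemma gen_field_eq (A B : set algC) :
  A `<=` gen_field B -> B `<=` gen_field A -> gen_field A = gen_field B.
Proof.
by move=> AB BA; apply/seteqP; split; apply: gen_field_sub => //;
  exact: gen_field_subfield.
Qed.

(** Peeling off one generator at a time, [quad_ext_sqrt] either discards it or multiplies w by it;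
    [b] records the choices. *)
Lemma gen_field_sqrt (s : seq algC) w : (forall z, z \in s -> z ^+ 2 \in Crat) ->
  w ^+ 2 \in Crat -> gen_field [set` s] w ->
  exists b : bitseq, size b = size s /\ w * \prod_(z <- mask b s) z \in Crat.
Proof.
elim: s w => [|z s ih] w s2 w2.
  by rewrite gen_field_nil => qw; exists [::]; rewrite big_nil mulr1.
have sgs := gen_field_subfield [set` s].
have z2 : z ^+ 2 \in Crat by apply: s2; rewrite mem_head.
rewrite gen_field_cons; last exact: rat_field_sub z2.
have s2' t : t \in s -> t ^+ 2 \in Crat by move=> ts; apply: s2; rewrite inE ts orbT.
case/(quad_ext_sqrt sgs (rat_field_sub sgs z2) (rat_field_sub sgs w2)).
  by move=> /(ih w s2' w2)[b [sb qb]]; exists (false :: b); rewrite /= sb.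
have wz2 : (w * z) ^+ 2 \in Crat by rewrite exprMn rpredM.
move=> /(ih _ s2' wz2)[b [sb qb]]; exists (true :: b); rewrite /= sb.
by rewrite big_cons mulrA.
Qed.

Lemma Aint_sqrt w : w ^+ 2 \in Aint -> w \in Aint.
Proof.
move=> w2; pose p := minCpoly (w ^+ 2) \Po 'X^2.
have pm := minCpoly_monic (w ^+ 2).
apply: (@root_monic_Aint p).
- rewrite /root horner_comp hornerXn; exact: root_minCpoly.
- rewrite monicE lead_coef_comp ?size_polyXn // (monicP pm) lead_coefXn.
  by rewrite expr1n mulr1.
- by rewrite polyOver_comp // rpredX // polyOverX.
Qed.

Lemma Aint_sqrtC_nat n : sqrtC n%:R \in Aint.
Proof. by apply: Aint_sqrt; rewrite sqrtCK Aint_Cnat. Qed.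

Definition natsq (n : nat) : Prop := exists z : nat, n = (z ^ 2)%N.

Lemma rat_sqrt_natsq n q : q \in Crat -> q ^+ 2 = n%:R -> natsq n.
Proof.
move=> qQ q2; have : q \in Num.int.
  by apply: Cint_rat_Aint => //; apply: Aint_sqrt; rewrite q2 Aint_Cnat.
case/intrP => z qE; exists `|z|%N.
move: q2; rewrite qE -rmorphXn /= -[n%:R]/(n%:Z%:~R) => /intr_inj h.
by nia.
Qed.

Lemma sqrtC_rat_natsq n : sqrtC n%:R \in Crat -> natsq n.
Proof. by move=> h; apply: rat_sqrt_natsq h _; rewrite sqrtCK. Qed.

Lemma sqrtC_nat_eq0 n : (0 < n)%N -> sqrtC n%:R != 0 :> algC.
Proof. by rewrite sqrtC_eq0 pnatr_eq0 lt0n. Qed.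

Lemma conj_sqrtC_nat n : (sqrtC n%:R)^* = sqrtC n%:R :> algC.
Proof. by apply/CrealP; rewrite sqrtC_real // ?ler0n. Qed.

Lemma quad_fieldE m : quad_field m = gen_field [set` [:: sqrtC m%:R]].
Proof.
by rewrite /quad_field; congr gen_field; apply/seteqP; split=> w /=;
  rewrite inE => /eqP.
Qed.

Lemma quad_field_quad_ext m : quad_field m = quad_ext rat_field (sqrtC m%:R).
Proof.
rewrite quad_fieldE gen_field_cons gen_field_nil //.
by rewrite /rat_field /= sqrtCK rpred_nat.
Qed.

Lemma quad_fieldP m w : quad_field m w <-> exists r s : rat, w = quad_rat m r s.
Proof.
rewrite quad_field_quad_ext; split=> [[_ [_ [/CratP[r ->] /CratP[s ->] ->]]]|[r [s ->]]].
  by exists r, s.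
by exists (ratr r), (ratr s); split=> //; exact: Crat_rat.
Qed.

Section Units.
Variables (K : set algC) (sfK : is_subfield K).

Lemma int_ringM u v : int_ring K u -> int_ring K v -> int_ring K (u * v).
Proof.
by move=> [Ku Au] [Kv Av]; split; [exact: subfieldM|exact: rpredM].
Qed.

Lemma int_ringD u v : int_ring K u -> int_ring K v -> int_ring K (u + v).
Proof.
by move=> [Ku Au] [Kv Av]; split; [exact: subfieldD|exact: rpredD].
Qed.

Lemma int_ring1 : int_ring K 1.
Proof. by split; [exact: subfield1|exact: rpred1]. Qed.

Lemma int_ring0 : int_ring K 0.
Proof. by split; [exact: subfield0|exact: rpred0]. Qed.

Lemma unit_group_neq0 u : unit_group K u -> u != 0.
Proof. by case. Qed.

Lemma unit_group_mem u : unit_group K u -> K u.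
Proof. by case=> _ []. Qed.

Lemma unit_group_Aint u : unit_group K u -> u \in Aint.
Proof. by case=> _ []. Qed.

Lemma unit_group1 : unit_group K 1.
Proof. by split; rewrite ?invr1 ?oner_eq0 //; exact: int_ring1. Qed.

Lemma unit_groupM u v : unit_group K u -> unit_group K v -> unit_group K (u * v).
Proof.
move=> [u0 iu iu'] [v0 iv iv']; split; first exact: mulf_neq0.
  exact: int_ringM.
by rewrite invfM; exact: int_ringM.
Qed.

Lemma unit_groupV u : unit_group K u -> unit_group K u^-1.
Proof. by case=> u0 iu iu'; split; rewrite ?invr_eq0 ?invrK. Qed.

Lemma unit_groupN u : unit_group K u -> unit_group K (- u).
Proof.
move=> [u0 [Ku Au] [Ku' Au']]; split; rewrite ?oppr_eq0 ?invrN //.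
  by split; [exact: subfieldN|rewrite /= rpredN].
by split; [exact: subfieldN|rewrite /= rpredN].
Qed.

Lemma unit_groupX n u : unit_group K u -> unit_group K (u ^+ n).
Proof.
move=> uu; elim: n => [|n ih]; first exact: unit_group1.
by rewrite exprS; exact: unit_groupM.
Qed.

Lemma unit_groupXz (n : int) u : unit_group K u -> unit_group K (u ^ n).
Proof.
by move=> uu; case: n => n; [|apply: unit_groupV]; exact: unit_groupX.
Qed.

Lemma unit_group_sqrt w : K w -> unit_group K (w ^+ 2) -> unit_group K w.
Proof.
move=> Kw [w0 [_ Aw] [_ Aw']]; split; first by move: w0; rewrite expf_eq0.
  by split=> //; exact: Aint_sqrt.
by split; [exact: subfieldV|apply: Aint_sqrt; rewrite exprVn].
Qed.

Lemma unit_group_aut (nu : {rmorphism algC -> algC}) u :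
  (forall v, K v -> K (nu v)) -> unit_group K u -> unit_group K (nu u).
Proof.
move=> nuK [u0 [Ku Au] [Ku' Au']]; split; rewrite ?fmorph_eq0 -?fmorphV //.
  by split; rewrite /= ?Aint_aut //; exact: nuK.
by split; rewrite /= ?Aint_aut //; exact: nuK.
Qed.

End Units.

Lemma unit_group_sub (K K' : set algC) u : K `<=` K' -> unit_group K u -> unit_group K' u.
Proof. by move=> KK' [u0 [Ku Au] [Ku' Au']]; split=> //; split=> //; exact: KK'. Qed.

Lemma unit_group_in (K K' : set algC) u : is_subfield K' -> K' u ->
  unit_group K u -> unit_group K' u.
Proof.
move=> sK' K'u [u0 [Ku Au] [Ku' Au']]; split=> //; split=> //; exact: subfieldV.
Qed.

Lemma unit_group_rat (K : set algC) u : u \in Crat -> unit_group K u -> u = 1 \/ u = -1.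
Proof.
move=> uQ [u0 [_ Au] [_ Au']].
have /intrP[n nE] := Cint_rat_Aint uQ Au.
have /intrP[n' nE'] : u^-1 \in Num.int by apply: Cint_rat_Aint; rewrite ?rpredV.
have nn' : n * n' = 1 by apply: (@intr_inj algC); rewrite rmorphM /= -nE -nE' mulfV.
have : (n %| 1)%Z by apply/dvdzP; exists n'; rewrite mulrC.
rewrite dvdz1 nE => h; have [->|->] : n = 1 \/ n = -1 by lia.
  by left.
by right.
Qed.

Lemma quad_conj_exists m : ~ natsq m ->
  exists nu : {rmorphism algC -> algC}, nu (sqrtC m%:R) = - sqrtC m%:R.
Proof.
move=> nsq; have [||nu [_ h]] := @quad_aut_exists [::] (sqrtC m%:R).
- by rewrite gen_field_nil => /sqrtC_rat_natsq.
- by rewrite gen_field_nil sqrtCK; exact: rpred_nat.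
- by exists nu.
Qed.

(** z is a root of X^2 - n X + 1 with n = z + z^* a rational integer of absolute value at most 2;
    the five cases are roots of unity of order dividing 4 or 6. *)
Lemma unit_circle_quad z : z \in Aint -> z * z^* = 1 -> z + z^* \in Crat ->
  [\/ z ^+ 2 = -1, z ^+ 3 = 1 | z ^+ 3 = -1].
Proof.
move=> Az zz zQ.
have Az' : z^* \in Aint by rewrite Aint_aut.
have /intrP[n nE] : z + z^* \in Num.int by apply: Cint_rat_Aint zQ (rpredD Az Az').
have nz : `|z| = 1.
  by apply/eqP; rewrite -(@pexpr_eq1 _ _ 2) // normCK zz.
have : `|n%:~R| <= 2 :> algC.
  by rewrite -nE (le_trans (ler_normD _ _)) // norm_conjC nz.
rewrite -intr_norm -[2]/(2%:~R) ler_int => n2.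
have zE : z ^+ 2 = n%:~R * z - 1 by rewrite -nE -zz; ring.
have [h|[h|[h|[h|h]]]] : n = 0 \/ n = 1 \/ n = -1 \/ n = 2 \/ n = -2 by lia.
- by constructor 1; rewrite zE h mul0r sub0r.
- by constructor 3; rewrite exprS zE h mul1r mulrBr -expr2 zE h; ring.
- by constructor 2; rewrite exprS zE h mulrBr mulrCA -expr2 zE h; ring.
- have : (z - 1) ^+ 2 = 0 by rewrite sqrrB zE h; ring.
  move/eqP; rewrite expf_eq0 subr_eq0 /= => /eqP ->; constructor 2; exact: expr1n.
- have : (z + 1) ^+ 2 = 0 by rewrite sqrrD zE h; ring.
  move/eqP; rewrite expf_eq0 addr_eq0 /= => /eqP ->; constructor 3; ring.
Qed.

(** * Fundamental units *)

Lemma exprz_gt1_inj (R : numFieldType) (e : R) : 1 < e -> injective (fun n : int => e ^ n).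
Proof.
move=> e1; have e0 : e != 0 by rewrite gt_eqF // (lt_trans ltr01).
have main (j k : int) : k < j -> e ^ j = e ^ k -> False.
  move=> kj; have [n jE] : exists n : nat, j = k + n.+1%:Z by exists (absz (j - k - 1)%R); lia.
  rewrite jE expfzDr // -[RHS]mulr1 => /(mulfI (expfz_neq0 k e0)).
  by move/eqP; rewrite gt_eqF // exprn_egt1.
by move=> j k /= jk; case: (ltrgtP j k) => // h; case: (main _ _ h).
Qed.

Definition sq_in (K : set algC) (x : algC) : Prop := exists2 w, K w & w ^+ 2 = x.

Lemma gen_field_sq_nat (ms : seq nat) n : (0 < n)%N -> all (fun m => 0 < m)%N ms ->
    sq_in (gen_field [set` 'i :: [seq sqrtC m%:R | m <- ms]]) n%:R ->
  exists b : bitseq, size b = size ms /\ natsq (n * \prod_(m <- mask b ms) m).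
Proof.
move=> n0 ms0 [w Kw w2].
have sq z : z \in 'i :: [seq sqrtC m%:R | m <- ms] -> z ^+ 2 \in Crat.
  rewrite inE => /orP[/eqP->|/mapP[m _ ->]].
    by rewrite sqrCi rpredN rpred1.
  by rewrite sqrtCK rpred_nat.
have [|[|c b] [] // [sb] qb] := gen_field_sqrt sq _ Kw.
  by rewrite w2 rpred_nat.
rewrite size_map in sb; exists b; split=> //.
have prodE : (\prod_(z <- mask b [seq sqrtC m%:R | m <- ms]) z) ^+ 2 =
    (\prod_(m <- mask b ms) m)%:R :> algC.
  rewrite -map_mask big_map -prodrXl natr_prod.
  by apply: eq_bigr => m _; rewrite sqrtCK.
have prod_gt0 : (0 < \prod_(m <- mask b ms) m)%N.
  elim: b ms ms0 {sb qb prodE Kw sq} => [|[] b ih] [|m ms] //=;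
    rewrite ?big_nil ?big_cons //.
  - by move=> /andP[m0 ms0]; rewrite muln_gt0 m0 ih.
  - by move=> /andP[_ ms0]; exact: ih.
case: c qb => /=; last first.
  move=> /rat_sqrt_natsq; apply.
  by rewrite exprMn prodE w2 natrM.
(* With ['i] among the chosen generators, the square of the rational number q would be - n times a
   positive product. *)
rewrite big_cons => qb; set q := (X in X \in _) in qb.
have q2 : q ^+ 2 = - (n * \prod_(m <- mask b ms) m)%:R.
  by rewrite /q exprMn exprMn sqrCi prodE w2 natrM; ring.
have : 0 <= q ^+ 2.
  by rewrite -realEsqr; exact: Creal_Crat.
by rewrite q2 oppr_ge0 lern0 muln_eq0 !eqn0Ngt n0 prod_gt0.
Qed.

Lemma quad_rat_norm (nu : {rmorphism algC -> algC}) m r s :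
  nu (sqrtC m%:R) = - sqrtC m%:R ->
  quad_rat m r s * nu (quad_rat m r s) = ratr (quad_norm m r s).
Proof.
move=> num; rewrite /quad_rat (rmorphD nu) fmorph_rat (rmorphM nu) /= num fmorph_rat.
rewrite /quad_norm [ratr (_ - _)]rmorphB /= [ratr (_ * _)]rmorphM /= ![ratr (_ ^+ _)]rmorphXn /=.
rewrite ratr_nat -[m%:R in RHS]sqrtCK; ring.
Qed.

Lemma quad_rat_trace (nu : {rmorphism algC -> algC}) m r s :
  nu (sqrtC m%:R) = - sqrtC m%:R ->
  quad_rat m r s + nu (quad_rat m r s) = ratr (2 * r).
Proof.
move=> num; rewrite /quad_rat (rmorphD nu) fmorph_rat (rmorphM nu) /= num fmorph_rat rmorphM /= ratr_nat.
by ring.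
Qed.

Lemma quad_rat_diff (nu : {rmorphism algC -> algC}) m r s :
  nu (sqrtC m%:R) = - sqrtC m%:R ->
  (quad_rat m r s - nu (quad_rat m r s)) * sqrtC m%:R = ratr (2 * s * m%:R).
Proof.
move=> num; rewrite /quad_rat (rmorphD nu) fmorph_rat (rmorphM nu) /= num fmorph_rat !rmorphM /= !ratr_nat.
rewrite -[m%:R in RHS]sqrtCK; ring.
Qed.

Lemma quad_field_real m u : quad_field m u -> u \is Creal.
Proof.
move=> /quad_fieldP[r [s ->]].
have sR : sqrtC m%:R \is Creal by rewrite ger0_real // sqrtC_ge0 ler0n.
have rR t : (ratr t : algC) \is Creal by rewrite Creal_Crat ?Crat_rat.
exact: rpredD (rR r) (rpredM (rR s) sR).
Qed.

Section QuadUnit.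
Variables (m : nat) (e : algC) (nu : {rmorphism algC -> algC}).
Hypothesis fund : fundamental_unit m e.
Hypothesis num : nu (sqrtC m%:R) = - sqrtC m%:R.

Lemma fund_unit_gt1 : 1 < e. Proof. by case: fund. Qed.

Lemma fund_unit_gt0 : 0 < e. Proof. exact: lt_trans ltr01 fund_unit_gt1. Qed.

Lemma fund_unit_mem : quad_field m e.
Proof. by case: fund => [[_ []]]. Qed.

Lemma fund_unit_norm : e * nu e = 1 \/ e * nu e = -1.
Proof.
have sf : is_subfield (quad_field m) := gen_field_subfield _.
have [eu _ _] := fund.
apply: (@unit_group_rat (quad_field m)).
  have [r [s ->]] := (quad_fieldP _ _).1 fund_unit_mem.
  by rewrite quad_rat_norm // Crat_rat.
apply: (unit_groupM sf) => //; apply: unit_group_aut => //.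
move=> v; apply: gen_field_rmorph => // z ->; rewrite num.
by apply: (subfieldN sf); exact: mem_gen_field.
Qed.

(** These two integers carry what is needed about e without deciding whether its coordinates are
    integers or half-integers. *)
Lemma fund_unit_int : exists n c : int,
  [/\ e + nu e = n%:~R & (e - nu e) * sqrtC m%:R = c%:~R].
Proof.
have [[_ [_ Ae] _] _ _] := fund.
have Ae' : nu e \in Aint by rewrite Aint_aut.
have [r [s eE]] := (quad_fieldP _ _).1 fund_unit_mem.
have /intrP[n nE] : e + nu e \in Num.int.
  by apply: Cint_rat_Aint; [rewrite eE quad_rat_trace ?Crat_rat|exact: rpredD].
have /intrP[c cE] : (e - nu e) * sqrtC m%:R \in Num.int.
  apply: Cint_rat_Aint; first by rewrite eE quad_rat_diff ?Crat_rat.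
  by apply: rpredM; [exact: rpredB|exact: Aint_sqrtC_nat].
by exists n, c.
Qed.

(** Here t is the trace plus 2. For norm 1, (e - nu e)^2 is the squared trace minus 4, that is t (t
    - 4), and multiplying by m yields the square of an integer. This later restricts the primes of
    odd exponent in t. *)
Lemma fund_unit_trace : e * nu e = 1 ->
  exists t c : nat, [/\ (4 < t)%N, (1 + e) ^+ 2 = t%:R * e & (t * (t - 4) * m = c ^ 2)%N].
Proof.
move=> en; have [n [c [nE cE]]] := fund_unit_int.
have e1 := fund_unit_gt1; have e0 := fund_unit_gt0.
have n2 : 2 < n.
  rewrite -(ltr_int algC) -nE -(ltr_pM2l e0) [e * (e + _)]mulrDr en -subr_gt0.
  have -> : e * e + 1 - e * 2 = (e - 1) ^+ 2 by ring.
  by rewrite exprn_gt0 // subr_gt0.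
have [t tE] : exists t : nat, n = t%:Z - 2 by exists (absz (n + 2)); lia.
exists t, `|c|%N; split.
- lia.
- have -> : (1 + e) ^+ 2 = (e + nu e + 2) * e.
    by rewrite mulrDl mulrDl [nu e * e]mulrC en; ring.
  rewrite nE tE; congr (_ * _); rewrite rmorphB /=; ring.
- suff : (t%:Z * (t%:Z - 4) * m%:Z) = c ^+ 2 by nia.
  apply: (@intr_inj algC); rewrite rmorphXn /= -cE exprMn sqrtCK.
  have -> : (e - nu e) ^+ 2 = (e + nu e) ^+ 2 - 4.
    have -> : (4 : algC) = 4 * (e * nu e) by rewrite en; ring.
    by ring.
  rewrite nE tE !rmorphM !rmorphB /=; ring.
Qed.

(** Norm -1 would give c^2 = (n^2 + 4) m with n the trace; this fails modulo 4, after division by 4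
    when n is even. *)
Lemma fund_unit_norm3 : (m %% 4 = 3)%N -> e * nu e = 1.
Proof.
move=> m3; case: fund_unit_norm => // en; have [n [c [nE cE]]] := fund_unit_int.
have h : c ^+ 2 = (n ^+ 2 + 4) * m%:Z.
  apply: (@intr_inj algC); rewrite rmorphXn /= -cE exprMn sqrtCK.
  have -> : (e - nu e) ^+ 2 = (e + nu e) ^+ 2 + 4.
    have -> : (4 : algC) = - (4 * (e * nu e)) by rewrite en; ring.
    by ring.
  rewrite nE rmorphM rmorphD rmorphXn /=; ring.
have [k mE] : exists k : nat, m = (4 * k + 3)%N by exists (m %/ 4)%N; lia.
have [n' [nE'|nE']] : exists n', n = 2 * n' \/ n = 2 * n' + 1.
  by exists (n %/ 2)%Z; lia.
- have [c' cE'] : exists c', c = 2 * c'.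
    exists (c %/ 2)%Z; have [] : c = 2 * (c %/ 2)%Z \/ c = 2 * (c %/ 2)%Z + 1 by lia.
      by [].
    by move: (c %/ 2)%Z => c' cE''; exfalso; move: h; rewrite cE'' nE'; lia.
  have h' : c' ^+ 2 = (n' ^+ 2 + 1) * m%:Z by move: h; rewrite cE' nE'; lia.
  have [a aE] : exists a, n' = 2 * a \/ n' = 2 * a + 1 by exists (n' %/ 2)%Z; lia.
  have [b bE] : exists a, c' = 2 * a \/ c' = 2 * a + 1 by exists (c' %/ 2)%Z; lia.
  by move: h'; rewrite mE; case: aE => ->; case: bE => ->; lia.
- have [b bE] : exists a, c = 2 * a \/ c = 2 * a + 1 by exists (c %/ 2)%Z; lia.
  by move: h; rewrite mE nE'; case: bE => ->; lia.
Qed.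

Lemma fund_unit_nonsquare w : quad_field m w -> w ^+ 2 = e \/ w ^+ 2 = - e -> False.
Proof.
move=> Kw; have e1 := fund_unit_gt1; have e0 := fund_unit_gt0.
have sf : is_subfield (quad_field m) := gen_field_subfield _.
have wR := quad_field_real Kw.
case=> we; last first.
  by have := realEsqr w; rewrite wR we oppr_ge0 lt_geF.
have [eu _ gen] := fund.
have [|n wE] := gen w; first by apply: (unit_group_sqrt sf) => //; rewrite we.
have : e ^ (n * 2) = e ^ 1.
  rewrite expr1z -exprz_exp; change ((e ^ n) ^+ 2 = e).
  by rewrite -[RHS]we; case: wE => ->; rewrite ?sqrrN.
by move/(exprz_gt1_inj e1); lia.
Qed.

(** Since (1 + e)^2 = t e, an integer square root of t or of t m would produce a square root of e in
    the quadratic field. *)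
Lemma fund_unit_trace_nonsquare t : (0 < t)%N -> (0 < m)%N ->
  (1 + e) ^+ 2 = t%:R * e -> ~ natsq t /\ ~ natsq (t * m).
Proof.
move=> t0 m0 te; have sf : is_subfield (quad_field m) := gen_field_subfield _.
have Ke := fund_unit_mem.
have K1e : quad_field m (1 + e) by apply: (subfieldD sf) => //; exact: subfield1.
have tN0 : t%:R != 0 :> algC by rewrite pnatr_eq0 -lt0n.
have mN0 : m%:R != 0 :> algC by rewrite pnatr_eq0 -lt0n.
split=> -[z zE].
  apply: (@fund_unit_nonsquare ((1 + e) / z%:R)).
    by apply: (subfield_div sf) => //; exact: subfield_nat.
  by left; rewrite expr_div_n te -natrX -zE mulrAC mulfV ?mul1r.
apply: (@fund_unit_nonsquare ((1 + e) * sqrtC m%:R / z%:R)).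
  apply: (subfield_div sf); last exact: subfield_nat.
  by apply: (subfieldM sf) => //; exact: mem_gen_field.
left; rewrite expr_div_n exprMn te sqrtCK -natrX -zE natrM; field.
by rewrite tN0 mN0.
Qed.

Lemma norm_one_sixth v : (0 < m)%N -> nu 'i = 'i ->
    unit_group (gen_field [set` [:: 'i; sqrtC m%:R]]) v -> v * nu v = 1 ->
  exists n : int, v ^+ 6 = e ^ n \/ v ^+ 6 = - e ^ n.
Proof.
move=> m0 nui; set F := gen_field _ => vu vn.
have sfF : is_subfield F := gen_field_subfield _.
have sfQ : is_subfield (quad_field m) := gen_field_subfield _.
have sm0 := sqrtC_nat_eq0 m0.
have FE : F = quad_ext (quad_field m) 'i.
  rewrite /F gen_field_cons -?quad_fieldE //.
  by rewrite sqrCi; apply: (subfieldN sfQ); exact: subfield1.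
have conjF u : F u -> F u^*.
  apply: gen_field_rmorph => // z /=; rewrite !inE => /orP[]/eqP ->.
    rewrite conjCi; apply: (subfieldN sfF); apply: mem_gen_field; exact: mem_head.
  by rewrite conj_sqrtC_nat; apply: mem_gen_field; rewrite /= !inE eqxx orbT.
have nuF u : F u -> F (nu u).
  apply: gen_field_rmorph => // z /=; rewrite !inE => /orP[]/eqP ->.
    rewrite nui; apply: mem_gen_field; exact: mem_head.
  by rewrite num; apply: (subfieldN sfF); apply: mem_gen_field; rewrite /= !inE eqxx orbT.
have nu_conj u : F u -> nu u^* = (nu u)^*.
  apply: (@gen_field_eq_rmorph _ (nu \o Num.conj) (Num.conj \o nu)) => z /=.
  rewrite !inE => /orP[]/eqP -> /=.
    by rewrite nui conjCi rmorphN nui.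
  have h : (sqrtC m%:R)^* = sqrtC m%:R := conj_sqrtC_nat m.
  by rewrite h num rmorphN /= h.
have conj_fix u : F u -> u^* = u -> quad_field m u.
  rewrite FE => Fu; apply: (@quad_ext_fixed _ 'i Num.conj u) => //=.
  - apply: (@gen_field_eq_rmorph _ Num.conj idfun) => z -> /=; exact: conj_sqrtC_nat.
  - exact: conjCi.
  - exact: neq0Ci.
have nu_fix u : quad_field m u -> nu u = u -> u \in Crat.
  rewrite quad_field_quad_ext => Fu nuu.
  have ratE t : rat_field t -> nu t = t by exact: aut_Crat.
  exact: (quad_ext_fixed rat_field_subfield ratE num sm0 Fu nuu).
have v0 := unit_group_neq0 vu.
have vc0 : v^* != 0 by rewrite fmorph_eq0.
have vcu : unit_group F v^* by exact: unit_group_aut.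
have nuv : nu v = v^-1 by rewrite -[RHS]mulr1 -vn mulKf.
have [_ _ gen] := fund.
have [n nE] : exists n : int, v * v^* = e ^ n \/ v * v^* = - e ^ n.
  apply: gen; apply: (@unit_group_in F) => //; last exact: unit_groupM.
  apply: conj_fix; first exact: subfieldM sfF _ _ (unit_group_mem vu) (unit_group_mem vcu).
  by rewrite rmorphM /= conjCK mulrC.
pose z := v / v^*.
have zc : z^* = v^* / v by rewrite /z rmorphM fmorphV /= conjCK.
have zu : unit_group F z by apply: unit_groupM => //; exact: unit_groupV.
have nuz : nu z = z^*.
  rewrite zc /z rmorphM fmorphV /= nu_conj ?nuv; last exact: unit_group_mem vu.
  by rewrite fmorphV invrK mulrC.
have zz : z * z^* = 1 by rewrite zc /z; field; rewrite vc0 v0.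
have zQ : z + z^* \in Crat.
  have Fz := unit_group_mem zu.
  apply: nu_fix; last first.
    by rewrite rmorphD /= nu_conj // nuz conjCK addrC.
  apply: conj_fix; last by rewrite rmorphD /= conjCK addrC.
  by apply: (subfieldD sfF) => //; exact: conjF.
have v2 : v ^+ 6 = (v * v^*) ^+ 3 * z ^+ 3 by rewrite /z; field; rewrite vc0.
have zN0 := unit_group_neq0 zu.
exists (n * 3); rewrite v2 -exprz_exp; change (?x ^ 3) with (x ^+ 3).
case: (unit_circle_quad (unit_group_Aint zu) zz zQ) => z3.
- exfalso; have z4 : (z - 'i) * (z + 'i) = 0 by rewrite -subr_sqr z3 sqrCi subrr.
  have nuzz : nu z = z.
    move/eqP: z4; rewrite mulf_eq0 subr_eq0 addr_eq0 => /orP[]/eqP ->.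
      by [].
    by rewrite rmorphN nui.
  by move: z3; rewrite expr2 -{2}nuzz nuz zz => /eqP; rewrite -addr_eq0 -(natrD _ 1 1) pnatr_eq0.
- by rewrite z3 mulr1; case: nE => ->; [left|right; rewrite exprNn; ring].
- by rewrite z3 mulrN1; case: nE => ->; [right|left; rewrite exprNn; ring].
Qed.

End QuadUnit.

(** * Counting cosets *)

Lemma has_card_range (T : Type) (A : set T) n (f : 'I_n -> T) :
  injective f -> A = range f -> has_card A n.
Proof.
move=> inj_f ->; rewrite /has_card.
apply: card_eq_trans (inj_card_eq (in2W inj_f)) _.
by rewrite card_eq_sym; exact: card_II.
Qed.

Lemma leq_card_rel (V W : finType) (A : {set V}) (B : {set W}) (R : V -> W -> Prop) :
    (forall a, a \in A -> exists2 b, b \in B & R a b) ->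
    (forall a a' b, R a b -> R a' b -> a = a') ->
  (#|A| <= #|B|)%N.
Proof.
move=> tot inj.
have [b0 _|noB] := pickP (mem B); last first.
  suff -> : A = finset.set0 by rewrite cards0.
  apply/setP => a; rewrite finset.inE; apply/negP => /tot[b bB _].
  by have := noB b; rewrite /= bB.
(* [b0] is only a default: on [A] the search succeeds. *)
pose f a := odflt b0 [pick b in B | `[< R a b >]].
have fP a : a \in A -> f a \in B /\ R a (f a).
  move=> aA; rewrite /f; case: pickP => [b /andP[bB /asboolP rab] //|no].
  by have [b bB rab] := tot a aA; have := no b; rewrite bB /=; case: asboolP.
have injf : {in A &, injective f}.
  by move=> a a' /fP[_ ra] /fP[_ ra'] eqf; apply: inj ra _; rewrite eqf.
rewrite -(card_in_imset injf); apply: subset_leq_card.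
by apply/fintype.subsetP => _ /imsetP[a /fP[fB _] ->].
Qed.

Definition xor3 (g h : bool * bool * bool) : bool * bool * bool :=
  (g.1.1 (+) h.1.1, g.1.2 (+) h.1.2, g.2 (+) h.2).

Lemma xor3K g : involutive (xor3 g).
Proof. by move: g => [[[] []] []] [[[] []] []]. Qed.

(** Equality of values of f makes [R] an equivalence relation whose classes are translates of W,
    each with |W| elements; one representative from each class enumerates A without repetition. *)
Lemma card_xor_quotient (T : Type) (A : set T) (f : bool * bool * bool -> T)
    (W : {set bool * bool * bool}) :
    (forall g, A (f g)) -> (forall t, A t -> exists g, t = f g) ->
    (forall g h, f g = f h <-> xor3 g h \in W) ->
  has_card A (8 %/ #|W|).
Proof.
move=> fA surj eqf.
pose R g h := xor3 g h \in W.
have eqR : {in finset.setT & &, equivalence_rel R}.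
  move=> g h l _ _ _; split; first exact/eqf.
  move=> /eqf gh; apply/idP/idP => /eqf e; apply/eqf; by rewrite -?gh // gh.
pose P := equivalence_partition R finset.setT.
have partP : finset.partition P finset.setT := equivalence_partitionP eqR.
have cardB : {in P, forall B : {set _}, #|B| = #|W|}.
  move=> B /imsetP[g _ ->]; rewrite -(card_preimset W (inv_inj (xor3K g))).
  by apply: eq_card => h; rewrite !finset.inE.
have trX := transversalP partP; set X := transversal P _ in trX.
have cardX : (#|X| * #|W| = 8)%N.
  rewrite (card_transversal trX) -(card_uniform_partition cardB partP) cardsT.
  by rewrite !card_prod card_bool.
have W0 : (0 < #|W|)%N by move: cardX; case: #|W| => //; rewrite muln0.
rewrite -cardX mulnK //.
have repX g : exists2 h, h \in X & f h = f g.
  have Pg : finset.pblock P g \in P by rewrite finset.pblock_mem // (cover_partition partP) finset.inE.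
  exists (transversal_repr g X (finset.pblock P g)); first exact: (repr_mem_transversal trX g Pg).
  have := repr_mem_pblock trX g Pg.
  by rewrite pblock_equivalence_partition ?finset.inE // => /eqf ->.
apply: (@has_card_range _ _ _ (fun i => f (enum_val i))).
  move=> i j /eqf; rewrite -/(R _ _) -(pblock_equivalence_partition eqR) ?finset.inE // => ij.
  apply: enum_val_inj; apply: (pblock_inj trX); rewrite ?enum_valP //.
  apply/esym/same_pblock => //; by case/and3P: partP.
apply/seteqP; split=> [t /surj[g ->]|t [i _ <-]]; last exact: fA.
have [h hX <-] := repX g; exists (enum_rank_in hX h) => //=.
by rewrite enum_rankK_in.
Qed.

(** * Capitulation and units of relative norm one *)

Definition scale_set (c : algC) (I : set algC) : set algC := [set c * a | a in I].

(** The part of being a fractional ideal that sums and scaling preserve, without nonvanishing or a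
    common denominator. *)
Definition int_module (K I : set algC) : Prop :=
  [/\ I 0, forall a b, I a -> I b -> I (a + b)
    & forall r a, int_ring K r -> I a -> I (r * a)].

Lemma int_module_sum K I (T : eqType) (s : seq T) (f : T -> algC) :
  int_module K I -> (forall t, t \in s -> I (f t)) -> I (\sum_(t <- s) f t).
Proof.
move=> [I0 ID _]; elim: s => [|t s ih] fs; first by rewrite big_nil.
rewrite big_cons; apply/ID; first by apply: fs; rewrite mem_head.
by apply: ih => i si; apply: fs; rewrite inE si orbT.
Qed.

Lemma fractional_int_module K I : is_subfield K -> fractional_ideal K I -> int_module K I.
Proof.
move=> sK [_ [a Ia _] ID IM _]; split=> //.
by rewrite -(mul0r a); apply: IM => //; exact: int_ring0.
Qed.

Lemma scale_int_module K I c : int_module K I -> int_module K (scale_set c I).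
Proof.
move=> [I0 ID IM]; split.
- by exists 0; rewrite ?mulr0.
- move=> _ _ [a Ia <-] [b Ib <-]; exists (a + b); last by rewrite mulrDr.
  exact: ID.
- move=> r _ rK [a Ia <-]; exists (r * a); last by rewrite mulrCA.
  exact: IM.
Qed.

Lemma int_ring_int_module K : is_subfield K -> int_module K (int_ring K).
Proof.
move=> sK; split; [exact: int_ring0|exact: int_ringD|exact: int_ringM].
Qed.

Lemma principal_int_module K c : is_subfield K -> int_module K (principal_ideal K c).
Proof. by move=> sK; apply/scale_int_module/int_ring_int_module. Qed.

Lemma mem_principal K c : is_subfield K -> principal_ideal K c c.
Proof. by move=> sK; exists 1; [exact: int_ring1|rewrite mulr1]. Qed.

Lemma scale_scale c b I : scale_set c (scale_set b I) = scale_set (c * b) I.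
Proof.
apply/seteqP; split=> [_ [_ [a Ia <-] <-]|_ [a Ia <-]].
  by exists a; rewrite ?mulrA.
by exists (b * a); rewrite ?mulrA //; exists a.
Qed.

Lemma scale1 I : scale_set 1 I = I.
Proof.
apply/seteqP; split=> [_ [a Ia <-]|a Ia]; first by rewrite mul1r.
by exists a; rewrite ?mul1r.
Qed.

Lemma ideal_mul_principal K I c : is_subfield K -> int_module K I ->
  ideal_mul I (principal_ideal K c) = scale_set c I.
Proof.
move=> sK modI; have [I0 ID IM] := modI; apply/seteqP; split=> [_ [s [hs ->]]|_ [a Ia <-]].
  apply: (int_module_sum (scale_int_module c modI)) => -[a b] /hs[/= Ia [r rK <-]].
  by exists (r * a); [exact: IM|ring].
exists [:: (a, c)]; split; last by rewrite big_seq1 /= mulrC.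
move=> t; rewrite inE => /eqP -> /=; split=> //; exact: mem_principal.
Qed.

Lemma ideal_classE K I : is_subfield K -> int_module K I ->
  ideal_class K I = [set scale_set c I | c in K `\ 0].
Proof.
move=> sK modI; apply/seteqP; split=> [_ [c Kc <-]|_ [c Kc <-]];
  by exists c => //; rewrite ideal_mul_principal.
Qed.

Lemma mem_ideal_class K I : is_subfield K -> int_module K I -> ideal_class K I I.
Proof.
move=> sK modI; rewrite ideal_classE //; exists 1; last exact: scale1.
by split; [exact: subfield1|apply/eqP; exact: oner_neq0].
Qed.

Lemma ideal_class_scale K I b : is_subfield K -> int_module K I -> K b -> b != 0 ->
  ideal_class K (scale_set b I) = ideal_class K I.
Proof.
move=> sK modI Kb b0; rewrite !ideal_classE //; last exact: scale_int_module.
apply/seteqP; split=> [_ [c [Kc c0] <-]|_ [c [Kc c0] <-]].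
  exists (c * b); last by rewrite scale_scale.
  split; first exact: subfieldM.
  by apply/eqP; rewrite mulf_neq0 //; apply/eqP.
exists (c / b); last by rewrite scale_scale divfK.
split; first exact: subfield_div.
by apply/eqP; rewrite mulf_neq0 ?invr_eq0 //; apply/eqP.
Qed.

Section Capitulation.
Variables (k L : set algC) (sigma : {rmorphism algC -> algC}).
Hypotheses (sfk : is_subfield k) (sfL : is_subfield L) (kL : k `<=` L).
Hypotheses (sigmaL : forall u, L u -> L (sigma u))
  (sigmaK : forall u, L u -> sigma (sigma u) = u)
  (sigma_fix : forall u, k u -> sigma u = u)
  (fix_sigma : forall u, L u -> sigma u = u -> k u).
(** [z] serves Hilbert 90 at -1, where 1 + u vanishes, and [omega] is an integer of trace 1. The
    list [cs] expresses that L / k is unramified: the differences y - sigma y of integers generate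
    the unit ideal. *)
Variables (z omega : algC).
Hypotheses (zL : int_ring L z) (z_neq0 : z != 0) (sigma_z : sigma z = - z).
Hypotheses (omegaL : int_ring L omega) (omega_trace : omega + sigma omega = 1).
Variable cs : seq (algC * algC).
Hypothesis csL : forall t, t \in cs -> int_ring L t.1 /\ int_ring L t.2.
Hypothesis cs_sum : \sum_(t <- cs) t.1 * (t.2 - sigma t.2) = 1.

Local Notation O := (int_ring L).
Local Notation prin := (principal_ideal L).

Lemma sigma_int u : O u -> O (sigma u).
Proof. by move=> [Lu Au]; split; [exact: sigmaL|rewrite /= Aint_aut]. Qed.

Lemma trace_mem u : L u -> k (u + sigma u).
Proof.
move=> Lu; apply: fix_sigma.
  by apply: (subfieldD sfL) => //; exact: sigmaL.
by rewrite rmorphD /= sigmaK // addrC.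
Qed.

Lemma trace_int u : O u -> int_ring k (u + sigma u).
Proof.
move=> Ou; split; first by apply: trace_mem; case: Ou.
by apply: rpredD; [case: Ou|case: (sigma_int Ou)].
Qed.

Definition descend (a : algC) : set algC := prin a `&` k.

Lemma descend_int_module a : int_module k (descend a).
Proof.
have [P0 PD PM] := principal_int_module a sfL; split.
- by split=> //; exact: subfield0.
- by move=> u v [pu ku] [pv kv]; split; [exact: PD|exact: subfieldD].
- move=> r u [kr Ar] [pu ku]; split; last exact: subfieldM.
  by apply: PM => //; split=> //; exact: kL.
Qed.

(* Galois descent: if sum c_i (z_i - sigma z_i) = 1, then every y satisfies
   y = sum c_i Tr(z_i y) - (sum c_i sigma z_i) Tr(y), and the traces lie in the
   ideal when the latter is stable under sigma. *)
Lemma descend_extend a : L a -> prin a (sigma a) ->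
  ideal_mul (descend a) O = prin a.
Proof.
move=> La [r Or ra]; have modP := principal_int_module a sfL.
apply/seteqP; split=> [_ [s [hs ->]]|y py].
  apply: (int_module_sum modP) => -[u v] /hs[/= [pu _] Ov].
  by rewrite mulrC; case: modP => _ _ PM; exact: PM.
have [P0 PD PM] := modP.
have psigma u : prin a u -> prin a (sigma u).
  move=> [v Ov <-]; rewrite rmorphM /= -ra -mulrA; exists (r * sigma v) => //.
  by apply: (int_ringM sfL) => //; exact: sigma_int.
have Lp u : prin a u -> L u.
  by move=> [v [Lv _] <-]; exact: subfieldM.
have ptr u : prin a u -> descend a (u + sigma u).
  move=> pu; split; last by apply/trace_mem/Lp.
  by apply/PD => //; exact: psigma.
exists ((y + sigma y, - \sum_(t <- cs) t.1 * sigma t.2) ::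
  [seq (t.2 * y + sigma (t.2 * y), t.1) | t <- cs]); split.
  move=> t; rewrite inE => /orP[/eqP->|/mapP[[c u] /csL[/= Oc Ou] ->]] /=.
    split; first exact: ptr.
    have [O0 OD OM] := int_ring_int_module sfL.
    rewrite -mulN1r; apply/OM.
      by split; [apply: (subfieldN sfL); exact: subfield1|rewrite /= rpredN rpred1].
    apply: (int_module_sum (int_ring_int_module sfL)) => -[c u] /csL[/= Oc Ou].
    by apply/OM => //; exact: sigma_int.
  by split=> //; apply/ptr/PM.
rewrite big_cons big_map /=.
have -> : \sum_(t <- cs) (t.2 * y + sigma (t.2 * y)) * t.1 =
    (\sum_(t <- cs) t.1 * (t.2 - sigma t.2)) * y +
    (\sum_(t <- cs) t.1 * sigma t.2) * (y + sigma y).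
  rewrite !mulr_suml -big_split /=; apply: eq_bigr => t _.
  by rewrite rmorphM /=; ring.
by rewrite cs_sum; ring.
Qed.

(** Since omega has trace 1, an element y of k is the trace of omega y; expanding y as a sum of x_j
    y_j with x_j in I gives the sum of x_j Tr(omega y_j), which lies in I. *)
Lemma extend_contract I : I `<=` k -> int_module k I -> ideal_mul I O `&` k = I.
Proof.
move=> Ik modI; have [I0 ID IM] := modI; apply/seteqP; split=> [y [[s [hs ysum]] ky]|y Iy].
  have -> : y = \sum_(t <- s) (omega * t.2 + sigma (omega * t.2)) * t.1.
    transitivity (omega * y + sigma (omega * y)).
      by rewrite rmorphM /= (sigma_fix ky) -mulrDl omega_trace mul1r.
    rewrite ysum mulr_sumr rmorph_sum -big_split /= !big_seq; apply: eq_bigr => t ts.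
    have [It _] := hs t ts.
    by rewrite !rmorphM /= (sigma_fix (Ik _ It)); ring.
  apply: (int_module_sum modI) => t /hs[It Ot]; apply/IM => //.
  by apply: trace_int; exact: (int_ringM sfL).
split; last exact: Ik.
exists [:: (y, 1)]; split; last by rewrite big_seq1 mulr1.
by move=> t; rewrite inE => /eqP -> /=; split=> //; exact: int_ring1.
Qed.

Lemma prin_scale c a : prin (c * a) = scale_set c (prin a).
Proof. by rewrite /principal_ideal -[LHS]/(scale_set _ _) -scale_scale. Qed.

Lemma ideal_mul_scale c I J : ideal_mul (scale_set c I) J = scale_set c (ideal_mul I J).
Proof.
apply/seteqP; split=> [_ [s [hs ->]]|_ [_ [s [hs ->]] <-]].
  elim: s hs => [|[a b] s ih] hs.
    exists 0; last by rewrite mulr0 big_nil.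
    by exists [::]; rewrite big_nil.
  have [|_ [s' [hs' ->]] eq] := ih; first by move=> t ts; apply: hs; rewrite inE ts orbT.
  have [/= [a' Ia <-] Jb] := hs _ (mem_head _ _).
  rewrite big_cons /= -eq.
  exists (\sum_(t <- (a', b) :: s') t.1 * t.2).
    exists ((a', b) :: s'); split=> // t.
    by rewrite inE => /orP[/eqP-> //|/hs'].
  by rewrite big_cons /=; ring.
exists [seq (c * t.1, t.2) | t <- s]; split.
  by move=> t /mapP[t' /hs[It Jt] ->] /=; split=> //; exists t'.1.
by rewrite big_map mulr_sumr; apply: eq_bigr => t _ /=; rewrite mulrA.
Qed.

Lemma descend_scale c a : k c -> c != 0 -> descend (c * a) = scale_set c (descend a).
Proof.
move=> kc c0; rewrite /descend prin_scale; apply/seteqP; split.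
  move=> _ [[u pu <-] ku]; exists u => //; split=> //.
  by rewrite -(mulKf c0 u); apply: (subfieldM sfk) => //; exact: subfieldV.
by move=> _ [u [pu ku] <-]; split; [exists u|exact: subfieldM].
Qed.

Lemma prin_unit a v : unit_group L v -> prin (a * v) = prin a.
Proof.
move=> [v0 Ov Ov']; apply/seteqP; split=> _ [r Or <-].
  by exists (v * r); [exact: (int_ringM sfL)|rewrite mulrA].
by exists (v^-1 * r); [exact: (int_ringM sfL)|rewrite -mulrA mulVKf].
Qed.

(** * Capitulating classes attached to units of relative norm one *)

Definition norm1_unit u : Prop := unit_group L u /\ u * sigma u = 1.

(** An explicit nonzero solution of a = u sigma a: 1 + u works for u of norm 1 other than -1. *)
Definition hilbert90 (u : algC) : algC := if u == -1 then z else 1 + u.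

Lemma hilbert90_int u : norm1_unit u -> O (hilbert90 u).
Proof.
move=> [[_ Ou _] _]; rewrite /hilbert90; case: eqP => // _.
by apply: (int_ringD sfL) => //; exact: int_ring1.
Qed.

Lemma hilbert90_neq0 u : hilbert90 u != 0.
Proof.
rewrite /hilbert90; case: (eqVneq u (-1)) => [_|uN1]; first exact: z_neq0.
by rewrite addrC addr_eq0.
Qed.

Lemma hilbert90P u : norm1_unit u -> hilbert90 u = u * sigma (hilbert90 u).
Proof.
move=> [uu un]; rewrite /hilbert90; case: eqVneq => [->|_].
  by rewrite sigma_z mulrNN mul1r.
by rewrite rmorphD rmorph1 mulrDr un mulr1 addrC.
Qed.

(** With a = u sigma a, the ideal a O_L is stable under sigma, hence extended from its contraction
    to k, whose class therefore capitulates. *)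
Definition capitulating_class (u : algC) := ideal_class k (descend (hilbert90 u)).

Lemma fixed_ratio a b u : L a -> L b -> b != 0 ->
  a = u * sigma a -> b = u * sigma b -> k (a / b).
Proof.
move=> La Lb b0 aE bE; apply: fix_sigma; first exact: subfield_div.
have u0 : u != 0 by apply: contraNneq b0 => u0; rewrite bE u0 mul0r.
have sb0 : sigma b != 0 by rewrite fmorph_eq0.
by rewrite rmorphM fmorphV /= [in RHS]aE [in RHS]bE; field; rewrite sb0 u0.
Qed.

Lemma sigma_hilbert90 u : norm1_unit u -> prin (hilbert90 u) (sigma (hilbert90 u)).
Proof.
move=> uN; have [[u0 Ou Ou'] un] := uN.
exists u^-1 => //; rewrite {1}(hilbert90P uN); field; exact: u0.
Qed.

(** Two nonzero solutions of a = u sigma a differ by a factor in k, which does not change the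
    class. *)
Lemma capitulating_classE u a : norm1_unit u -> L a -> a != 0 -> a = u * sigma a ->
  ideal_class k (descend a) = capitulating_class u.
Proof.
move=> uN La a0 aE; set b := hilbert90 u.
have [Lb _] := hilbert90_int uN.
have b0 := hilbert90_neq0 u.
have kc := fixed_ratio La Lb b0 aE (hilbert90P uN).
rewrite -[a](divfK b0) -/b descend_scale ?ideal_class_scale //.
- exact: descend_int_module.
- by rewrite mulf_neq0 ?invr_eq0.
- by rewrite mulf_neq0 ?invr_eq0.
Qed.

(** Equal classes give, after extension to L, a O_L = c a' O_L with c in k, so a = c a' v for a unit
    v; comparison with the image under sigma, which fixes c, relates u to u'. *)
Lemma capitulating_class_eq u u' : norm1_unit u -> norm1_unit u' ->
  capitulating_class u = capitulating_class u' <->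
  exists2 v, unit_group L v & u * sigma v = u' * v.
Proof.
move=> uN uN'; set a := hilbert90 u; set a' := hilbert90 u'.
have [La _] := hilbert90_int uN; have [La' _] := hilbert90_int uN'.
have a0 := hilbert90_neq0 u; have a0' := hilbert90_neq0 u'.
have aE := hilbert90P uN; have aE' := hilbert90P uN'.
have [[u0 _ _] _] := uN; have [[u0' _ _] _] := uN'.
split=> [eqc|[v vu uv]]; last first.
  have v0 := unit_group_neq0 vu; have Lv := unit_group_mem vu.
  rewrite -(@capitulating_classE u (a' * v)) //.
  - by rewrite /descend prin_unit.
  - exact: subfieldM.
  - exact: mulf_neq0.
  - by rewrite rmorphM /= mulrCA uv mulrA [_ * u']mulrC -aE'.
have : capitulating_class u' (descend a).
  by rewrite -eqc; apply: mem_ideal_class => //; exact: descend_int_module.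
rewrite /capitulating_class ideal_classE //; last exact: descend_int_module.
move=> [c [kc /eqP c0] eqI].
have pE : prin a = prin (c * a').
  rewrite -(descend_extend La (sigma_hilbert90 uN)) -eqI ideal_mul_scale.
  by rewrite descend_extend // ?prin_scale //; exact: sigma_hilbert90.
have [r Or rE] : prin (c * a') a by rewrite -pE; exact: mem_principal.
have [r' Or' rE'] : prin a (c * a') by rewrite pE; exact: mem_principal.
have rr' : r * r' = 1.
  by apply: (mulfI (mulf_neq0 c0 a0')); rewrite mulr1 mulrA rE.
have r0 : r != 0 by apply: contra_eq_neq rr' => ->; rewrite mul0r eq_sym oner_eq0.
exists r.
  by split=> //; suff -> : r^-1 = r' by []; rewrite -[RHS](mulKf r0) rr' mulr1.
have sa0 : sigma a' != 0 by rewrite fmorph_eq0.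
apply: (mulfI (mulf_neq0 c0 sa0)).
have h : c * a' * r = u * (c * sigma a' * sigma r).
  by rewrite rE [LHS]aE -/a -rE !rmorphM /= (sigma_fix kc).
rewrite mulrCA -h; have -> : c * a' * r = c * (u' * sigma a') * r by rewrite -aE'.
by ring.
Qed.

Lemma capitulating_class_in u : norm1_unit u -> capitulation_kernel k L (capitulating_class u).
Proof.
move=> uN; set a := hilbert90 u.
have Oa := hilbert90_int uN; have [La _] := Oa.
have a0 : a != 0 := hilbert90_neq0 u.
have modD := descend_int_module a.
have clE b : L b -> b != 0 -> ideal_class L (prin b) = ideal_class L O.
  by move=> Lb b0; apply: ideal_class_scale => //; exact: int_ring_int_module.
have extE c : k c -> c != 0 ->
    ideal_class L (ideal_mul (scale_set c (descend a)) O) = ideal_class L O.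
  move=> kc c0; rewrite ideal_mul_scale descend_extend //; last exact: sigma_hilbert90.
  rewrite -prin_scale clE //; last exact: mulf_neq0.
  by apply: (subfieldM sfL) => //; exact: kL.
split.
  exists (descend a) => //; have [D0 DD DM] := modD; split=> //.
  - by move=> y [].
  - exists (a * sigma a); last by rewrite mulf_neq0 ?fmorph_eq0.
    split; first by exists (sigma a) => //; exact: sigma_int.
    apply: fix_sigma; first by apply: (subfieldM sfL) => //; exact: sigmaL.
    by rewrite rmorphM /= sigmaK // mulrC.
  - exists 1; first exact: int_ring1.
    split; first exact: oner_neq0.
    move=> y [[r [_ Ar] rE] ky]; rewrite mul1r; split=> //.
    by rewrite /= -rE; apply: rpredM => //; case: Oa.
rewrite /class_extension /capitulating_class; apply/seteqP; split.
  move=> J [I]; rewrite ideal_classE // => -[c [kc /eqP c0] <-].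
  by rewrite extE.
move=> J JO; exists (scale_set 1 (descend a)).
  rewrite ideal_classE //; exists 1 => //.
  by split; [exact: subfield1|apply/eqP; exact: oner_neq0].
by rewrite extE //; [exact: subfield1|exact: oner_neq0].
Qed.

(** If I O_L = a O_L, then sigma a = r a, because sigma fixes I elementwise; applying sigma again
    gives r sigma r = 1, and u = r^-1 is the required unit. Contracting a O_L to k recovers I. *)
Lemma capitulation_kernelP C : capitulation_kernel k L C ->
  exists2 u, norm1_unit u & C = capitulating_class u.
Proof.
move=> [[I fracI <-] ext]; have modI := fractional_int_module sfk fracI.
have [Ik _ _ _ _] := fracI.
set J := ideal_mul I O.
have modJ : int_module L J.
  split.
  - by exists [::]; rewrite big_nil.
  - move=> _ _ [s [hs ->]] [s' [hs' ->]]; exists (s ++ s'); rewrite big_cat; split=> // t.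
    by rewrite mem_cat => /orP[/hs|/hs'].
  - move=> r _ Or [s [hs ->]]; exists [seq (t.1, r * t.2) | t <- s]; split.
      by move=> t /mapP[t' /hs[It Ot] ->] /=; split=> //; exact: (int_ringM sfL).
    by rewrite big_map mulr_sumr; apply: eq_bigr => t _ /=; rewrite mulrCA.
have : ideal_class L O J.
  rewrite -ext; exists I; first exact: mem_ideal_class.
  exact: mem_ideal_class.
rewrite ideal_classE //; last exact: int_ring_int_module.
move=> [a [La /eqP a0] JE].
have pa : J = prin a by rewrite -JE.
have sJ y : J y -> J (sigma y).
  move=> [s [hs ->]]; exists [seq (t.1, sigma t.2) | t <- s]; split.
    by move=> t /mapP[t' /hs[It Ot] ->] /=; split=> //; exact: sigma_int.
  rewrite rmorph_sum big_map !big_seq; apply: eq_bigr => t /hs[It _] /=.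
  by rewrite rmorphM /= (sigma_fix (Ik _ It)).
have [r Or rE] : prin a (sigma a) by rewrite -pa; apply: sJ; rewrite pa; exact: mem_principal.
have rr : r * sigma r = 1.
  apply: (mulfI a0); rewrite mulr1 mulrA rE -rmorphM /= rE sigmaK //.
have r0 : r != 0 by apply: contra_eq_neq rr => ->; rewrite mul0r eq_sym oner_eq0.
have sr : sigma r = r^-1 by rewrite -[LHS](mulKf r0) rr mulr1.
have uN : norm1_unit r^-1.
  split; last by rewrite fmorphV sr invrK mulVf.
  by split; rewrite ?invr_eq0 ?invrK // -sr; exact: sigma_int.
exists r^-1 => //; rewrite -(@capitulating_classE r^-1 a) //.
  by rewrite /descend -pa /J extend_contract.
by rewrite -rE mulrCA mulVf // mulr1.
Qed.

Lemma norm1_unitM u v : norm1_unit u -> norm1_unit v -> norm1_unit (u * v).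
Proof.
move=> [uu un] [vu vn]; split; first exact: unit_groupM.
by rewrite rmorphM /= mulrACA un vn mulr1.
Qed.

Lemma norm1_unitV u : norm1_unit u -> norm1_unit u^-1.
Proof.
move=> [uu un]; split; first exact: unit_groupV.
by rewrite fmorphV -invfM un invr1.
Qed.

Lemma norm1_unit1 : norm1_unit 1.
Proof. by split; [exact: unit_group1|rewrite rmorph1 mulr1]. Qed.

Lemma norm1_unitN1 : norm1_unit (-1).
Proof.
split; first by apply: (unit_groupN sfL); exact: unit_group1.
by rewrite rmorphN rmorph1 mulrNN mulr1.
Qed.

Lemma norm1_unitX n u : norm1_unit u -> norm1_unit (u ^+ n).
Proof.
move=> uN; elim: n => [|n ih]; first exact: norm1_unit1.
by rewrite exprS; exact: norm1_unitM.
Qed.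

(** * The quotients v / sigma v modulo squares and the index formula *)

Definition sigma_quot (v : algC) : algC := v / sigma v.

Definition is_sigma_quot (u : algC) : Prop := exists2 v, unit_group L v & u = sigma_quot v.

Lemma sigma_quotM u v : sigma_quot (u * v) = sigma_quot u * sigma_quot v.
Proof. by rewrite /sigma_quot rmorphM invfM mulrACA. Qed.

Lemma sigma_quotV u : sigma_quot u^-1 = (sigma_quot u)^-1.
Proof. by rewrite /sigma_quot fmorphV invfM. Qed.

Lemma sigma_quot_norm1 u : norm1_unit u -> sigma_quot u = u ^+ 2.
Proof.
move=> [uu un]; rewrite /sigma_quot; suff -> : sigma u = u^-1 by rewrite invrK.
by rewrite -[LHS](mulKf (unit_group_neq0 uu)) un mulr1.
Qed.

Lemma norm1_sigma_quot v : unit_group L v -> norm1_unit (sigma_quot v).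
Proof.
move=> vu; have v0 := unit_group_neq0 vu; have svu := unit_group_aut sigmaL vu.
have sv0 := unit_group_neq0 svu.
split; first by apply: (unit_groupM sfL) => //; exact: unit_groupV.
rewrite /sigma_quot rmorphM fmorphV /= sigmaK; last exact: unit_group_mem vu.
by field; rewrite sv0 v0.
Qed.

Lemma is_sigma_quotM u v : is_sigma_quot u -> is_sigma_quot v -> is_sigma_quot (u * v).
Proof.
move=> [a au ->] [b bu ->]; exists (a * b); first exact: unit_groupM.
by rewrite sigma_quotM.
Qed.

Lemma is_sigma_quot_sq w : norm1_unit w -> is_sigma_quot (w ^+ 2).
Proof. by move=> wN; exists w; [case: wN|rewrite sigma_quot_norm1]. Qed.

Variables (alpha beta io eta : algC).
Hypotheses (alphaN : norm1_unit alpha) (betaN : norm1_unit beta).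
Hypotheses (ioU : unit_group k io) (etaU : unit_group k eta).

Definition norm1_base (g : bool * bool * bool) : algC :=
  (-1) ^+ g.1.1 * alpha ^+ g.1.2 * beta ^+ g.2.

(** [eta] stays a parameter because it will be either the fundamental unit e or a square root of i
    e. *)
Definition unit_base (h : bool * bool) : algC := io ^+ h.1 * eta ^+ h.2.

Hypothesis norm1_rep : forall u, norm1_unit u ->
  exists g w, norm1_unit w /\ u = norm1_base g * w ^+ 2.
Hypothesis norm1_free : forall g w, norm1_unit w -> norm1_base g = w ^+ 2 ->
  g = (false, false, false).
Hypothesis unit_rep : forall e, unit_group k e ->
  exists h f, unit_group k f /\ e = unit_base h * f ^+ 2.
Hypothesis unit_free : forall h f, unit_group k f -> unit_base h = f ^+ 2 ->
  h = (false, false).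

Definition is_unit_norm (e : algC) : Prop := exists2 v, unit_group L v & v * sigma v = e.

Definition unit_norms : {set bool * bool} := finset (fun h => `[< is_unit_norm (unit_base h) >]).

Lemma norm1_baseN g : norm1_unit (norm1_base g).
Proof.
apply: norm1_unitM; first apply: norm1_unitM; apply: norm1_unitX => //.
exact: norm1_unitN1.
Qed.

Lemma expr_addb (R : comRingType) (x : R) (a b : bool) :
  x ^+ a * x ^+ b = x ^+ (a (+) b) * (x ^+ (a && b)) ^+ 2.
Proof. by case: a; case: b; rewrite /=; ring. Qed.

(** Modulo squares of M division is multiplication, and the factors common to g and h pair up into
    squares. *)
Lemma norm1_base_xor g h :
  exists2 w, norm1_unit w & norm1_base g / norm1_base h = norm1_base (xor3 g h) * w ^+ 2.
Proof.
exists ((-1) ^+ (g.1.1 && h.1.1) * alpha ^+ (g.1.2 && h.1.2) * beta ^+ (g.2 && h.2)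
    / norm1_base h).
  apply: norm1_unitM; last exact/norm1_unitV/norm1_baseN.
  exact: (norm1_baseN (g.1.1 && h.1.1, g.1.2 && h.1.2, g.2 && h.2)).
have [[h0 _ _] _] := norm1_baseN h.
apply: (mulIf h0); apply: (mulIf h0); rewrite divfK //.
rewrite expr_div_n -[RHS]mulrA -expr2 -[RHS]mulrA divfK ?expf_neq0 //.
rewrite /norm1_base /= !exprMn.
rewrite -!mulrA [(-1) ^+ h.1.1 * _]mulrCA; move: (expr_addb (-1 : algC) g.1.1 h.1.1).
move: (expr_addb alpha g.1.2 h.1.2) (expr_addb beta g.2 h.2) => ea eb es.
transitivity (((-1) ^+ g.1.1 * (-1) ^+ h.1.1) * (alpha ^+ g.1.2 * alpha ^+ h.1.2) *
   (beta ^+ g.2 * beta ^+ h.2)); first by ring.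
by rewrite es ea eb; ring.
Qed.

Definition base_quots : {set bool * bool * bool} :=
  finset (fun g => `[< is_sigma_quot (norm1_base g) >]).

(** The classes agree when the quotient of the two units is some v / sigma v; squares w^2 with w in
    M are of this form, since sigma w = w^-1. *)
Lemma capitulating_class_base_eq g h :
  capitulating_class (norm1_base g) = capitulating_class (norm1_base h) <->
  xor3 g h \in base_quots.
Proof.
rewrite finset.inE; have [w wN wE] := norm1_base_xor g h.
have w0 : w ^+ 2 != 0 by rewrite expf_neq0 // (unit_group_neq0 wN.1).
have gN := norm1_baseN g; have hN := norm1_baseN h.
have h0 := unit_group_neq0 hN.1.
rewrite capitulating_class_eq //; split=> [[v vu e]|/asboolP q].
  have sv0 : sigma v != 0 by rewrite fmorph_eq0 (unit_group_neq0 vu).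
  apply/asboolP; have -> : norm1_base (xor3 g h) = sigma_quot v * w^-1 ^+ 2.
    apply: (mulIf w0); rewrite -wE exprVn mulfVK //.
    by apply: (mulIf h0); apply: (mulIf sv0); rewrite divfK // e /sigma_quot; field.
  apply: is_sigma_quotM; first by exists v.
  exact/is_sigma_quot_sq/norm1_unitV.
have [v vu vE] := is_sigma_quotM q (is_sigma_quot_sq wN).
have sv0 : sigma v != 0 by rewrite fmorph_eq0 (unit_group_neq0 vu).
exists v => //; move: vE; rewrite -wE /sigma_quot => vE.
by rewrite -[norm1_base g](divfK h0) vE; field.
Qed.

Lemma norm_unit v : unit_group L v -> unit_group k (v * sigma v).
Proof.
move=> vu; have svu := unit_group_aut sigmaL vu.
apply: (@unit_group_in L) => //; last exact: unit_groupM.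
have Lv := unit_group_mem vu.
apply: fix_sigma; first by apply: (subfieldM sfL) => //; exact: sigmaL.
by rewrite rmorphM /= sigmaK // mulrC.
Qed.

(* The maps v |-> v / sigma v and v |-> v * sigma v on the units of L have
   the same kernel modulo squares, namely the units of k times the norm-one
   units. *)
Lemma card_base_quots : #|base_quots| = #|unit_norms|.
Proof.
apply/eqP; rewrite eqn_leq; apply/andP; split.
- apply: (@leq_card_rel _ _ _ _ (fun g h => exists2 v, unit_group L v &
    sigma_quot v = norm1_base g /\
    exists2 f, unit_group k f & v * sigma v = unit_base h * f ^+ 2)).
    move=> g; rewrite finset.inE => /asboolP[v vu gE].
    have [h [f [fu hE]]] := unit_rep (norm_unit vu).
    have f0 := unit_group_neq0 fu.
    exists h; last by exists v => //; split=> //; exists f.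
    rewrite finset.inE; apply/asboolP; exists (v / f).
      by apply: (unit_groupM sfL) => //; apply: (unit_groupV); exact: unit_group_sub fu.
    rewrite rmorphM fmorphV /= (sigma_fix (unit_group_mem fu)) mulrACA hE.
    by field.
  move=> g g' h [v vu [gE [f fu vE]]] [v' vu' [gE' [f' fu' vE']]].
  have f0 := unit_group_neq0 fu; have f0' := unit_group_neq0 fu'.
  have v0 := unit_group_neq0 vu; have v0' := unit_group_neq0 vu'.
  have fuL := unit_group_sub kL fu; have fuL' := unit_group_sub kL fu'.
  have sff' u : unit_group k u -> sigma u = u by move=> uu; exact: sigma_fix (unit_group_mem uu).
  (* [v] and [v'] have the same norm up to the squares of f and f', so y has norm 1 and y / sigma y
     = y^2. *)
  pose y := v * f' / (v' * f).
  have yN : norm1_unit y.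
    split.
      apply: (unit_groupM sfL); first exact: unit_groupM.
      by apply: unit_groupV; exact: unit_groupM.
    rewrite /y !rmorphM fmorphV /= !rmorphM /= (sff' _ fu) (sff' _ fu').
    have -> : v * f' / (v' * f) * (sigma v * f' / (sigma v' * f)) =
      (v * sigma v) * f' ^+ 2 / ((v' * sigma v') * f ^+ 2).
      by field; rewrite f0 v0' fmorph_eq0 v0'.
    rewrite vE vE'; field; rewrite f0 f0' /=.
    apply: contraTneq (mulf_neq0 v0' (_ : sigma v' != 0)) => [|]; last by rewrite fmorph_eq0.
    by move=> h0; rewrite vE' h0 mul0r eqxx.
  have [w wN wE] := norm1_base_xor g g'.
  have w0 := unit_group_neq0 wN.1.
  have sq : norm1_base (xor3 g g') = (y / w) ^+ 2.
    have w20 : w ^+ 2 != 0 by rewrite expf_neq0.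
    apply: (mulIf w20); rewrite -wE expr_div_n divfK // -(sigma_quot_norm1 yN).
    rewrite -gE -gE' /y !sigma_quotM sigma_quotV sigma_quotM.
    have sqf u : unit_group k u -> sigma_quot u = 1.
      by move=> uu; rewrite /sigma_quot sff' // mulfV // (unit_group_neq0 uu).
    by rewrite (sqf _ fu) (sqf _ fu') !mulr1.
  have := norm1_free (norm1_unitM yN (norm1_unitV wN)) sq.
  by move: g g' {sq wE vE vE' gE gE'} => [[[] []] []] [[[] []] []].
- apply: (@leq_card_rel _ _ _ _ (fun h g => exists2 v, unit_group L v &
    v * sigma v = unit_base h /\
    exists2 w, norm1_unit w & sigma_quot v = norm1_base g * w ^+ 2)).
    move=> h; rewrite finset.inE => /asboolP[v vu hE].
    have [g [w [wN gE]]] := norm1_rep (norm1_sigma_quot vu).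
    exists g; last by exists v => //; split=> //; exists w.
    rewrite finset.inE; apply/asboolP; exists (v / w).
      by apply: (unit_groupM sfL) => //; apply: unit_groupV; case: wN.
    rewrite sigma_quotM sigma_quotV gE sigma_quot_norm1 // mulfK //.
    by rewrite expf_neq0 // (unit_group_neq0 wN.1).
  move=> h h' g [v vu [hE [w wN vE]]] [v' vu' [hE' [w' wN' vE']]].
  have v0 := unit_group_neq0 vu; have v0' := unit_group_neq0 vu'.
  have w0 := unit_group_neq0 wN.1; have w0' := unit_group_neq0 wN'.1.
  have g0 := unit_group_neq0 (norm1_baseN g).1.
  (* On M, w / sigma w = w^2, so the correction gives y / sigma y = 1; then y lies in k and has norm
     y^2. *)
  pose y := v * w' / (v' * w).
  have yu : unit_group L y.
    apply: (unit_groupM sfL); first by apply: (unit_groupM sfL) => //; case: wN'.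
    by apply: unit_groupV; apply: (unit_groupM sfL) => //; case: wN.
  have qy : sigma_quot y = 1.
    rewrite /y !sigma_quotM sigma_quotV sigma_quotM vE vE' !sigma_quot_norm1 //.
    by field; rewrite w0 g0 w0'.
  have sy : sigma y = y.
    have y0 := unit_group_neq0 yu; have sy0 : sigma y != 0 by rewrite fmorph_eq0.
    by rewrite -[RHS](divfK sy0) -/(sigma_quot y) qy mul1r.
  have ky : unit_group k y.
    exact: unit_group_in sfk (fix_sigma (unit_group_mem yu) sy) yu.
  have hh' : unit_base h = unit_base h' * y ^+ 2.
    rewrite -hE -hE' expr2 -{2}sy /y !rmorphM fmorphV !rmorphM /=.
    have wn := wN.2; have wn' := wN'.2.
    transitivity (v * sigma v * (w' * sigma w') / (w * sigma w)).
      by rewrite wn wn' divr1 mulr1.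
    by field; rewrite w0 v0' !fmorph_eq0 w0 v0'.
  have io0 := unit_group_neq0 ioU; have eta0 := unit_group_neq0 etaU.
  have hu l : unit_group k (unit_base l) by apply: (unit_groupM sfk); exact: unit_groupX.
  have sq : unit_base (h.1 (+) h'.1, h.2 (+) h'.2) =
     (unit_base h' * y / unit_base (h.1 && h'.1, h.2 && h'.2)) ^+ 2.
    have b0 := unit_group_neq0 (hu (h.1 && h'.1, h.2 && h'.2)).
    have b20 : unit_base (h.1 && h'.1, h.2 && h'.2) ^+ 2 != 0 by rewrite expf_neq0.
    apply: (mulIf b20); rewrite expr_div_n divfK //.
    transitivity (unit_base h * unit_base h'); last by rewrite hh'; ring.
    move: (expr_addb io h.1 h'.1) (expr_addb eta h.2 h'.2) => e1 e2.
    rewrite /unit_base /= [RHS]mulrACA e1 e2; ring.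
  have := unit_free _ sq; rewrite -/(unit_base _) => /(_ _).
  move=> H; have {}H : (h.1 (+) h'.1, h.2 (+) h'.2) = (false, false).
    apply: H; apply: (unit_groupM sfk); last by apply: unit_groupV; exact: hu.
    by apply: (unit_groupM sfk).
  by move: h h' H {sq hh' hE hE'} => [[] []] [[] []].
Qed.

Theorem card_capitulation_kernel :
  has_card (capitulation_kernel k L) (8 %/ #|unit_norms|).
Proof.
rewrite -card_base_quots.
apply: (@card_xor_quotient _ _ (fun g => capitulating_class (norm1_base g))).
- by move=> g; apply/capitulating_class_in/norm1_baseN.
- move=> C /capitulation_kernelP[u uN ->].
  have [g [w [wN uE]]] := norm1_rep uN; exists g.
  have gN := norm1_baseN g.
  apply/capitulating_class_eq => //; exists w; first by case: wN.
  by rewrite uE expr2 mulrA -mulrA wN.2 mulr1.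
- exact: capitulating_class_base_eq.
Qed.

End Capitulation.

(** * The biquadratic case *)

Section SquaresIn.
Variables (K : set algC) (sfK : is_subfield K).

Lemma sq_in_sqr w : K w -> sq_in K (w ^+ 2).
Proof. by move=> Kw; exists w. Qed.

Lemma sq_in1 : sq_in K 1.
Proof. by exists 1; [exact: subfield1|rewrite expr1n]. Qed.

Lemma sq_inM x y : sq_in K x -> sq_in K y -> sq_in K (x * y).
Proof.
move=> [u Ku <-] [v Kv <-]; exists (u * v); last by rewrite exprMn.
exact: subfieldM.
Qed.

Lemma sq_inV x : sq_in K x -> sq_in K x^-1.
Proof. by move=> [u Ku <-]; exists u^-1; rewrite ?exprVn //; exact: subfieldV. Qed.

Lemma sq_in_cancel x y : x != 0 -> sq_in K x -> sq_in K (x * y) -> sq_in K y.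
Proof. by move=> x0 sx sxy; rewrite -(mulKf x0 y); apply: sq_inM => //; exact: sq_inV. Qed.

End SquaresIn.

Lemma natsq_mod4 n : natsq n -> (n %% 4 = 0)%N \/ (n %% 4 = 1)%N.
Proof.
move=> [z ->]; have [y [->|->]] : exists y, (z = 2 * y)%N \/ (z = 2 * y + 1)%N.
  by exists (z %/ 2)%N; lia.
- by left; lia.
- by right; lia.
Qed.

Lemma bool_parity (n : int) : exists (p : bool) (h : int), n = p%:Z + h * 2.
Proof.
exists ((n %% 2)%Z == 1), (n %/ 2)%Z; rewrite {1}(divz_eq n 2) addrC.
by congr (_ + _); have [->|->] : (n %% 2)%Z = 0 \/ (n %% 2)%Z = 1 by lia.
Qed.

Lemma bool_even (p : bool) (h : int) : p%:Z = h * 2 -> p = false.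
Proof. by case: p => //; lia. Qed.

Lemma exprz_parity (x : algC) (p : bool) (h : int) : x != 0 ->
  x ^ (p%:Z + h * 2) = x ^+ p * (x ^ h) ^+ 2.
Proof. by move=> x0; rewrite expfzDr // -exprz_exp. Qed.

Lemma sqr_eq_m1 (z : algC) : z ^+ 2 = -1 -> z = 'i \/ z = - 'i.
Proof. by rewrite -sqrCi => /eqP; rewrite eqf_sqr => /orP[]/eqP; [left|right]. Qed.

Lemma quartic_root (z : algC) : z ^+ 2 = 1 \/ z ^+ 2 = -1 -> exists j : nat, z = 'i ^+ j.
Proof.
case=> [/eqP|/sqr_eq_m1].
  rewrite sqrf_eq1 => /orP[]/eqP ->; first by exists 0%N.
  by exists 2%N; rewrite sqrCi.
by case=> ->; [exists 1%N|exists 3%N; rewrite exprS sqrCi mulrN1].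
Qed.

Lemma quad_int_Aint (w c : algC) : c \in Num.int -> w ^+ 2 - w = c -> w \in Aint.
Proof.
move=> cZ wE; apply: (@root_monic_Aint ('X^2 - 'X - c%:P)).
- by rewrite /root !hornerE wE subrr.
- rewrite monicE lead_coefDl ?lead_coefXn //; last first.
    rewrite size_polyN (leq_ltn_trans (size_polyC_leq1 _)) //.
    by rewrite size_polyDl ?size_polyN ?size_polyX ?size_polyXn.
  rewrite lead_coefDl ?lead_coefXn // size_polyN size_polyX size_polyXn //.
- apply/polyOverP => i; rewrite !coefB coefXn coefX coefC.
  by apply: rpredB; [apply: rpredB; exact: rpred_nat|case: ifP => // _; exact: rpred0].
Qed.

Section Biquadratic.
Variables (m1 m2 : nat).
Hypotheses (m1_mod4 : (m1 %% 4 = 1)%N) (m2_mod4 : (m2 %% 4 = 3)%N).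
Hypothesis m12_coprime : coprime m1 m2.
Local Notation d := (m1 * m2)%N.
Local Notation r1 := (sqrtC m1%:R : algC).
Local Notation r2 := (sqrtC m2%:R : algC).
Local Notation rd := (sqrtC (m1 * m2)%:R : algC).
Local Notation k := (gen_field [set` [:: 'i; rd]]).
Local Notation L := (gen_field [set` [:: 'i; r1; r2]]).
Local Notation F1 := (gen_field [set` [:: 'i; r1]]).
Local Notation F2 := (gen_field [set` [:: 'i; r2]]).
(** [sigma], [tau] and their product fix k, F1 and F2 respectively, the three quadratic extensions
    of Q(i) inside L. *)
Variables (sigma tau : {rmorphism algC -> algC}).
Hypotheses (sigma_i : sigma 'i = 'i) (sigma_r1 : sigma r1 = - r1) (sigma_r2 : sigma r2 = - r2).
Hypotheses (tau_i : tau 'i = 'i) (tau_r1 : tau r1 = r1) (tau_r2 : tau r2 = - r2).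

Lemma sqrtC_mul_nat a b : sqrtC (a * b)%:R = sqrtC a%:R * sqrtC b%:R :> algC.
Proof. by rewrite natrM sqrtCM // nnegrE ler0n. Qed.

Let rdE : rd = r1 * r2. Proof. exact: sqrtC_mul_nat. Qed.
Let m1_gt0 : (0 < m1)%N. Proof. by case: m1 m1_mod4. Qed.
Let m2_gt0 : (0 < m2)%N. Proof. by case: m2 m2_mod4. Qed.
Let r1_neq0 : r1 != 0. Proof. exact: sqrtC_nat_eq0. Qed.
Let r2_neq0 : r2 != 0. Proof. exact: sqrtC_nat_eq0. Qed.
Let d_mod4 : (d %% 4 = 3)%N. Proof. by rewrite -modnMm m1_mod4 m2_mod4. Qed.
Let sfk : is_subfield k. Proof. exact: gen_field_subfield. Qed.
Let sfL : is_subfield L. Proof. exact: gen_field_subfield. Qed.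
Let sfF1 : is_subfield F1. Proof. exact: gen_field_subfield. Qed.
Let sfF2 : is_subfield F2. Proof. exact: gen_field_subfield. Qed.

Let Li : L 'i. Proof. by apply: mem_gen_field; rewrite /= !inE eqxx. Qed.
Let Lr1 : L r1. Proof. by apply: mem_gen_field; rewrite /= !inE eqxx orbT. Qed.
Let Lr2 : L r2. Proof. by apply: mem_gen_field; rewrite /= !inE eqxx !orbT. Qed.
Let ki : k 'i. Proof. by apply: mem_gen_field; rewrite /= !inE eqxx. Qed.
Let kr : k rd. Proof. by apply: mem_gen_field; rewrite /= !inE eqxx orbT. Qed.

Lemma biquad_quad_ext (s : seq algC) z : z ^+ 2 \in Crat ->
    (forall u, u \in s -> L u) -> L z ->
    (forall u, u \in [:: 'i; r1; r2] -> gen_field [set` z :: s] u) ->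
  L = quad_ext (gen_field [set` s]) z.
Proof.
move=> z2 sL zL gens; rewrite -gen_field_cons; last first.
  by apply: rat_field_sub z2; exact: gen_field_subfield.
apply: gen_field_eq => // u /=; rewrite inE => /orP[/eqP->//|]; exact: sL.
Qed.

Lemma L_over_k : L = quad_ext k r1.
Proof.
apply: biquad_quad_ext => //; first by rewrite sqrtCK rpred_nat.
  by move=> u; rewrite !inE => /orP[]/eqP-> //; rewrite rdE; exact: (subfieldM sfL).
have sg := gen_field_subfield [set` [:: r1; 'i; rd]].
have g1 : gen_field [set` [:: r1; 'i; rd]] r1 by apply: mem_gen_field; exact: mem_head.
move=> u; rewrite !inE => /orP[|/orP[]]/eqP-> //.
  by apply: mem_gen_field; rewrite /= !inE eqxx orbT.
rewrite -(mulKf r1_neq0 r2) -rdE; apply: (subfieldM sg); first exact: (subfieldV sg).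
by apply: mem_gen_field; rewrite /= !inE eqxx !orbT.
Qed.

Lemma L_over_F1 : L = quad_ext F1 r2.
Proof.
apply: biquad_quad_ext => //; first by rewrite sqrtCK rpred_nat.
  by move=> u; rewrite !inE => /orP[]/eqP->.
move=> u; rewrite !inE => h; apply: mem_gen_field; rewrite /= !inE.
by case/orP: h => [->|/orP[]->]; rewrite ?orbT.
Qed.

Lemma L_over_F2 : L = quad_ext F2 r1.
Proof.
apply: biquad_quad_ext => //; first by rewrite sqrtCK rpred_nat.
  by move=> u; rewrite !inE => /orP[]/eqP->.
move=> u; rewrite !inE => h; apply: mem_gen_field; rewrite /= !inE.
by case/orP: h => [->|/orP[]->]; rewrite ?orbT.
Qed.

Lemma k_sub_L : k `<=` L.
Proof. by rewrite L_over_k; exact: sub_quad_ext. Qed.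

Lemma rmorph_L (f : {rmorphism algC -> algC}) :
  L (f 'i) -> L (f r1) -> L (f r2) -> forall u, L u -> L (f u).
Proof.
move=> fi f1 f2; apply: gen_field_rmorph => // u /=.
by rewrite !inE => /orP[|/orP[]]/eqP->.
Qed.

Lemma rmorph_eq_L (f g : {rmorphism algC -> algC}) :
  f 'i = g 'i -> f r1 = g r1 -> f r2 = g r2 -> forall u, L u -> f u = g u.
Proof.
move=> fi f1 f2; apply: gen_field_eq_rmorph => u /=.
by rewrite !inE => /orP[|/orP[]]/eqP->.
Qed.

Lemma sigmaL u : L u -> L (sigma u).
Proof.
apply: rmorph_L; rewrite ?sigma_i ?sigma_r1 ?sigma_r2 //; exact: (subfieldN sfL).
Qed.

Lemma tauL u : L u -> L (tau u).
Proof.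
apply: rmorph_L; rewrite ?tau_i ?tau_r1 ?tau_r2 //; exact: (subfieldN sfL).
Qed.

Let conj1 : r1^* = r1. Proof. exact: conj_sqrtC_nat. Qed.
Let conj2 : r2^* = r2. Proof. exact: conj_sqrtC_nat. Qed.

Lemma sigmaK u : L u -> sigma (sigma u) = u.
Proof.
apply: (@rmorph_eq_L (sigma \o sigma) idfun) => /=; rewrite ?sigma_i //.
  by rewrite sigma_r1 rmorphN /= sigma_r1 opprK.
by rewrite sigma_r2 rmorphN /= sigma_r2 opprK.
Qed.

Lemma tauK u : L u -> tau (tau u) = u.
Proof.
apply: (@rmorph_eq_L (tau \o tau) idfun) => /=; rewrite ?tau_i ?tau_r1 //.
by rewrite tau_r2 rmorphN /= tau_r2 opprK.
Qed.

Lemma sigma_tau u : L u -> sigma (tau u) = tau (sigma u).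
Proof.
apply: (@rmorph_eq_L (sigma \o tau) (tau \o sigma)) => /=.
- by rewrite sigma_i tau_i.
- by rewrite tau_r1 sigma_r1 rmorphN /= tau_r1.
- by rewrite tau_r2 sigma_r2 !rmorphN /= tau_r2 sigma_r2.
Qed.

Lemma sigma_conj u : L u -> sigma u^* = (sigma u)^*.
Proof.
apply: (@rmorph_eq_L (sigma \o Num.conj) (Num.conj \o sigma)) => /=.
- by rewrite sigma_i conjCi rmorphN /= sigma_i.
- by rewrite sigma_r1 conj1 rmorphN /= conj1.
- by rewrite sigma_r2 conj2 rmorphN /= conj2.
Qed.

Lemma tau_conj u : L u -> tau u^* = (tau u)^*.
Proof.
apply: (@rmorph_eq_L (tau \o Num.conj) (Num.conj \o tau)) => /=.
- by rewrite tau_i conjCi rmorphN /= tau_i.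
- by rewrite tau_r1 conj1.
- by rewrite tau_r2 conj2 rmorphN /= conj2.
Qed.

Lemma sigma_rd : sigma rd = rd.
Proof. by rewrite rdE rmorphM /= sigma_r1 sigma_r2 mulrNN. Qed.

Lemma tau_rd : tau rd = - rd.
Proof. by rewrite rdE rmorphM /= tau_r1 tau_r2 mulrN. Qed.

Lemma sigma_fix u : k u -> sigma u = u.
Proof.
apply: (@gen_field_eq_rmorph _ sigma idfun) => v /=; rewrite !inE => /orP[]/eqP-> //.
exact: sigma_rd.
Qed.

Lemma fix_sigma u : L u -> sigma u = u -> k u.
Proof.
rewrite L_over_k; apply: quad_ext_fixed => //; exact: sigma_fix.
Qed.

Lemma fix_tau u : L u -> tau u = u -> F1 u.
Proof.
rewrite L_over_F1; apply: quad_ext_fixed => //.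
apply: (@gen_field_eq_rmorph _ tau idfun) => v /=; rewrite !inE => /orP[]/eqP-> //.
Qed.

Lemma fix_sigma_tau u : L u -> sigma (tau u) = u -> F2 u.
Proof.
rewrite L_over_F2; apply: (@quad_ext_fixed _ _ (sigma \o tau)) => //=.
  apply: (@gen_field_eq_rmorph _ (sigma \o tau) idfun) => v /=.
  rewrite !inE => /orP[]/eqP->; first by rewrite tau_i.
  by rewrite tau_r2 rmorphN /= sigma_r2 opprK.
by rewrite tau_r1.
Qed.

Lemma tau_k u : k u -> k (tau u).
Proof.
apply: gen_field_rmorph => // v /=; rewrite !inE => /orP[]/eqP->; first by rewrite tau_i.
by rewrite tau_rd; exact: (subfieldN sfk).
Qed.

Lemma fix_tau_conj_k u : k u -> tau u = u -> u^* = u -> u \in Crat.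
Proof.
have i2 : 'i ^+ 2 \in Crat by rewrite sqrCi rpredN rpred1.
have gi : is_subfield (gen_field [set` [:: 'i]]) := gen_field_subfield _.
have -> : k = quad_ext (gen_field [set` [:: 'i]]) rd.
  rewrite -gen_field_cons; last by rewrite sqrtCK; exact: subfield_nat.
  by congr gen_field; apply/seteqP; split=> v /=; rewrite !inE orbC.
move=> ku tu cu; have : gen_field [set` [:: 'i]] u.
  apply: quad_ext_fixed tau_rd _ ku tu => //; last by rewrite rdE mulf_neq0.
  by apply: (@gen_field_eq_rmorph _ tau idfun) => v /=; rewrite inE => /eqP->.
rewrite gen_field_cons gen_field_nil //.
move=> ru; have conjQ v : rat_field v -> v^* = v by exact: conj_Crat.
exact: (@quad_ext_fixed _ _ Num.conj _ rat_field_subfield conjQ (conjCi _) (neq0Ci _) ru cu).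
Qed.

Definition nat_sq_class (n : nat) : Prop := exists x y : bool, natsq (n * (m1 ^ x * m2 ^ y)).

Lemma sq_in_L_nat n : (0 < n)%N -> sq_in L n%:R <-> nat_sq_class n.
Proof.
move=> n0; split.
  move=> /(@gen_field_sq_nat [:: m1; m2]); rewrite /= m1_gt0 m2_gt0 => /(_ n0 isT).
  move=> [b [sb h]]; case: b sb h => [|x [|y []]] //= _ h; exists x, y; move: h.
  by case: x; case: y; rewrite /= ?big_cons ?big_nil ?expn1 ?expn0 ?muln1 ?mul1n.
move=> [x [y [z zE]]]; exists (z%:R / (r1 ^+ x * r2 ^+ y)).
  apply: (subfield_div sfL); first exact: subfield_nat.
  by apply: (subfieldM sfL); exact: (subfieldX sfL).
rewrite expr_div_n exprMn -!exprM ![(_ * 2)%N]mulnC !exprM !sqrtCK -natrX -zE.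
rewrite !natrM !natrX mulfK // mulf_neq0 // expf_neq0 // pnatr_eq0 -lt0n //.
Qed.

Lemma sq_in_k_nat n : (0 < n)%N -> sq_in k n%:R <-> natsq n \/ natsq (n * d).
Proof.
move=> n0; split.
  move=> /(@gen_field_sq_nat [:: d]); rewrite /= muln_gt0 m1_gt0 m2_gt0 => /(_ n0 isT).
  move=> [b [sb h]]; case: b sb h => [|[] []] //= _; rewrite ?big_cons ?big_nil ?muln1.
    by right.
  by left.
case=> [[z zE]|[z zE]].
  by exists z%:R; [exact: subfield_nat|rewrite -natrX -zE].
exists (z%:R / rd); first by apply: (subfield_div sfk) => //; exact: subfield_nat.
rewrite expr_div_n sqrtCK -natrX -zE natrM mulfK // pnatr_eq0 -lt0n muln_gt0.
by rewrite m1_gt0.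
Qed.

Lemma two_not_sq_L : ~ nat_sq_class 2.
Proof.
move=> [x [y /natsq_mod4]]; rewrite -modnMmr -[X in (2 * X)%N]modnMm.
by case: x; case: y; rewrite ?expn1 ?expn0 ?m1_mod4 ?m2_mod4 => -[].
Qed.

Lemma sq_in_kL x : sq_in k x -> sq_in L x.
Proof. by move=> [w kw wE]; exists w => //; exact: k_sub_L. Qed.

Lemma two_i : 2 * 'i = (1 + 'i) ^+ 2 :> algC.
Proof.
by rewrite sqrrD sqrCi expr1n; ring.
Qed.

Lemma sq_two_i : sq_in k (2 * 'i).
Proof.
by rewrite two_i; apply: sq_in_sqr; apply: (subfieldD sfk) => //; exact: subfield1.
Qed.

Lemma i_not_sq_L : ~ sq_in L 'i.
Proof.
move=> si; apply: two_not_sq_L; apply/sq_in_L_nat => //.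
apply: (sq_in_cancel sfL (neq0Ci _) si); rewrite mulrC; exact/sq_in_kL/sq_two_i.
Qed.

Lemma sqN1 : sq_in k (-1).
Proof. by rewrite -sqrCi; exact: sq_in_sqr. Qed.

Lemma Ni_not_sq_L : ~ sq_in L (- 'i).
Proof.
move=> si; apply: i_not_sq_L; have := sq_inM sfL (sq_in_kL sqN1) si.
by rewrite mulrNN mul1r.
Qed.
Let d_gt0 : (0 < d)%N. Proof. by rewrite muln_gt0 m1_gt0. Qed.

Variables (e1 e2 e : algC).
Hypotheses (fund1 : fundamental_unit m1 e1) (fund2 : fundamental_unit m2 e2)
  (fund : fundamental_unit d e).

Let norm_e2 : e2 * sigma e2 = 1.
Proof. exact: (fund_unit_norm3 fund2 sigma_r2 m2_mod4). Qed.

Let norm_e : e * tau e = 1.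
Proof. exact: (fund_unit_norm3 fund tau_rd d_mod4). Qed.

Let quad_sub_L m : L (sqrtC m%:R) -> quad_field m `<=` L.
Proof. by move=> Lr; apply: gen_field_sub => // u ->. Qed.

Let unit_e1 : unit_group L e1.
Proof. by case: fund1 => h _ _; apply: unit_group_sub h; exact: quad_sub_L. Qed.

Let unit_e2 : unit_group L e2.
Proof. by case: fund2 => h _ _; apply: unit_group_sub h; exact: quad_sub_L. Qed.

Let unit_e : unit_group k e.
Proof. by case: fund => h _ _; apply: unit_group_sub h; apply: gen_field_sub => // u ->. Qed.

Let unit_i : unit_group k 'i.
Proof.
apply: (unit_group_sqrt sfk) => //; rewrite sqrCi.
by apply: (unit_groupN sfk); exact: unit_group1.
Qed.

Let e1_gt0 := fund_unit_gt0 fund1.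
Let e2_gt0 := fund_unit_gt0 fund2.
Let e_gt0 := fund_unit_gt0 fund.
Let e1_neq0 : e1 != 0. Proof. by rewrite gt_eqF. Qed.
Let e2_neq0 : e2 != 0. Proof. by rewrite gt_eqF. Qed.
Let e_neq0 : e != 0. Proof. by rewrite gt_eqF. Qed.

Let tau_e1 : tau e1 = e1.
Proof.
have [[_ [h _] _] _ _] := fund1; move: h.
by apply: (@gen_field_eq_rmorph _ tau idfun) => u ->.
Qed.

Let tau_e2 : tau e2 = e2^-1.
Proof.
have [[_ [h _] _] _ _] := fund2; have -> : tau e2 = sigma e2.
  move: h; apply: (@gen_field_eq_rmorph _ tau sigma) => u ->; by rewrite tau_r2 sigma_r2.
by rewrite -[LHS](mulKf e2_neq0) norm_e2 mulr1.
Qed.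

Let sigma_e : sigma e = e.
Proof. by apply: sigma_fix; exact: unit_group_mem unit_e. Qed.

Let tau_e : tau e = e^-1.
Proof. by rewrite -[LHS](mulKf e_neq0) norm_e mulr1. Qed.

(* [neg1] tells whether e1 has norm -1; [alpha] is e1 corrected to norm 1. *)
Definition neg1 : bool := e1 * sigma e1 == -1.
Definition alpha : algC := 'i ^+ neg1 * e1.

Let norm_e1 : e1 * sigma e1 = (-1) ^+ neg1.
Proof.
rewrite /neg1; case: eqVneq => [->|]; first by rewrite expr1.
by case: (fund_unit_norm fund1 sigma_r1) => ->; rewrite ?eqxx.
Qed.

Let sigma_e1 : sigma e1 = (-1) ^+ neg1 / e1.
Proof. by rewrite -norm_e1; field. Qed.

Local Notation M := (norm1_unit L sigma).

Lemma alpha_norm1 : M alpha.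
Proof.
split.
  apply: (unit_groupM sfL) => //; apply: (unit_groupX sfL).
  exact: unit_group_sub k_sub_L unit_i.
rewrite /alpha rmorphM rmorphXn /= sigma_i mulrACA norm_e1 -exprMn -expr2 sqrCi.
by case: neg1; rewrite ?expr1 ?expr0 ?mulrNN ?mulr1.
Qed.

Lemma beta_norm1 : M e2.
Proof. by split. Qed.

Let alpha_neq0 : alpha != 0.
Proof. exact: unit_group_neq0 alpha_norm1.1. Qed.

Let conj_pos x : 0 < x -> x^* = x :> algC.
Proof. by move=> x0; apply/CrealP; rewrite gtr0_real. Qed.

(* |v|^2 would be a totally nonnegative element of L equal to e1 e2^b e^h,
   which sigma o tau maps to a negative number. *)
Lemma neg1_not_sq j b h : neg1 -> ~ sq_in L ('i ^+ j * e1 * e2 ^+ b * e ^+ h).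
Proof.
move=> n1 [v Lv v2].
pose P := e1 * e2 ^+ b * e ^+ h.
have P0 : 0 < P by rewrite /P !mulr_gt0 ?exprn_gt0.
have yP : v * v^* = P.
  apply/eqP; rewrite -(@eqrXn2 _ 2) ?mul_conjC_ge0 ?(ltW P0) //; apply/eqP.
  have {}v2 : v ^+ 2 = 'i ^+ j * P by rewrite v2 /P !mulrA.
  rewrite exprMn -rmorphXn /= v2 rmorphM rmorphXn /= (conj_pos P0).
  by rewrite conjCi mulrACA -exprMn mulrN -expr2 sqrCi opprK expr1n mul1r expr2.
have : 0 <= sigma (tau (v * v^*)).
  rewrite !rmorphM /= tau_conj // sigma_conj; last exact: tauL.
  exact: mul_conjC_ge0.
rewrite yP /P !rmorphM !rmorphXn /= tau_e1 tau_e2 tau_e !rmorphV ?unitfE //= sigma_e sigma_e1.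
rewrite n1 expr1.
have -> : sigma e2 = e2^-1 by rewrite -[LHS](mulKf e2_neq0) norm_e2 mulr1.
rewrite invrK mulN1r !mulNr oppr_ge0 => /(lt_le_trans _)-/(_ 0).
by rewrite ltxx !mulr_gt0 ?exprn_gt0 ?invr_gt0 // => /(_ isT).
Qed.

Variables (t1 t2 t : nat).
Hypotheses (t1_gt0 : (0 < t1)%N) (t2_gt0 : (0 < t2)%N) (t_gt0 : (0 < t)%N).
(** When e1 has norm -1, t1 is only a placeholder, and [neg1_not_sq] keeps alpha = i e1 out of
    squares; hence the condition on [a] below. *)
Hypothesis t1E : ~~ neg1 -> (1 + e1) ^+ 2 = t1%:R * e1.
Hypothesis t2E : (1 + e2) ^+ 2 = t2%:R * e2.
Hypothesis tE : (1 + e) ^+ 2 = t%:R * e.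
Hypothesis class_free : forall a b : bool, (neg1 -> ~~ a) ->
  nat_sq_class (t1 ^ a * t2 ^ b) -> ~~ a && ~~ b.

Lemma sq_in_exp K (b : bool) x y : is_subfield K -> sq_in K (x * y) ->
  sq_in K (x ^+ b * y ^+ b).
Proof.
by case: b => // sK _; rewrite !expr0 mulr1; exact: sq_in1.
Qed.

Lemma sq_in_base_L (h1 h2 a b : bool) : (neg1 -> ~~ a) ->
  sq_in L ('i ^+ h1 * e ^+ h2 * (alpha ^+ a * e2 ^+ b)) <->
  nat_sq_class (2 ^ h1 * t ^ h2 * (t1 ^ a * t2 ^ b)).
Proof.
move=> na; rewrite -sq_in_L_nat; last by rewrite !muln_gt0 !expn_gt0 t_gt0 t1_gt0 t2_gt0.
have L1 x : L x -> L (1 + x) by move=> Lx; apply: (subfieldD sfL) => //; exact: subfield1.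
have sq1 : sq_in L (t1%:R ^+ a * alpha ^+ a).
  case: a na => na; last first.
    by rewrite !expr0 mulr1; exact: sq_in1.
  have n1 : neg1 = false by apply/negbTE/negP => /na.
  rewrite !expr1 /alpha n1 expr0 mul1r -t1E ?n1 //; apply: sq_in_sqr.
  exact: L1 (unit_group_mem unit_e1).
have sq2 : sq_in L (t2%:R ^+ b * e2 ^+ b).
  apply: sq_in_exp => //; rewrite -t2E; apply: sq_in_sqr.
  exact: L1 (unit_group_mem unit_e2).
have sqe : sq_in L (t%:R ^+ h2 * e ^+ h2).
  apply: sq_in_exp => //; rewrite -tE; apply: sq_in_sqr.
  exact: L1 (k_sub_L (unit_group_mem unit_e)).
have sqi : sq_in L (2 ^+ h1 * 'i ^+ h1).
  by apply: sq_in_exp => //; exact/sq_in_kL/sq_two_i.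
have prod : sq_in L ((2 ^ h1 * t ^ h2 * (t1 ^ a * t2 ^ b))%:R *
    ('i ^+ h1 * e ^+ h2 * (alpha ^+ a * e2 ^+ b))).
  have := sq_inM sfL (sq_inM sfL sqi sqe) (sq_inM sfL sq1 sq2).
  congr sq_in; rewrite !natrM !natrX; ring.
split=> sq.
  apply: (sq_in_cancel sfL _ sq); last by rewrite mulrC.
  by rewrite !mulf_neq0 ?expf_neq0 ?neq0Ci.
apply: (sq_in_cancel sfL _ sq) => //.
by rewrite pnatr_eq0 -lt0n !muln_gt0 !expn_gt0 t_gt0 t1_gt0 t2_gt0.
Qed.

Lemma alpha_sq_neg (h1 h2 a b : bool) :
  sq_in L ('i ^+ h1 * e ^+ h2 * (alpha ^+ a * e2 ^+ b)) -> neg1 -> ~~ a.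
Proof.
move=> sq n1; apply/negP => aT; move: sq.
rewrite aT expr1 /alpha n1 expr1.
have -> : 'i ^+ h1 * e ^+ h2 * ('i * e1 * e2 ^+ b) =
  'i ^+ h1.+1 * e1 * e2 ^+ b * e ^+ h2 by rewrite exprS; ring.
exact: neg1_not_sq.
Qed.

(** * Units of relative norm one modulo squares *)

Lemma norm1_power_even (s : bool) (n1 n2 : int) :
  sq_in L ((-1) ^+ s * alpha ^ n1 * e2 ^ n2) -> exists a b, n1 = a * 2 /\ n2 = b * 2.
Proof.
have [p1 [h1 ->]] := bool_parity n1; have [p2 [h2 ->]] := bool_parity n2.
rewrite !exprz_parity // => sq.
have {}sq : sq_in L ('i ^+ false * e ^+ false * (alpha ^+ p1 * e2 ^+ p2)).
  have Ls : sq_in L ((-1) ^+ s).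
    case: s {sq}; first exact/sq_in_kL/sqN1.
    by rewrite expr0; exact: sq_in1.
  have La : sq_in L ((alpha ^ h1) ^+ 2).
    by apply: sq_in_sqr; apply: (subfieldXz sfL); exact: unit_group_mem alpha_norm1.1.
  have Lb : sq_in L ((e2 ^ h2) ^+ 2).
    by apply: sq_in_sqr; apply: (subfieldXz sfL); exact: unit_group_mem unit_e2.
  apply: (sq_in_cancel sfL _ (sq_inM sfL (sq_inM sfL Ls La) Lb)).
    by rewrite !mulf_neq0 ?signr_eq0 ?expf_neq0 ?expfz_neq0.
  move: sq; congr sq_in; rewrite !expr0; ring.
have na := alpha_sq_neg sq.
have /(class_free na) : nat_sq_class (t1 ^ p1 * t2 ^ p2).
  by have /sq_in_base_L := sq => /(_ na); rewrite !expn0 !mul1n.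
case: p1 {sq na} => //; case: p2 => // _; exists h1, h2; by rewrite !add0r.
Qed.

(** sigma fixes i, so the fourth root of unity z has norm z^2, which is 1 because y and z y both
    have norm 1. *)
Lemma quartic_norm1 z y : L z -> M y -> z ^+ 2 = 1 \/ z ^+ 2 = -1 -> M (z * y) ->
  exists s : bool, z = (-1) ^+ s.
Proof.
move=> Lz [yu yn] /quartic_root[j zE] [_ zn].
have : z * sigma z = 1.
  by move: zn; rewrite rmorphM /= mulrACA yn mulr1.
have -> : sigma z = z by rewrite zE rmorphXn /= sigma_i.
rewrite -expr2 => /eqP; rewrite sqrf_eq1 => /orP[]/eqP ->; first by exists false.
by exists true.
Qed.

(** The exponents on the right are even by [norm1_power_even], so x divided by alpha^a e2^b is a
    fourth root of unity; only 1 and -1 have norm 1. *)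
Lemma norm1_sqrt x (s : bool) (n1 n2 : int) : M x ->
    x ^+ 2 = (-1) ^+ s * alpha ^ n1 * e2 ^ n2 ->
  exists (s' : bool) (a b : int), x = (-1) ^+ s' * alpha ^ a * e2 ^ b.
Proof.
move=> xM x2; have Lx := unit_group_mem xM.1.
have [|a [b [aE bE]]] := @norm1_power_even s n1 n2; first by exists x.
pose y := alpha ^ a * e2 ^ b.
have yM : M y.
  split.
    by apply: (unit_groupM sfL); apply: (unit_groupXz sfL); [case: alpha_norm1|].
  rewrite /y rmorphM /= !rmorphXz ?unitfE // mulrACA -!exprzMl ?unitfE ?fmorph_eq0 //.
  by rewrite alpha_norm1.2 norm_e2 !exp1rz mulr1.
have y0 := unit_group_neq0 yM.1.
have zs : (x / y) ^+ 2 = (-1) ^+ s.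
  have y2 : y ^+ 2 = alpha ^ n1 * e2 ^ n2 by rewrite /y exprMn aE bE -!exprz_exp.
  by rewrite expr_div_n x2 -mulrA -y2 mulfK // expf_neq0.
have [||||s' sE] := @quartic_norm1 (x / y) y; rewrite ?divfK //.
- by apply: (subfield_div sfL) => //; exact: unit_group_mem yM.1.
- by rewrite zs; case: (s); [right|left].
by exists s', a, b; rewrite -mulrA -/y -sE divfK.
Qed.

(** tau u has norm 1 along with u, so u^2 is the product of u tau u in F1 and u sigma (tau u) in F2.
    Both have relative norm 1, and [norm_one_sixth] determines u^12. Two square roots bring the
    exponent down to 3, which is odd and therefore harmless modulo squares. *)
Lemma norm1_cube u : M u ->
  exists (s : bool) (a b : int), u ^+ 3 = (-1) ^+ s * alpha ^ a * e2 ^ b.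
Proof.
move=> uM; have [uu un] := uM; have Lu := unit_group_mem uu.
have tu : unit_group L (tau u) by exact: (unit_group_aut tauL).
have stu : unit_group L (sigma (tau u)) by exact: (unit_group_aut sigmaL).
have Ltu := unit_group_mem tu.
have tn : tau u * sigma (tau u) = 1.
  by rewrite sigma_tau // -rmorphM /= un rmorph1.
have [n1 n1E] : exists n : int, (u * tau u) ^+ 6 = e1 ^ n \/ (u * tau u) ^+ 6 = - e1 ^ n.
  apply: (norm_one_sixth fund1 sigma_r1 m1_gt0 sigma_i).
    apply: (@unit_group_in L) => //; last exact: (unit_groupM sfL).
    apply: fix_tau; first exact: (subfieldM sfL).
    by rewrite rmorphM /= tauK // mulrC.
  by rewrite rmorphM /= mulrACA un tn mulr1.
have [n2 n2E] : exists n : int, (u * sigma (tau u)) ^+ 6 = e2 ^ n \/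
    (u * sigma (tau u)) ^+ 6 = - e2 ^ n.
  apply: (norm_one_sixth fund2 sigma_r2 m2_gt0 sigma_i).
    apply: (@unit_group_in L) => //; last exact: (unit_groupM sfL).
    apply: fix_sigma_tau; first by apply: (subfieldM sfL) => //; exact: sigmaL.
    by rewrite !rmorphM /= -(sigma_tau Ltu) tauK // sigmaK // mulrC.
  by rewrite rmorphM /= sigmaK // mulrACA un mul1r mulrC tn.
have prodE : u ^+ 12 = (u * tau u) ^+ 6 * (u * sigma (tau u)) ^+ 6.
  have -> : (u * tau u) ^+ 6 * (u * sigma (tau u)) ^+ 6 =
    u ^+ 12 * (tau u * sigma (tau u)) ^+ 6 by ring.
  by rewrite tn expr1n mulr1.
have [s0 s0E] : exists s : bool, u ^+ 12 = (-1) ^+ s * e1 ^ n1 * e2 ^ n2.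
  rewrite prodE; case: n1E => ->; case: n2E => ->.
  - by exists false; ring.
  - by exists true; ring.
  - by exists true; ring.
  - by exists false; ring.
(* The fourth root of unity left over when e1 is replaced by alpha. *)
pose z := (-1) ^+ s0 / ('i ^+ neg1) ^ n1 : algC.
have ib0 : 'i ^+ neg1 != 0 :> algC by rewrite expf_neq0 // neq0Ci.
have u12 : u ^+ 12 = z * (alpha ^ n1 * e2 ^ n2).
  rewrite s0E /z /alpha exprzMl ?unitfE // -!mulrA; congr (_ * _).
  by rewrite mulKf // expfz_neq0.
have xM n : M (u ^+ n) by exact: norm1_unitX.
have yM : M (alpha ^ n1 * e2 ^ n2).
  split.
    by apply: (unit_groupM sfL); apply: (unit_groupXz sfL); [case: alpha_norm1|].
  rewrite rmorphM /= !rmorphXz ?unitfE // mulrACA -!exprzMl ?unitfE ?fmorph_eq0 //.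
  by rewrite alpha_norm1.2 norm_e2 !exp1rz mulr1.
have zL : L z.
  apply: (subfield_div sfL).
    by apply: (subfieldX sfL); apply: (subfieldN sfL); exact: subfield1.
  by apply: (subfieldXz sfL); apply: (subfieldX sfL).
have [||s sE] := @quartic_norm1 z _ zL yM.
- suff /eqP : (z ^+ 2) ^+ 2 = 1 by rewrite sqrf_eq1 => /orP[]/eqP; [left|right].
  have c4 : (('i ^+ neg1) ^ n1) ^+ 4 = 1 :> algC.
    change ((('i ^+ neg1) ^ n1) ^ 4 = 1 :> algC); rewrite exprz_exp mulrC -exprz_exp.
    change ((('i ^+ neg1 : algC) ^+ 4) ^ n1 = 1).
    by rewrite -exprM mulnC exprM (exprM _ 2 2) sqrCi sqrrN !expr1n exp1rz.
  rewrite -exprM /z expr_div_n c4 divr1 -exprM mulnC exprM.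
  by rewrite (exprM _ 2 2) sqrrN !expr1n.
- by rewrite -u12.
have [s' [a [b x2E]]] : exists (s' : bool) (a b : int),
    u ^+ 6 = (-1) ^+ s' * alpha ^ a * e2 ^ b.
  apply: (@norm1_sqrt _ s n1 n2) => //.
  by rewrite -exprM u12 sE mulrA.
by apply: (@norm1_sqrt _ s' a b) => //; rewrite -exprM.
Qed.

(** Modulo squares u is u^3; the parities of the exponents in u^3 give g, and their halves go into
    w. *)
Lemma norm1_rep u : M u -> exists g w, M w /\ u = norm1_base alpha e2 g * w ^+ 2.
Proof.
move=> uM; have [s [a [b u3]]] := norm1_cube uM.
have u0 := unit_group_neq0 uM.1.
have [p1 [h1 aE]] := bool_parity a; have [p2 [h2 bE]] := bool_parity b.
exists (s, p1, p2), (alpha ^ h1 * e2 ^ h2 / u); split.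
  split.
    apply: (unit_groupM sfL); last exact: unit_groupV uM.1.
    by apply: (unit_groupM sfL); apply: (unit_groupXz sfL); [case: alpha_norm1|].
  rewrite !rmorphM fmorphV /= !rmorphXz ?unitfE // mulrACA -invfM uM.2 invr1 mulr1.
  by rewrite mulrACA -!exprzMl ?unitfE ?fmorph_eq0 // alpha_norm1.2 norm_e2 !exp1rz mulr1.
apply: (mulIf (expf_neq0 2 u0)); rewrite -exprS u3 aE bE !exprz_parity // /norm1_base /=.
by rewrite expr_div_n exprMn -[RHS]mulrA divfK ?expf_neq0 //; ring.
Qed.

Lemma norm1_free g w : M w -> norm1_base alpha e2 g = w ^+ 2 -> g = (false, false, false).
Proof.
move: g => [[s p1] p2] wM; rewrite /norm1_base /= => wE.
have [|a [b [aE bE]]] := @norm1_power_even s p1 p2.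
  exists w; [exact: unit_group_mem wM.1|by rewrite -wE].
have p10 := bool_even aE.
have p20 := bool_even bE.
(* -1 is a square in L but not in M: its roots i and -i have norm -1. *)
move: wE; rewrite p10 p20 !expr0 !mulr1; case: s => // /esym.
rewrite expr1 => /sqr_eq_m1 wi; have : w * sigma w = w ^+ 2.
  by rewrite expr2; congr (_ * _); case: wi => ->; rewrite ?rmorphN /= sigma_i.
rewrite wM.2; case: wi => ->; rewrite ?sqrrN sqrCi => /eqP.
  by rewrite -addr_eq0 -(natrD _ 1 1) pnatr_eq0.
by rewrite -addr_eq0 -(natrD _ 1 1) pnatr_eq0.
Qed.

(** * Units of k modulo squares *)

Lemma sq_in_base_k (h1 h2 : bool) : sq_in k ('i ^+ h1 * e ^+ h2) <->
  natsq (2 ^ h1 * t ^ h2) \/ natsq (2 ^ h1 * t ^ h2 * d).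
Proof.
have n0 : (0 < 2 ^ h1 * t ^ h2)%N by rewrite muln_gt0 !expn_gt0 t_gt0.
rewrite -sq_in_k_nat //.
have sqe : sq_in k (t%:R ^+ h2 * e ^+ h2).
  apply: sq_in_exp => //; rewrite -tE; apply: sq_in_sqr.
  by apply: (subfieldD sfk); [exact: subfield1|exact: unit_group_mem unit_e].
have sqi : sq_in k (2 ^+ h1 * 'i ^+ h1) by apply: sq_in_exp => //; exact: sq_two_i.
have prod : sq_in k ((2 ^ h1 * t ^ h2)%:R * ('i ^+ h1 * e ^+ h2)).
  by have := sq_inM sfk sqi sqe; congr sq_in; rewrite !natrM !natrX; ring.
split=> sq.
  apply: (sq_in_cancel sfk _ sq); last by rewrite mulrC.
  by rewrite !mulf_neq0 ?expf_neq0 ?neq0Ci.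
by apply: (sq_in_cancel sfk _ sq) => //; rewrite pnatr_eq0 -lt0n.
Qed.

Lemma e_not_sq_k : ~ sq_in k e.
Proof.
have [h1 h2] := fund_unit_trace_nonsquare fund t_gt0 d_gt0 tE.
by have := sq_in_base_k false true; rewrite expr0 mul1r expn0 mul1n expn1 => -[h _] /h[].
Qed.

Lemma i_not_sq_k : ~ sq_in k 'i.
Proof. by move=> /sq_in_kL; exact: i_not_sq_L. Qed.

(** u^2 is the product of u / tau u, of relative norm 1 over Q(i), and y = u tau u, fixed by tau.
    The product y y^* is a nonnegative unit of Q, so y lies on the unit circle and y^6 is 1 or
    -1. *)
Lemma unit_twelfth u : unit_group k u ->
  exists (s : bool) (n : int), u ^+ 12 = (-1) ^+ s * e ^ n.
Proof.
move=> uu; have ku := unit_group_mem uu; have Lu := k_sub_L ku.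
have u0 := unit_group_neq0 uu.
have tu : unit_group k (tau u) by exact: (unit_group_aut tau_k).
have tu0 := unit_group_neq0 tu.
have ktu := unit_group_mem tu.
pose y := u * tau u.
have yu : unit_group k y by exact: (unit_groupM sfk).
have ky := unit_group_mem yu; have Ly := k_sub_L ky.
have ty : tau y = y by rewrite /y rmorphM /= tauK // mulrC.
have conjk v : k v -> k v^*.
  apply: (@gen_field_rmorph _ _ Num.conj) => // z /=; rewrite !inE => /orP[]/eqP->.
    by rewrite conjCi; exact: (subfieldN sfk).
  have -> : (sqrtC d%:R)^* = sqrtC d%:R :> algC by exact: conj_sqrtC_nat.
  exact: kr.
have tyc : tau y^* = y^* by rewrite tau_conj // ty.
have yuc : unit_group k y^* by exact: (@unit_group_aut _ Num.conj).
have yQ : y + y^* \in Crat.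
  apply: fix_tau_conj_k; first by apply: (subfieldD sfk) => //; exact: conjk.
    by rewrite rmorphD /= ty tyc.
  by rewrite rmorphD /= conjCK addrC.
have yy : y * y^* = 1.
  have : y * y^* = 1 \/ y * y^* = -1.
    apply: (@unit_group_rat k); last exact: (unit_groupM sfk).
    apply: fix_tau_conj_k; first by apply: (subfieldM sfk) => //; exact: conjk.
      by rewrite rmorphM /= ty tyc.
    by rewrite rmorphM /= conjCK mulrC.
  case=> // yyN; have := mul_conjC_ge0 y; rewrite yyN oppr_ge0 => h.
  by have := lt_le_trans ltr01 h; rewrite ltxx.
have y12 : (y ^+ 6) ^+ 2 = 1.
  rewrite -exprM; case: (unit_circle_quad (unit_group_Aint yu) yy yQ) => yE.
  - by rewrite (exprM _ 2 6) yE (exprM _ 2 3) sqrrN !expr1n.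
  - by rewrite (exprM _ 3 4) yE expr1n.
  - by rewrite (exprM _ 3 4) yE (exprM _ 2 2) sqrrN !expr1n.
have [n nE] : exists n : int, (u / tau u) ^+ 6 = e ^ n \/ (u / tau u) ^+ 6 = - e ^ n.
  apply: (norm_one_sixth fund tau_rd d_gt0 tau_i).
    by apply: (unit_groupM sfk) => //; exact: unit_groupV.
  by rewrite rmorphM fmorphV /= tauK //; field; rewrite tu0 u0.
have uE : u ^+ 12 = (u / tau u) ^+ 6 * y ^+ 6 by rewrite /y; field.
rewrite uE; move/eqP: y12; rewrite sqrf_eq1 => /orP[]/eqP ->; case: nE => ->.
- by exists false, n; ring.
- by exists true, n; ring.
- by exists true, n; ring.
- by exists false, n; ring.
Qed.

(** In u^12 the exponent of e must be even, since -1 is a square in k and e is not; a square root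
    can then be taken. *)
Lemma unit_sixth u : unit_group k u -> exists (j : nat) (n : int), u ^+ 6 = 'i ^+ j * e ^ n.
Proof.
move=> uu; have ku := unit_group_mem uu; have [s [n uE]] := unit_twelfth uu.
have [p [h nE]] := bool_parity n.
have e2u : (u ^+ 6 / e ^ h) ^+ 2 = (-1) ^+ s * e ^+ p.
  rewrite expr_div_n -exprM uE nE exprz_parity // mulrA mulfK //.
  by rewrite expf_neq0 // expfz_neq0.
have kz : k (u ^+ 6 / e ^ h).
  apply: (subfield_div sfk); first exact: (subfieldX sfk).
  by apply: (subfieldXz sfk); exact: unit_group_mem unit_e.
have p0 : p = false.
  apply/negbTE/negP => pT; apply: e_not_sq_k.
  apply: (@sq_in_cancel k sfk ((-1) ^+ s)); first by rewrite signr_eq0.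
    by case: (s); [exact: sqN1|rewrite expr0; exact: sq_in1].
  by exists (u ^+ 6 / e ^ h) => //; rewrite e2u pT.
have [j jE] : exists j : nat, u ^+ 6 / e ^ h = 'i ^+ j.
  apply: quartic_root; rewrite e2u p0 expr0 mulr1.
  by case: (s); [right|left].
by exists j, h; rewrite -jE divfK // expfz_neq0.
Qed.

Lemma unit_rep_cube eta : unit_group k eta ->
    (forall u, unit_group k u -> exists (j : nat) (n : int), u ^+ 3 = 'i ^+ j * eta ^ n) ->
  forall u, unit_group k u -> exists h f, unit_group k f /\ u = unit_base 'i eta h * f ^+ 2.
Proof.
move=> etau rep u uu; have [j [n uE]] := rep u uu.
have u0 := unit_group_neq0 uu; have eta0 := unit_group_neq0 etau.
have [p [h nE]] := bool_parity n.
exists (odd j, p), ('i ^+ j./2 * eta ^ h / u); split.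
  apply: (unit_groupM sfk); last exact: unit_groupV.
  by apply: (unit_groupM sfk); [exact: (unit_groupX sfk)|exact: (unit_groupXz sfk)].
apply: (mulIf (expf_neq0 2 u0)); rewrite -exprS uE nE exprz_parity // /unit_base /=.
rewrite expr_div_n exprMn -[RHS]mulrA divfK ?expf_neq0 //.
have -> : 'i ^+ j = 'i ^+ odd j * ('i ^+ j./2) ^+ 2 :> algC.
  by rewrite -exprM muln2 -exprD odd_double_half.
by ring.
Qed.

Lemma is_unit_normP E : unit_group k E ->
  is_unit_norm L sigma E <-> exists a b : bool, sq_in L (E * (alpha ^+ a * e2 ^+ b)).
Proof.
move=> Eu; have kE := unit_group_mem Eu; have E0 := unit_group_neq0 Eu; split.
  move=> [v vu vE]; have v0 := unit_group_neq0 vu.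
  have sv0 : sigma v != 0 by rewrite fmorph_eq0.
  have [[[s a] b] [w [wM qE]]] := norm1_rep (norm1_sigma_quot sfL sigmaL sigmaK vu).
  have w0 := unit_group_neq0 wM.1.
  exists a, b.
  have v2 : v ^+ 2 = E * sigma_quot sigma v.
    by rewrite -vE /sigma_quot; field.
  apply: (@sq_in_cancel L sfL ((-1) ^+ s)); first by rewrite signr_eq0.
    by case: (s); [exact: sq_in_kL sqN1|rewrite expr0; exact: sq_in1].
  exists (v / w).
    by apply: (subfield_div sfL); [exact: unit_group_mem vu|exact: unit_group_mem wM.1].
  by rewrite expr_div_n v2 qE /norm1_base /=; field.
move=> [a [b [v Lv v2]]].
have vu : unit_group L v.
  apply: (unit_group_sqrt sfL) => //; rewrite v2.
  apply: (unit_groupM sfL); first exact: unit_group_sub k_sub_L Eu.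
  by apply: (unit_groupM sfL); apply: (unit_groupX sfL) => //; case: alpha_norm1.
have : (v * sigma v) ^+ 2 = E ^+ 2.
  rewrite exprMn -rmorphXn /= v2 !rmorphM !rmorphXn /= (sigma_fix kE).
  transitivity (E ^+ 2 * (alpha * sigma alpha) ^+ a * (e2 * sigma e2) ^+ b).
    by rewrite !exprMn; ring.
  by rewrite alpha_norm1.2 norm_e2 !expr1n !mulr1.
move=> /eqP; rewrite eqf_sqr => /orP[]/eqP vE; first by exists v.
(* The norm of ['i] is -1, which repairs the sign. *)
exists ('i * v).
  by apply: (unit_groupM sfL) => //; exact: unit_group_sub k_sub_L unit_i.
by rewrite rmorphM /= sigma_i mulrACA vE -expr2 sqrCi mulrNN mul1r.
Qed.

Let omega : algC := (1 + r1) / 2.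

Let omega_int : int_ring L omega.
Proof.
split.
  apply: (subfield_div sfL); last exact: subfield_nat.
  by apply: (subfieldD sfL) => //; exact: subfield1.
apply: (@quad_int_Aint _ (m1 %/ 4)%:R); first exact: rpred_nat.
have h : m1%:R = 4 * (m1 %/ 4)%:R + 1 :> algC.
  by rewrite {1}(divn_eq m1 4) m1_mod4 natrD natrM mulrC.
have -> : omega ^+ 2 - omega = (r1 ^+ 2 - 1) / 4 by rewrite /omega; field.
by rewrite sqrtCK h; field.
Qed.

Let sigma_omega : omega + sigma omega = 1.
Proof.
by rewrite /omega rmorphM fmorphV rmorphD /= rmorph1 rmorph_nat sigma_r1; field.
Qed.

(** omega - sigma omega = sqrt m1, where omega is integral because m1 = 1 mod 4, and the difference
    for sqrt m2 is 2 sqrt m2. Multiplied by sqrt m1 and 2 sqrt m2 they give m1 and 4 m2, which are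
    coprime; Bezout coefficients complete the list. *)
Let unramified : exists cs : seq (algC * algC),
  (forall x, x \in cs -> int_ring L x.1 /\ int_ring L x.2) /\
  \sum_(x <- cs) x.1 * (x.2 - sigma x.2) = 1.
Proof.
have cop : coprime m1 (4 * m2).
  rewrite coprimeMr m12_coprime andbT (@coprimeXr 2 m1 2) // coprime_sym coprime2n.
  by rewrite (divn_eq m1 4) m1_mod4 oddD oddM andbF.
have [a [b ab]] : exists a b : int, a * m1%:Z + b * (4 * m2)%N%:Z = 1.
  have [a [b h]] := Bezoutz m1%:Z (4 * m2)%N%:Z; exists a, b; rewrite h.
  by move: cop; rewrite /coprime /gcdz !absz_nat => /eqP ->.
have iL n x : L x -> x \in Aint -> int_ring L (n%:~R * x).
  move=> Lx Ax; split; first by apply: (subfieldM sfL) => //; exact: subfield_int.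
  by rewrite /= rpredM // Aint_int.
exists [:: (a%:~R * r1, omega); (b%:~R * 2 * r2, r2)]; split.
  move=> x; rewrite !inE => /orP[]/eqP -> /=; split=> //.
  - by apply: iL => //; exact: Aint_sqrtC_nat.
  - have -> : b%:~R * 2 = (b * 2)%:~R :> algC by rewrite rmorphM.
    by apply: iL => //; exact: Aint_sqrtC_nat.
  - by split=> //; exact: Aint_sqrtC_nat.
rewrite !big_cons big_nil addr0 /= sigma_r2.
have -> : omega - sigma omega = r1.
  by rewrite /omega rmorphM fmorphV rmorphD /= rmorph1 rmorph_nat sigma_r1; field.
transitivity (a%:~R * r1 ^+ 2 + b%:~R * (4 * r2 ^+ 2)); first by ring.
rewrite !sqrtCK; transitivity ((a * m1%:Z + b * (4 * m2)%N%:Z)%:~R : algC).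
  by rewrite rmorphD !rmorphM /= -!pmulrn natrM.
by rewrite ab.
Qed.

Lemma card_capitulation_of eta : unit_group k eta ->
    (forall u, unit_group k u -> exists (j : nat) (n : int), u ^+ 3 = 'i ^+ j * eta ^ n) ->
    (forall h f, k f -> unit_base 'i eta h = f ^+ 2 -> h = (false, false)) ->
  has_card (capitulation_kernel k L) (8 %/ #|unit_norms L sigma 'i eta|).
Proof.
move=> etau rep free; have [cs [csL cs_sum]] := unramified.
have zL : int_ring L r1 by split=> //; exact: Aint_sqrtC_nat.
apply: (card_capitulation_kernel sfk sfL k_sub_L sigmaL sigmaK sigma_fix fix_sigma zL
  r1_neq0 sigma_r1 omega_int sigma_omega csL cs_sum alpha_norm1 beta_norm1 unit_i etau).
- exact: norm1_rep.
- exact: norm1_free.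
- exact: unit_rep_cube.
- by move=> h f /unit_group_mem; exact: free.
Qed.

(** When n is the square class of a product of i and e, this is the condition that the product is a
    norm of a unit of L. *)
Definition adm_class (n : nat) : Prop := exists a b : bool,
  (neg1 -> ~~ a) /\ nat_sq_class (n * (t1 ^ a * t2 ^ b)).

Lemma is_unit_norm_class (h1 h2 : bool) :
  is_unit_norm L sigma ('i ^+ h1 * e ^+ h2) <-> adm_class (2 ^ h1 * t ^ h2).
Proof.
rewrite is_unit_normP; last first.
  by apply: (unit_groupM sfk); exact: (unit_groupX sfk).
split=> [[a [b sq]]|[a [b [na sq]]]]; exists a, b.
  by have na := alpha_sq_neg sq; split=> //; apply/sq_in_base_L.
exact/sq_in_base_L.
Qed.

(** Here i e is not a square in k, so i and e are independent and generate the units of k modulo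
    squares. *)
Theorem capitulation_nonsquare : ~ natsq (2 * t) -> ~ natsq (2 * t * d) ->
  has_card (capitulation_kernel k L)
    (8 %/ #|finset (fun h : bool * bool => `[< adm_class (2 ^ h.1 * t ^ h.2) >])|).
Proof.
move=> nS1 nS2.
have -> : finset (fun h : bool * bool => `[< adm_class (2 ^ h.1 * t ^ h.2) >]) =
    unit_norms L sigma 'i e.
  apply/setP => -[h1 h2]; rewrite !finset.inE /unit_base /=.
  by apply/asboolP/asboolP => /is_unit_norm_class.
have free (h1 h2 : bool) : sq_in k ('i ^+ h1 * e ^+ h2) -> h1 = false /\ h2 = false.
  case: h1; case: h2 => // sq; exfalso.
  - by move/sq_in_base_k: sq; rewrite !expn1 => -[].
  - by apply: i_not_sq_k; move: sq; rewrite expr0 mulr1.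
  - by apply: e_not_sq_k; move: sq; rewrite expr0 mul1r.
apply: card_capitulation_of => //.
  move=> u uu; have [j [n uE]] := unit_sixth uu.
  have ku := unit_group_mem uu.
  have [p [h nE]] := bool_parity n.
  pose y := 'i ^+ j./2 * e ^ h.
  have ky : k y.
    apply: (subfieldM sfk); first exact: (subfieldX sfk).
    by apply: (subfieldXz sfk); exact: unit_group_mem unit_e.
  have y0 : y != 0 by rewrite mulf_neq0 ?expf_neq0 ?expfz_neq0 ?neq0Ci.
  have sqE : (u ^+ 3 / y) ^+ 2 = 'i ^+ odd j * e ^+ p.
    rewrite expr_div_n -exprM uE nE exprz_parity //.
    rewrite -{1}(odd_double_half j) exprD -muln2 (exprM _ _ 2) /y.
    have := y0; rewrite /y mulf_eq0 negb_or => /andP[i0 h0]; field.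
    by rewrite h0 i0.
  have [] := free (odd j) p.
    exists (u ^+ 3 / y) => //.
    by apply: (subfield_div sfk) => //; exact: (subfieldX sfk).
  move=> oj p0; move: sqE; rewrite oj p0 !expr0 mulr1 => /eqP.
  rewrite sqrf_eq1 => /orP[]/eqP sE.
    by exists j./2, h; rewrite -[LHS](divfK y0) sE mul1r.
  (* The sign is absorbed as i^2. *)
  by exists j./2.+2, h; rewrite -[LHS](divfK y0) sE /y !exprS mulrA -expr2 sqrCi mulrA.
by move=> [h1 h2] f kf hE; have [|-> ->] := free h1 h2; first by exists f.
Qed.

(** Here i e = eta^2, and i and eta generate the units of k modulo squares. Since eta tau eta is i
    or -i, neither a square in L, no i^h eta is a norm; only i, of square class 2, remains to be
    tested. *)
Theorem capitulation_square : natsq (2 * t) \/ natsq (2 * t * d) ->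
  has_card (capitulation_kernel k L) (8 %/ (1 + `[< adm_class 2 >])).
Proof.
move=> S.
have [eta keta eta2] : sq_in k ('i * e).
  by have := (sq_in_base_k true true).2; rewrite !expr1 !expn1; apply.
have etau : unit_group k eta.
  by apply: (unit_group_sqrt sfk) => //; rewrite eta2; exact: (unit_groupM sfk).
have eta0 := unit_group_neq0 etau.
have tau_eta : (eta * tau eta = 'i \/ eta * tau eta = - 'i).
  apply: sqr_eq_m1; rewrite exprMn -rmorphXn /= eta2 rmorphM /= tau_i mulrACA norm_e.
  by rewrite -expr2 sqrCi mulr1.
(* Forming v tau v removes e2, because tau e2 = e2^-1, and turns alpha into a square, because tau
   alpha = alpha. *)
have not_sq (h : bool) v (a b : bool) : L v ->
    v ^+ 2 = 'i ^+ h * eta * (alpha ^+ a * e2 ^+ b) -> False.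
  move=> Lv v2.
  have ta : tau alpha = alpha by rewrite /alpha rmorphM rmorphXn /= tau_i tau_e1.
  have La := unit_group_mem alpha_norm1.1.
  have sqE : (v * tau v / alpha ^+ a) ^+ 2 = (-1) ^+ h * (eta * tau eta).
    rewrite expr_div_n exprMn -rmorphXn /= v2 !rmorphM !rmorphXn /= tau_i ta tau_e2.
    transitivity (('i ^+ 2) ^+ h * (eta * tau eta) * (e2 / e2) ^+ b *
      (alpha ^+ a) ^+ 2 / (alpha ^+ a) ^+ 2); last first.
      by rewrite sqrCi mulfV // expr1n mulr1 mulfK // !expf_neq0.
    by case: (h); case: (b); rewrite ?expr1 ?expr0; ring.
  have sq : sq_in L ((-1) ^+ h * (eta * tau eta)).
    exists (v * tau v / alpha ^+ a) => //; apply: (subfield_div sfL).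
      by apply: (subfieldM sfL) => //; exact: tauL.
    exact: (subfieldX sfL).
  have {}sq : sq_in L (eta * tau eta).
    apply: (sq_in_cancel sfL _ _ sq); first by rewrite signr_eq0.
    by case: (h); [exact: sq_in_kL sqN1|rewrite expr0; exact: sq_in1].
  by case: tau_eta sq => ->; [exact: i_not_sq_L|exact: Ni_not_sq_L].
have -> : (1 + `[< adm_class 2 >])%N = #|unit_norms L sigma 'i eta|.
  have mem h : (h \in unit_norms L sigma 'i eta) =
      (h == (false, false)) || (h == (true, false)) && `[< adm_class 2 >].
    rewrite finset.inE; case: h => h1 h2; apply/asboolP/idP.
      case: h2 => [[v vu vE]|].
        have [|a [b [v' Lv' /(not_sq h1)]]] := (is_unit_normP _).1 (ex_intro2 _ _ v vu vE).
          by rewrite /unit_base /= expr1; apply: (unit_groupM sfk) => //; exact: (unit_groupX sfk).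
        by move=> /(_ Lv').
      case: h1 => //; rewrite /unit_base /= => nm.
      have /is_unit_norm_class : is_unit_norm L sigma ('i ^+ true * e ^+ false).
        by move: nm; rewrite !expr0.
      by rewrite expn1 expn0 muln1 => /asboolP.
    case/orP => [/eqP[-> ->]|/andP[/eqP[-> ->] /asboolP adm]].
      by exists 1; [exact: unit_group1|rewrite rmorph1 /unit_base /= !expr0].
    have /is_unit_norm_class : adm_class (2 ^ true * t ^ false) by rewrite expn1 expn0 muln1.
    by rewrite /unit_base /= !expr0.
  case: asboolP mem => adm mem.
    have -> : unit_norms L sigma 'i eta = [set (false, false); (true, false)]%SET.
      by apply/setP => h; rewrite mem !finset.inE andbT.
    by rewrite cards2.
  have -> : unit_norms L sigma 'i eta = [set (false, false)]%SET.
    by apply/setP => h; rewrite mem !finset.inE andbF orbF.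
  by rewrite cards1.
apply: card_capitulation_of => //.
  move=> u uu; have [j [n uE]] := unit_sixth uu.
  have ku := unit_group_mem uu.
  pose z := u ^+ 3 / eta ^ n.
  have kz : k z.
    by apply: (subfield_div sfk); [exact: (subfieldX sfk)|exact: (subfieldXz sfk)].
  have z2 : z ^+ 2 = 'i ^+ j / 'i ^ n.
    rewrite /z expr_div_n -exprM uE.
    have -> : (eta ^ n) ^+ 2 = 'i ^ n * e ^ n.
      change ((eta ^ n) ^ 2 = 'i ^ n * e ^ n); rewrite exprz_exp mulrC -exprz_exp.
      by change ((eta ^+ 2) ^ n = 'i ^ n * e ^ n); rewrite eta2 exprzMl ?unitfE ?neq0Ci.
    by field; rewrite !expfz_neq0 ?neq0Ci.
  (* [z ^+ 2] is thus a fourth root of unity; as i is not a square in k, it can only be 1 or -1. *)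
  have z8 : ((z ^+ 2) ^+ 2) ^+ 2 = 1.
    rewrite z2 -exprM expr_div_n.
    have -> : ('i ^ n) ^+ (2 * 2) = 1 :> algC.
      change (('i ^ n) ^ 4 = 1 :> algC); rewrite exprz_exp mulrC -exprz_exp.
      by change (('i ^+ 4 : algC) ^ n = 1); rewrite (exprM _ 2 2) sqrCi sqrrN expr1n exp1rz.
    by rewrite divr1 -exprM mulnC exprM (exprM _ 2 2) sqrCi sqrrN !expr1n.
  have [l lE] : exists l : nat, z ^+ 2 = 'i ^+ l.
    apply: quartic_root; move/eqP: z8; rewrite sqrf_eq1 => /orP[]/eqP; [by left|by right].
  have {}lE : z ^+ 2 = 'i ^+ odd l * (-1) ^+ l./2.
    by rewrite lE -{1}(odd_double_half l) exprD -muln2 mulnC exprM sqrCi.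
  have ev : ~~ odd l.
    apply/negP => ol; move: lE; rewrite ol expr1.
    move=> zE; have := @i_not_sq_k; apply.
    apply: (sq_in_cancel sfk (x := (-1) ^+ l./2)); first by rewrite signr_eq0.
      rewrite -signr_odd; case: odd; [exact: sqN1|rewrite expr0; exact: sq_in1].
    by exists z => //; rewrite zE mulrC.
  have [j' jE] : exists j' : nat, z = 'i ^+ j'.
    apply: quartic_root; rewrite lE (negbTE ev) expr0 mul1r.
    by rewrite -signr_odd; case: odd; [right|left].
  by exists j', n; rewrite -jE /z divfK // expfz_neq0.
move=> [h1 h2] f kf; rewrite /unit_base /=; case: h2 => fE.
  case: (@not_sq h1 f false false (k_sub_L kf)).
  by rewrite -fE !expr0 !mulr1 expr1.
case: h1 fE => // fE; case: i_not_sq_k; exists f => //.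
by rewrite -fE expr0 mulr1 expr1.
Qed.

End Biquadratic.

(** * Pell's equation and existence of fundamental units *)

Lemma isqrt_exists n : exists g : nat, (g ^ 2 <= n < g.+1 ^ 2)%N.
Proof.
elim: n => [|n [g /andP[g1 g2]]]; first by exists 0%N.
have [h|h] := leqP (g.+1 ^ 2)%N n.+1; last by exists g; rewrite h (leq_trans g1).
by exists g.+1; rewrite h; nia.
Qed.

Lemma abs_shift_lt (C : nat) (a : int) : `|a| <= C%:Z -> (absz (a + C%:Z)%R < (2 * C).+1)%N.
Proof. by lia. Qed.

Lemma abs_shift_inj (C : nat) (a b : int) : `|a| <= C%:Z -> `|b| <= C%:Z ->
  absz (a + C%:Z)%R = absz (b + C%:Z)%R -> a = b.
Proof. by lia. Qed.

Lemma dvdz_fact (C : nat) (a : int) : a != 0 -> `|a| <= C%:Z -> (a %| C`!%:Z)%Z.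
Proof. by move=> a0 aC; rewrite dvdzE absz_nat dvdn_fact //; lia. Qed.

Section Pell.
Variable m : nat.
Hypothesis nonsq : ~ natsq m.
Let s : algR := Num.sqrt m%:R.

Let s2 : s ^+ 2 = m%:R. Proof. by rewrite sqr_sqrtr ?ler0n. Qed.
Let s_ge0 : 0 <= s. Proof. exact: sqrtr_ge0. Qed.
Let m_gt0 : (0 < m)%N. Proof. by case: m nonsq => // -[]; exists 0%N. Qed.
Let s_ge1 : 1 <= s.
Proof. by rewrite -(@ler_sqr algR) ?nnegrE ?ler01 // s2 expr1n ler1n. Qed.
Let s_le : s <= m%:R.
Proof. by rewrite -s2 expr2 ler_peMl. Qed.

Let norm_neq0 (A B : nat) : (0 < B)%N -> (A%:Z ^+ 2 - m%:Z * B%:Z ^+ 2 != 0 :> int).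
Proof.
move=> B0; rewrite subr_eq0 -!natz -!natrX -natrM eqr_nat; apply/eqP => h.
apply: nonsq; have : (B ^ 2 %| A ^ 2)%N by rewrite h dvdn_mull.
rewrite dvdn_pexp2r // => /dvdnP[c cE]; exists c; apply/eqP.
by rewrite -(eqn_pmul2r (_ : 0 < B ^ 2)%N) ?expn_gt0 ?B0 // -h cE expnMn.
Qed.

(** Pigeonhole: with g b the integer part of b N s, two of the N + 1 values g 0, ..., g N agree
    modulo N, and their difference is A N. *)
Lemma dirichlet_approx (N : nat) : (0 < N)%N -> exists A B : nat,
  [/\ (0 < B <= N)%N & `|A%:R - B%:R * s| * N%:R < 1].
Proof.
move=> N0.
have gP b : exists g : nat, (g%:R <= (b * N)%:R * s) && ((b * N)%:R * s < g.+1%:R).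
  have [g /andP[g1 g2]] := isqrt_exists (m * (b * N) ^ 2); exists g.
  have e : ((b * N)%:R * s) ^+ 2 = (m * (b * N) ^ 2)%:R.
    by rewrite exprMn s2 mulrC -natrX -natrM.
  have p0 : 0 <= (b * N)%:R * s by rewrite mulr_ge0 ?ler0n.
  rewrite -(@ler_sqr algR) ?nnegrE ?ler0n // -(@ltr_sqr algR ((b * N)%:R * s)) ?nnegrE ?ler0n //.
  by rewrite e -!natrX ler_nat ltr_nat g1 g2.
pose g b := projT1 (cid (gP b)).
have gE b : (g b)%:R <= (b * N)%:R * s < (g b).+1%:R := projT2 (cid (gP b)).
pose rho (i : 'I_N.+1) : 'I_N := Ordinal (ltn_pmod (g i) N0).
have [i [j [ij rE]]] : exists i j : 'I_N.+1, (i < j)%N /\ (g i = g j %[mod N])%N.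
  apply: contrapT => no; have : injective rho.
    move=> i j /(congr1 val) /= e; apply: val_inj.
    by case: (ltngtP i j) => // h; case: no; [exists i, j|exists j, i].
  by move=> /leq_card; rewrite !card_ord ltnn.
have mono : (g i <= g j)%N.
  have /andP[h1 _] := gE i; have /andP[_ h2] := gE j.
  rewrite -ltnS -(ltr_nat algR); apply: le_lt_trans h1 _; apply: le_lt_trans h2.
  by rewrite ler_wpM2r // ler_nat leq_mul2r ltnW ?orbT.
have [A AE] : exists A, (g j = g i + A * N)%N.
  exists (g j %/ N - g i %/ N)%N; rewrite mulnBl.
  have := divn_eq (g i) N; have := divn_eq (g j) N.
  have := leq_mul (leq_div2r N mono) (leqnn N); rewrite rE; lia.
exists A, (j - i)%N; split; first by rewrite subn_gt0 ij (leq_trans (leq_subr _ _)) // -ltnS.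
have /andP[i1 i2] := gE i; have /andP[j1 j2] := gE j.
have -> : `|A%:R - (j - i)%:R * s| * N%:R = `|(A * N)%:R - ((j * N)%:R * s - (i * N)%:R * s)|.
  rewrite -[X in _ * X](@ger0_norm algR) ?ler0n // -normrM natrB ?(ltnW ij) // !natrM.
  by congr (`| _ |); ring.
move: j1 j2 i2 i1; rewrite AE -!natr1 natrD => j1 j2 i2 i1.
by rewrite ltr_norml; apply/andP; split; lra.
Qed.

Let normE (A B : nat) : (A%:Z ^+ 2 - m%:Z * B%:Z ^+ 2)%:~R =
  (A%:R - B%:R * s) * (A%:R + B%:R * s) :> algR.
Proof.
rewrite rmorphB /= rmorphXn /= [(_ * _)%:~R]rmorphM /= rmorphXn /= -!pmulrn.
by rewrite -[m%:R]s2; ring.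
Qed.

(** |A - B s| < 1 / N with B <= N bounds |A^2 - m B^2| by 2 s + 1, and s <= m. *)
Let C := (2 * m + 1)%N.

Definition small_norm (p : nat * nat) : bool :=
  (0 < p.2)%N && (`|p.1%:Z ^+ 2 - m%:Z * p.2%:Z ^+ 2| <= C%:Z).

Lemma small_norm_new (l : seq (nat * nat)) : all small_norm l ->
  exists2 p, small_norm p & p \notin l.
Proof.
(* N exceeds A + m B for every listed pair, so a repeated pair would have a nonzero integer norm of
   absolute value below 1. *)
move=> lP; pose N := (\max_(p <- l) (p.1 + m * p.2)).+1.
have [A [B [/andP[B0 BN] dlt]]] := dirichlet_approx (ltn0Sn _ : 0 < N)%N.
have Npos : 0 < N%:R :> algR by rewrite ltr0n.
have N1 : 1 <= N%:R :> algR by rewrite ler1n.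
have d1 : `|A%:R - B%:R * s| < 1.
  by apply: le_lt_trans dlt; rewrite ler_peMr.
exists (A, B).
  rewrite /small_norm B0 /= -(ler_int algR) intr_norm normE.
  have Bs : 0 <= B%:R * s by rewrite mulr_ge0 ?ler0n.
  have AB0 : 0 <= A%:R + B%:R * s by rewrite addr_ge0 ?ler0n.
  rewrite normrM (ger0_norm AB0).
  have AB : A%:R + B%:R * s <= 2 * (B%:R * s) + 1.
    by have := ltW d1; rewrite ler_norml => /andP[_ h]; lra.
  have BN' : B%:R * s <= N%:R * s by rewrite ler_wpM2r // ler_nat.
  have bound : A%:R + B%:R * s <= N%:R * (2 * m%:R + 1).
    have h : N%:R * s <= N%:R * m%:R by rewrite ler_pM2l.
    by rewrite mulrDr mulr1 mulrCA; move: N1 AB BN' h {dlt Npos}; lra.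
  have -> : C%:~R = 2 * m%:R + 1 :> algR by rewrite -pmulrn /C natrD natrM.
  apply: le_trans (ler_wpM2l (normr_ge0 _) bound) _; rewrite mulrA.
  rewrite ler_piMl ?(ltW dlt) //.
  by rewrite addr_ge0 ?mulr_ge0 ?ler0n.
apply/negP => pl; have := allP lP _ pl => /andP[_ _].
have ABN : (A + m * B < N)%N.
  by rewrite /N ltnS; exact: (@leq_bigmax_seq _ l predT (fun p => p.1 + m * p.2)%N (A, B) pl isT).
have nz := norm_neq0 A B0.
have : 1 <= `|A%:R - B%:R * s| * (A%:R + B%:R * s).
  have AB0 : 0 <= A%:R + B%:R * s by rewrite addr_ge0 ?mulr_ge0 ?ler0n.
  rewrite -(ger0_norm AB0) -normrM -normE.
  by rewrite -intr_norm ler1z -gtz0_ge1 normr_gt0.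
apply/negP; rewrite -ltNge; apply: le_lt_trans dlt; apply: ler_wpM2l => //.
have : (A + m * B)%:R <= N%:R :> algR by rewrite ler_nat ltnW.
rewrite natrD natrM; apply: le_trans; rewrite lerD2l mulrC ler_wpM2r ?ler0n //.
Qed.

Lemma small_norm_seq n : exists l : seq (nat * nat), [/\ uniq l, all small_norm l & size l = n].
Proof.
elim: n => [|n [l [lu lP ls]]]; first by exists [::].
have [p pP pl] := small_norm_new lP.
by exists (p :: l); rewrite /= pl lu pP lP ls.
Qed.

(** Arbitrarily many pairs have norm bounded by C, so two distinct ones share the norm c and the
    residues of both coordinates modulo C!. As c divides C!, the quotient of the two has integer
    coordinates, and its norm is 1. *)
Theorem pell_exists : exists X Y : int, Y != 0 /\ X ^+ 2 - m%:Z * Y ^+ 2 = 1.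
Proof.
pose D := C`!.
have D0 : (0 < D)%N := fact_gt0 C.
pose norm (p : nat * nat) : int := p.1%:Z ^+ 2 - m%:Z * p.2%:Z ^+ 2.
pose cl (p : nat * nat) : 'I_(2 * C).+1 * 'I_D * 'I_D :=
  (inord (absz (norm p + C%:Z)%R), Ordinal (ltn_pmod p.1 D0), Ordinal (ltn_pmod p.2 D0)).
have [l [lu lP ls]] := small_norm_seq #|{: 'I_(2 * C).+1 * 'I_D * 'I_D}|.+1.
have : ~~ uniq (map cl l).
  apply/negP => /card_uniqP h; have := max_card (mem (map cl l)).
  by rewrite h size_map ls ltnn.
move=> /(uniqPn (cl (0, 0)%N))[i [j [ij]]]; rewrite size_map => jl.
have il := ltn_trans ij jl.
rewrite !(nth_map (0, 0)%N) //.
set p := nth _ l i; set p' := nth _ l j.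
have pl : p \in l by exact: mem_nth.
have pl' : p' \in l by exact: mem_nth.
have pp' : p != p' by rewrite nth_uniq // neq_ltn ij.
have /andP[B0 nb] := allP lP _ pl; have /andP[B0' nb'] := allP lP _ pl'.
have c0 := norm_neq0 p.1 B0.
rewrite -/(norm p) in nb c0; rewrite -/(norm p') in nb'.
case=> /(congr1 val) /= e1 e2 e3.
have nn' : norm p = norm p'.
  by move: e1; rewrite !inordK ?abs_shift_lt // => /abs_shift_inj; apply.
move: p p' {pl pl'} pp' B0 B0' nb nb' c0 e1 e2 e3 nn' => [A B] [A' B'] /=.
move=> pp' B0 B0' nb nb' c0 _ e2 e3 nn'.
set c := norm (A, B) in nb c0 nn'.
have cD : (c %| D%:Z)%Z by exact: dvdz_fact.
have dA : (c %| A%:Z - A'%:Z)%Z.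
  apply: dvdz_trans cD _; rewrite -eqz_mod_dvd; apply/eqP.
  by rewrite !modz_nat e2.
have dB : (c %| B%:Z - B'%:Z)%Z.
  apply: dvdz_trans cD _; rewrite -eqz_mod_dvd; apply/eqP.
  by rewrite !modz_nat e3.
have cE : A%:Z ^+ 2 - m%:Z * B%:Z ^+ 2 = c by [].
have cE' : A'%:Z ^+ 2 - m%:Z * B'%:Z ^+ 2 = c by rewrite nn'.
have /dvdzP[a aE] := dA; have /dvdzP[b bE] := dB.
(* X and, up to sign, Y are the coordinates of (A + B s) / (A' + B' s), computed with the conjugate
   of the denominator. *)
have [X XE] : exists X, A%:Z * A'%:Z - m%:Z * B%:Z * B'%:Z = X * c.
  exists (1 - A%:Z * a + m%:Z * B%:Z * b).
  have -> : A'%:Z = A%:Z - a * c by rewrite -aE; ring.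
  have -> : B'%:Z = B%:Z - b * c by rewrite -bE; ring.
  transitivity ((A%:Z ^+ 2 - m%:Z * B%:Z ^+ 2) - A%:Z * a * c + m%:Z * B%:Z * b * c).
    by ring.
  by rewrite cE; ring.
have [Y YE] : exists Y, A%:Z * B'%:Z - A'%:Z * B%:Z = Y * c.
  exists (a * B%:Z - A%:Z * b).
  have -> : A'%:Z = A%:Z - a * c by rewrite -aE; ring.
  have -> : B'%:Z = B%:Z - b * c by rewrite -bE; ring.
  by ring.
exists X, Y; split; last first.
  apply: (mulIf (expf_neq0 2 c0)).
  transitivity ((X * c) ^+ 2 - m%:Z * (Y * c) ^+ 2); first by ring.
  rewrite -XE -YE mul1r.
  transitivity ((A%:Z ^+ 2 - m%:Z * B%:Z ^+ 2) * (A'%:Z ^+ 2 - m%:Z * B'%:Z ^+ 2)).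
    by ring.
  by rewrite cE cE'.
(* Y = 0 makes the two pairs proportional; having the same nonzero norm and positive second entries,
   they would coincide. *)
apply/eqP => Y0; move: YE; rewrite Y0 mul0r => /eqP; rewrite subr_eq0 => /eqP AB.
have h : c * B'%:Z ^+ 2 = c * B%:Z ^+ 2.
  rewrite -[in LHS]cE -[in RHS]cE' mulrBl -exprMn AB; ring.
have := mulfI c0 h; move=> /eqP; rewrite eqrXn2 ?ler0n // => /eqP BB.
have {}BB : B = B' by case: BB.
move: AB; rewrite BB => /(mulIf _) AA; have {}AA : A = A'.
  by have := AA (_ : B'%:Z != 0); rewrite eqz_nat -lt0n B0' => /(_ isT)[].
by move: pp'; rewrite AA BB eqxx.
Qed.

End Pell.

Lemma sqrD_inv_lt (x y : algC) : 1 <= y -> y < x -> y ^+ 2 + y ^- 2 < x ^+ 2 + x ^- 2.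
Proof.
move=> y1 yx; have y0 : 0 < y := lt_le_trans ltr01 y1.
have x0 : 0 < x := lt_trans y0 yx; have x1 : 1 < x := le_lt_trans y1 yx.
rewrite -subr_gt0.
have -> : x ^+ 2 + x ^- 2 - (y ^+ 2 + y ^- 2) = (x ^+ 2 - y ^+ 2) * (1 - (x * y) ^- 2).
  by field; rewrite !gt_eqF.
apply: mulr_gt0; rewrite subr_gt0; first by rewrite ltrXn2r // ?ltW.
rewrite invf_lt1 ?exprn_gt0 ?mulr_gt0 // exprn_egt1 //.
by apply: lt_le_trans x1 _; rewrite ler_peMr // ltW.
Qed.

Section FundamentalUnitExists.
Variable m : nat.
Hypothesis nonsq : ~ natsq m.
Local Notation K := (quad_field m).
Let sfK : is_subfield K. Proof. exact: gen_field_subfield. Qed.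
Let m_gt0 : (0 < m)%N. Proof. by case: m nonsq => // -[]; exists 0%N. Qed.

(** u has norm 1 or -1, so u^-2 is the conjugate of u^2 and the sum is a trace. This natural number
    measures the size of u and allows well-founded arguments. *)
Lemma quad_unit_weight u : unit_group K u -> exists n : nat, u ^+ 2 + u ^- 2 = n%:R.
Proof.
move=> uu; have [nu num] := quad_conj_exists nonsq.
have u0 := unit_group_neq0 uu; have Ku := unit_group_mem uu.
have nuK v : K v -> K (nu v).
  apply: gen_field_rmorph => // z ->; rewrite num.
  by apply: (subfieldN sfK); exact: mem_gen_field.
have nuu : unit_group K (nu u) by exact: (unit_group_aut nuK).
have norm1 : (u * nu u) ^+ 2 = 1.
  have : u * nu u = 1 \/ u * nu u = -1.
    apply: (@unit_group_rat K); last exact: (unit_groupM sfK).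
    by have [r [s ->]] := (quad_fieldP _ _).1 Ku; rewrite quad_rat_norm // Crat_rat.
  by case=> ->; rewrite ?sqrrN expr1n.
have u2 : u ^- 2 = nu (u ^+ 2).
  by rewrite rmorphXn -[LHS]mulr1 -norm1 exprMn mulKf // expf_neq0.
have [r [s uE]] := (quad_fieldP _ _).1 (subfieldX sfK 2 Ku).
have /intrP[n nE] : u ^+ 2 + u ^- 2 \in Num.int.
  apply: Cint_rat_Aint; first by rewrite u2 uE quad_rat_trace // Crat_rat.
  have A2 := rpredX 2 (unit_group_Aint uu).
  by rewrite rpredD // u2 Aint_aut.
have uR := quad_field_real Ku.
have : 0 <= n.
  rewrite -(ler_int algC) -nE addr_ge0 ?invr_ge0 //; by have := realEsqr u; rewrite uR => <-.
by case: n nE => // n nE _; exists n.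
Qed.

Lemma quad_unit_exists : exists2 u, unit_group K u & 1 < u.
Proof.
have [X [Y [Y0 XY]]] := pell_exists nonsq.
have Kr : K (sqrtC m%:R) by exact: mem_gen_field.
have ints (a b : int) : int_ring K (a%:~R + b%:~R * sqrtC m%:R).
  split.
    apply: (subfieldD sfK); first exact: subfield_int.
    by apply: (subfieldM sfK) => //; exact: subfield_int.
  by rewrite /= rpredD ?rpredM ?Aint_int ?Aint_sqrtC_nat.
pose u := `|X|%:~R + `|Y|%:~R * sqrtC m%:R : algC.
have inv : u * (`|X|%:~R + (- `|Y|)%:~R * sqrtC m%:R) = 1.
  transitivity ((`|X| ^+ 2 - m%:Z * `|Y| ^+ 2)%:~R : algC); last first.
    by rewrite !real_normK ?num_real // XY.
  rewrite /u rmorphB /= rmorphXn /= [(_ * _)%:~R]rmorphM /= rmorphXn /= mulrNz.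
  have -> : m%:~R = sqrtC m%:R ^+ 2 :> algC by rewrite sqrtCK.
  by ring.
have u0 : u != 0 by apply: contra_eq_neq inv => ->; rewrite mul0r eq_sym oner_eq0.
exists u.
  split=> //; first exact: ints.
  by rewrite -[u^-1]mulr1 -inv mulKf //; exact: ints.
have X1 : 1 <= `|X|.
  rewrite -gtz0_ge1 normr_gt0; apply: contra_eq_neq XY => ->.
  rewrite expr0n /= sub0r; apply/eqP => h.
  have : 0 <= m%:Z * Y ^+ 2 by rewrite mulr_ge0 // sqr_ge0.
  by lia.
apply: (@lt_le_trans _ _ (1 + `|Y|%:~R * sqrtC m%:R)).
  by rewrite ltrDl mulr_gt0 ?ltr0z ?normr_gt0 // sqrtC_gt0 ltr0n.
by rewrite lerD2r ler1z.
Qed.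

(** A unit above 1 of least weight u^2 + u^-2 is the least unit above 1, because the weight
    increases with u. Dividing a unit above 1 by e keeps it at least 1 and lowers its weight, so
    repeated division ends at 1. *)
Theorem fundamental_unit_exists : exists e, fundamental_unit m e.
Proof.
pose P n := `[< exists2 u, unit_group K u /\ 1 < u & u ^+ 2 + u ^- 2 = n%:R >].
have exP : exists n, P n.
  have [u uu u1] := quad_unit_exists; have [n nE] := quad_unit_weight uu.
  by exists n; apply/asboolP; exists u.
have [n /asboolP[e [eu e1] eE] minn] := ex_minnP exP.
have e0 : 0 < e := lt_trans ltr01 e1.
have eN0 : e != 0 by rewrite gt_eqF.
have realU u : unit_group K u -> u \is Creal.
  by move=> /unit_group_mem; exact: quad_field_real.
have le_e u : unit_group K u -> 1 < u -> e <= u.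
  move=> uu u1; have [//|ue] := real_leP (realU _ eu) (realU _ uu).
  have [l lE] := quad_unit_weight uu.
  have : (n <= l)%N by apply: minn; apply/asboolP; exists u.
  have := sqrD_inv_lt (ltW u1) ue; rewrite eE lE ltr_nat => h.
  by rewrite leqNgt h.
exists e; split=> //.
have ge1 l u : unit_group K u -> 1 <= u -> u ^+ 2 + u ^- 2 <= l%:R ->
    exists n : int, u = e ^ n.
  elim: l u => [|l ih] u uu u1 ul.
    have : 0 < u ^+ 2 + u ^- 2.
      by rewrite addr_gt0 ?invr_gt0 ?exprn_gt0 // (lt_le_trans ltr01 u1).
    by move=> /lt_le_trans /(_ ul); rewrite ltxx.
  have [->|uN1] := eqVneq u 1; first by exists 0; rewrite expr0z.
  have {}u1 : 1 < u by rewrite lt_neqAle eq_sym uN1.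
  have ueu : unit_group K (u / e) by apply: (unit_groupM sfK) => //; exact: unit_groupV.
  have ue1 : 1 <= u / e by rewrite ler_pdivlMr // mul1r le_e.
  have uel : u / e < u by rewrite ltr_pdivrMr // ltr_pMr // (lt_trans ltr01 u1).
  have [k kE] := quad_unit_weight ueu.
  have [|n' nE'] := ih _ ueu ue1.
    have := lt_le_trans (sqrD_inv_lt ue1 uel) ul.
    by rewrite kE ltr_nat ltnS ler_nat.
  by exists (n' + 1); rewrite expfzDr // expr1z -nE' divfK.
have pos u : unit_group K u -> 0 < u -> exists n : int, u = e ^ n.
  move=> uu u0; have [u1|u1] := real_leP (rpred1 _) (realU _ uu).
    by have [l lE] := quad_unit_weight uu; apply: (ge1 l) => //; rewrite lE.
  have uVu := unit_groupV uu; have [l lE] := quad_unit_weight uVu.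
  have [| |n' nE] := ge1 l _ uVu; rewrite ?lE //.
    by rewrite invf_ge1 // ltW.
  by exists (- n'); rewrite -invr_expz -nE invrK.
move=> u uu; have u0 := unit_group_neq0 uu.
have [n' nE] : exists n' : int, `|u| = e ^ n'.
  apply: pos; last by rewrite normr_gt0.
  have := realU _ uu; rewrite realE => /orP[h|h]; first by rewrite ger0_norm.
  by rewrite ler0_norm //; exact: (unit_groupN sfK).
exists n'; have := realU _ uu; rewrite realE -nE => /orP[h|h]; [left|right].
  by rewrite ger0_norm.
by rewrite ler0_norm // opprK.
Qed.

End FundamentalUnitExists.

(** * Square classes of natural numbers *)

Lemma natsq_cancel a b : (0 < a)%N -> natsq a -> natsq (a * b) -> natsq b.
Proof.
move=> a0 [y yE] [z zE]; have y0 : (0 < y)%N by move: a0; rewrite yE expn_gt0 orbF.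
have : (y ^ 2 %| z ^ 2)%N by rewrite -zE yE dvdn_mulr.
rewrite dvdn_pexp2r // => /dvdnP[c cE]; exists c; apply/eqP.
by rewrite -(eqn_pmul2l a0) zE cE yE expnMn mulnC.
Qed.

Lemma natsq_sqr z : natsq (z ^ 2). Proof. by exists z. Qed.

Lemma natsqM a b : natsq a -> natsq b -> natsq (a * b).
Proof. by move=> [y ->] [z ->]; exists (y * z)%N; rewrite expnMn. Qed.

Lemma natsq_logn n : (0 < n)%N ->
  natsq n <-> forall l, prime l -> ~~ odd (logn l n).
Proof.
move=> n0; split=> [[z ->] l lp|ev]; first by rewrite lognX mul2n odd_double.
exists (\prod_(l <- primes n) l ^ (logn l n)./2)%N.
rewrite {1}[n]prod_prime_decomp // prime_decompE big_map /=.
rewrite -mulnn -big_split /= !big_seq; apply: eq_bigr => l.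
rewrite mem_primes => /and3P[lp _ _].
by rewrite -expnD addnn halfK (negbTE (ev l lp)) subn0.
Qed.

(** An odd prime dividing t does not divide t - 4; if it does not divide m either, its exponent in t
    is its exponent in c^2. *)
Lemma trace_logn_even m t c l : (0 < m)%N -> (4 < t)%N -> (t * (t - 4) * m = c ^ 2)%N ->
  prime l -> ~~ (l %| 2 * m)%N -> ~~ odd (logn l t).
Proof.
move=> m0 t4 tE lp; rewrite Euclid_dvdM // negb_or => /andP[l2 lm].
have t0 : (0 < t)%N by apply: leq_trans t4.
have t40 : (0 < t - 4)%N by rewrite subn_gt0.
have [lt|lt] := boolP (l %| t)%N; last by rewrite lognE lp t0 (negbTE lt).
have lt4 : ~~ (l %| t - 4)%N.
  apply/negP => h; have : (l %| 4)%N by rewrite -(subKn (ltnW t4)) dvdn_sub.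
  by rewrite (Euclid_dvdX 2 2) // (negbTE l2).
have : odd (logn l (t * (t - 4) * m)) = false by rewrite tE lognX mul2n odd_double.
rewrite !lognM ?muln_gt0 ?t0 ?t40 //.
by rewrite (lognE l (t - 4)) (negbTE lt4) (lognE l m) (negbTE lm) !andbF !addn0 => ->.
Qed.

(* The norm equations y^2 - m z^2 = 2 and m z^2 - y^2 = 2 have no solution
   modulo 4 when m = 1 mod 4. *)
Lemma trace_mod4 m t c : (m %% 4 = 1)%N -> (4 < t)%N -> (t * (t - 4) * m = c ^ 2)%N ->
  ~ natsq (2 * t) /\ ~ natsq (2 * t * m).
Proof.
move=> m1 t4 tE.
have m0 : (0 < m)%N by case: m m1 {tE}.
have no y : ~ natsq (4 * ((y ^ 2 + 2) * m)).
  move=> /(natsq_cancel _ (natsq_sqr 2)) h; have {h} : natsq ((y ^ 2 + 2) * m) by exact: h.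
  move=> /natsq_mod4; rewrite -modnMmr m1 muln1.
  by case: (natsq_mod4 (natsq_sqr y)) => h; rewrite -modnDml h => -[].
have even_sqrt n : natsq (2 * n) -> exists y, n = (2 * y ^ 2)%N.
  move=> [z zE]; have : (2 %| z)%N.
    by have : (2 %| z ^ 2)%N; [rewrite -zE dvdn_mulr|rewrite Euclid_dvdX // andbT].
  move=> /dvdnP[y yE]; exists y; apply/eqP; rewrite -(eqn_pmul2l (_ : 0 < 2)%N) // zE yE.
  by rewrite expnMn mulnC mulnA.
split=> sq.
- have [y yE] := even_sqrt _ sq.
  have sq4 : natsq (2 * (t - 4) * m).
    apply: (natsq_cancel _ sq); first by rewrite muln_gt0 /= (leq_trans _ t4).
    have -> : (2 * t * (2 * (t - 4) * m) = 2 ^ 2 * (t * (t - 4) * m))%N by ring.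
    by rewrite tE; apply: natsqM; exact: natsq_sqr.
  have y2 : (2 <= y ^ 2)%N by move: t4; rewrite yE; lia.
  have : natsq (4 * ((y ^ 2 - 2) * m)).
    move: sq4; rewrite yE.
    by have -> : (2 * (2 * y ^ 2 - 4) * m = 4 * ((y ^ 2 - 2) * m))%N by nia.
  move=> /(natsq_cancel _ (natsq_sqr 2)) h; have {h} : natsq ((y ^ 2 - 2) * m) by exact: h.
  move=> /natsq_mod4; rewrite -modnMmr m1 muln1.
  by case: (natsq_mod4 (natsq_sqr y)) => h; lia.
- have sq4 : natsq (2 * (t - 4)).
    apply: (natsq_cancel _ sq); first by rewrite !muln_gt0 /= (leq_trans _ t4).
    have -> : (2 * t * m * (2 * (t - 4)) = 2 ^ 2 * (t * (t - 4) * m))%N by ring.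
    by rewrite tE; apply: natsqM; exact: natsq_sqr.
  have [y yE] := even_sqrt _ sq4.
  apply: (no y); move: sq; have -> : t = (2 * y ^ 2 + 4)%N by move: yE t4; lia.
  by have -> : (2 * (2 * y ^ 2 + 4) * m = 4 * ((y ^ 2 + 2) * m))%N by ring.
Qed.

(** * Automorphisms, generators and trace conditions for the fields of the theorem *)

Lemma biquad_auts m1 m2 : (m1 %% 4 = 1)%N -> (m2 %% 4 = 3)%N -> ~ natsq m1 ->
  exists sigma tau : {rmorphism algC -> algC},
    [/\ sigma 'i = 'i, sigma (sqrtC m1%:R) = - sqrtC m1%:R
      & sigma (sqrtC m2%:R) = - sqrtC m2%:R] /\
    [/\ tau 'i = 'i, tau (sqrtC m1%:R) = sqrtC m1%:R
      & tau (sqrtC m2%:R) = - sqrtC m2%:R].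
Proof.
move=> h1 h2 nsq1.
have m1_gt0 : (0 < m1)%N by case: (m1) h1.
have m2_gt0 : (0 < m2)%N by case: (m2) h2.
have r1_neq0 := sqrtC_nat_eq0 m1_gt0.
have not_in n m : (0 < n)%N -> (0 < m)%N -> ~ natsq n -> ~ natsq (n * m) ->
    ~ gen_field [set` [:: 'i; sqrtC m%:R]] (sqrtC n%:R).
  move=> n0 m0 no1 no2 mem.
  have : sq_in (gen_field [set` 'i :: [seq sqrtC m%:R | m <- [:: m]]]) n%:R.
    by exists (sqrtC n%:R); rewrite ?sqrtCK.
  move=> /gen_field_sq_nat; rewrite /= m0 => /(_ n0 isT)[b [sb]].
  by case: b sb => [|[] []] //= _; rewrite ?big_cons ?big_nil ?muln1.
have sq_mem n m : gen_field [set` [:: 'i; sqrtC m%:R]] (sqrtC n%:R ^+ 2).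
  rewrite sqrtCK; exact: subfield_nat (gen_field_subfield _) _.
(* m1 is not a square and m1 (m1 m2) is 3 modulo 4, so sqrt m1 lies outside Q(i, sqrt (m1 m2)). *)
have [||sigma [fixs sig1]] := @quad_aut_exists [:: 'i; sqrtC (m1 * m2)%:R] (sqrtC m1%:R).
- apply: not_in => //; first by rewrite muln_gt0 m1_gt0.
  by move=> /natsq_mod4; rewrite -modnMm -(modnMm m1) h1 h2 => -[].
- exact: sq_mem.
have [||tau [fixt tau2]] := @quad_aut_exists [:: 'i; sqrtC m1%:R] (sqrtC m2%:R).
- apply: not_in => //; first by move=> /natsq_mod4; rewrite h2 => -[].
  by move=> /natsq_mod4; rewrite -modnMm h1 h2 => -[].
- exact: sq_mem.
exists sigma, tau; split; split=> //.
- by apply: fixs; apply: mem_gen_field; rewrite /= !inE eqxx.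
- have : sigma (sqrtC (m1 * m2)%:R) = sqrtC (m1 * m2)%:R.
    by apply: fixs; apply: mem_gen_field; rewrite /= !inE eqxx orbT.
  rewrite sqrtC_mul_nat rmorphM /= sig1 => h; apply: (mulfI r1_neq0).
  by rewrite mulrN -h mulNr opprK.
- by apply: fixt; apply: mem_gen_field; rewrite /= !inE eqxx.
- by apply: fixt; apply: mem_gen_field; rewrite /= !inE eqxx orbT.
Qed.

Lemma adjoin_biquad m1 m2 : (0 < m1)%N -> (0 < m2)%N ->
  let k := gen_field [set sqrtC (m1 * m2)%:R; 'i] in
  let L := gen_field [set` [:: 'i; sqrtC m1%:R; sqrtC m2%:R]] in
  [/\ k = gen_field [set` [:: 'i; sqrtC (m1 * m2)%:R]], adjoin k (sqrtC m1%:R) = L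
    & adjoin k (sqrtC m2%:R) = L].
Proof.
move=> m1_gt0 m2_gt0 k L.
have sfk : is_subfield k := gen_field_subfield _.
have sfL : is_subfield L := gen_field_subfield _.
have r1_neq0 := sqrtC_nat_eq0 m1_gt0; have r2_neq0 := sqrtC_nat_eq0 m2_gt0.
have Lin u : u \in [:: 'i; sqrtC m1%:R; sqrtC m2%:R] -> L u by exact: mem_gen_field.
have L1 : L (sqrtC m1%:R) by apply: Lin; rewrite !inE eqxx orbT.
have L2 : L (sqrtC m2%:R) by apply: Lin; rewrite !inE eqxx !orbT.
have kL : k `<=` L.
  apply: gen_field_sub => // u [->|->]; last by apply: Lin; rewrite inE eqxx.
  by rewrite sqrtC_mul_nat; exact: (subfieldM sfL).
have ki : k 'i by apply: mem_gen_field; right.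
have kd : k (sqrtC (m1 * m2)%:R) by apply: mem_gen_field; left.
have adj z z' : L z -> z != 0 -> z * z' = sqrtC (m1 * m2)%:R ->
    (forall u, u \in [:: 'i; sqrtC m1%:R; sqrtC m2%:R] -> [|| u == 'i, u == z | u == z']) ->
    adjoin k z = L.
  move=> Lz z0 zz' cover; apply/seteqP; split.
    by apply: gen_field_sub => // u [/kL|->].
  have sa : is_subfield (adjoin k z) := gen_field_subfield _.
  have ka u : k u -> adjoin k z u by move=> ku; apply: mem_gen_field; left.
  have az : adjoin k z z by apply: mem_gen_field; right.
  apply: gen_field_sub => // u /cover/or3P[]/eqP -> //; first exact: ka.
  by rewrite -(mulKf z0 z') zz'; apply: (subfieldM sa); [exact: (subfieldV sa)|exact: ka].
split.
- apply: gen_field_eq => u /=.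
    by case=> ->; apply: mem_gen_field; rewrite /= !inE eqxx ?orbT.
  by rewrite !inE => /orP[]/eqP->.
- apply: (adj _ (sqrtC m2%:R)) => //; first by rewrite sqrtC_mul_nat.
  by move=> u; rewrite !inE.
- apply: (adj _ (sqrtC m1%:R)) => //; first by rewrite sqrtC_mul_nat mulrC.
  by move=> u; rewrite !inE [in X in _ -> X]orbCA => /or3P[]->; rewrite ?orbT.
Qed.

Lemma quad_int_trace m a b : (m %% 4 = 3)%N -> fundamental_unit m (quad_int m a b) ->
  exists t c : nat, [/\ (4 < t)%N, t%:Z = 2 * (a + 1),
    (1 + quad_int m a b) ^+ 2 = t%:R * quad_int m a b & (t * (t - 4) * m = c ^ 2)%N].
Proof.
move=> m3 fund; have nsq : ~ natsq m by move=> /natsq_mod4; rewrite m3 => -[].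
have [nu num] := quad_conj_exists nsq.
have norm1 := fund_unit_norm3 fund num m3.
have [t [c [t4 tE cE]]] := fund_unit_trace fund num norm1.
exists t, c; split=> //; apply: (@intr_inj algC).
have e0 : quad_int m a b != 0 by rewrite gt_eqF // (fund_unit_gt0 fund).
apply: (mulIf e0); rewrite -pmulrn -tE.
have nuE : nu (quad_int m a b) = a%:~R - b%:~R * sqrtC m%:R.
  by rewrite /quad_int rmorphD rmorphM /= num !rmorph_int mulrN.
transitivity (quad_int m a b * (quad_int m a b + nu (quad_int m a b) + 2)).
  move: (quad_int m a b) norm1 => e' norm1.
  have -> : e' * (e' + nu e' + 2) = e' ^+ 2 + e' * nu e' + 2 * e' by ring.
  by rewrite norm1; ring.
rewrite mulrC nuE; congr (_ * _); rewrite /quad_int rmorphM rmorphD /=; ring.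
Qed.

(** Here 2 c0 t = 4 c0 (x + 1) and 2 c0 (t - 4) = 4 c0 (x - 1). The product of 2 c0 (t - 4) and 2 c0
    t m is (2 c0 c)^2, so the minus sign amounts to an extra factor m. *)
Lemma square_pmP (m t c c0 : nat) (x : int) : (0 < m)%N -> (0 < c0)%N -> (4 < t)%N ->
    t%:Z = 2 * (x + 1) -> (t * (t - 4) * m = c ^ 2)%N ->
  square_pm c0%:Z x <-> natsq (2 * c0 * t) \/ natsq (2 * c0 * t * m).
Proof.
move=> m0 c00 t4 tx tE.
have [X XE] : exists X : nat, x + 1 = X%:Z by exists `|(x + 1)%R|%N; lia.
have tX : t = (2 * X)%N by lia.
have X2 : (2 < X)%N by lia.
have xm : x - 1 = (X - 2)%N%:Z by lia.
have sqE (n : nat) : nat_square (c0%:Z * n%:Z) <-> natsq (c0 * n).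
  split=> -[z zE]; exists z.
    by move: zE; rewrite -PoszM -[z%:Z ^+ 2]/(z%:Z * z%:Z) -PoszM => -[->]; rewrite -mulnn.
  by rewrite -PoszM zE -mulnn PoszM expr2.
have four n : natsq (4 * n) <-> natsq n.
  split; first exact: (@natsq_cancel 4 n isT (natsq_sqr 2)).
  by move=> h; apply: (natsqM (natsq_sqr 2)).
have e1 : (2 * c0 * t = 4 * (c0 * X))%N by rewrite tX; ring.
have e2 : (2 * c0 * (t - 4) = 4 * (c0 * (X - 2)))%N by rewrite tX; nia.
have prod : natsq ((2 * c0 * (t - 4)) * (2 * c0 * t * m)).
  have -> : (2 * c0 * (t - 4) * (2 * c0 * t * m) = (2 * c0) ^ 2 * (t * (t - 4) * m))%N by ring.
  by rewrite tE; apply: natsqM; exact: natsq_sqr.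
have t40 : (0 < t - 4)%N by lia.
have sw : natsq (2 * c0 * (t - 4)) <-> natsq (2 * c0 * t * m).
  split=> h; first by apply: (natsq_cancel _ h prod); rewrite !muln_gt0 c00.
  apply: (natsq_cancel _ h); first by rewrite !muln_gt0 c00 m0 (leq_trans _ t4).
  by rewrite mulnC.
by rewrite /square_pm XE xm !sqE -sw e1 e2 !four.
Qed.

(** With norm 1, only 2 and p could have an odd exponent in t, so t would be 1, 2, p or 2 p up to
    squares. The values 1 and p would make e a square, and [trace_mod4] excludes 2 and 2 p. *)
Lemma prime_unit_norm p e (sigma : {rmorphism algC -> algC}) : prime p -> (p %% 4 = 1)%N ->
  fundamental_unit p e -> sigma (sqrtC p%:R) = - sqrtC p%:R -> e * sigma e = -1.
Proof.
move=> pp p1 fund sp; case: (fund_unit_norm fund sp) => // norm1; exfalso.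
have p0 := prime_gt0 pp.
have p2 : p != 2 by apply/eqP => p2; rewrite p2 in p1.
have [t [c [t4 tE cE]]] := fund_unit_trace fund sp norm1.
have t0 : (0 < t)%N by apply: leq_trans t4.
have [n1 n2] := fund_unit_trace_nonsquare fund t0 p0 tE.
have [n3 n4] := trace_mod4 p1 t4 cE.
have : natsq (2 ^ odd (logn 2 t) * t * p ^ odd (logn p t)).
  apply/natsq_logn; first by rewrite !muln_gt0 !expn_gt0 t0 p0.
  move=> l lp; rewrite !lognM ?muln_gt0 ?expn_gt0 ?t0 ?p0 // !lognX (logn_prime l pp) (@logn_prime l 2 isT).
  rewrite !oddD !oddM.
  rewrite !oddb; have [->|l2] := eqVneq l 2.
    by rewrite [2%N == p]eq_sym (negbTE p2) andbF addbF andbT addbb.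
  have [->|lnp] := eqVneq l p; first by rewrite andbF addFb andbT addbb.
  rewrite !andbF addbF addFb; apply: (trace_logn_even p0 t4 cE lp).
  by rewrite Euclid_dvdM // !dvdn_prime2 // negb_or l2.
by case: (odd (logn 2 t)); case: (odd (logn p t));
  rewrite ?expn1 ?expn0 ?mul1n ?muln1.
Qed.

(* Parities of the exponents of 2, p1, p2 and q in a natural number. *)
Definition bits := (bool * bool * bool * bool)%type.

Definition addbits (u v : bits) : bits :=
  (u.1.1.1 (+) v.1.1.1, u.1.1.2 (+) v.1.1.2, u.1.2 (+) v.1.2, u.2 (+) v.2).

Definition nullbits : bits := (false, false, false, false).

Definition scalebits (b : bool) (u : bits) : bits := if b then u else nullbits.

(** The span of M1 and M2: the classes that become squares in L. *)
Definition sq_bits (M1 M2 N : bits) : bool :=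
  [|| N == nullbits, N == M1, N == M2 | N == addbits M1 M2].

Lemma addbits_eq0 u v : (addbits u v == nullbits) = (u == v).
Proof. by move: u v => [[[[] []] []] []] [[[[] []] []] []]. Qed.

(** The four disjuncts are the exponent pairs (a, b) of [adm_class]. *)
Definition adm_bits (neg : bool) (M1 M2 T1 T2 N : bits) : bool :=
  [|| sq_bits M1 M2 N, sq_bits M1 M2 (addbits N T2),
      ~~ neg && sq_bits M1 M2 (addbits N T1)
    | ~~ neg && sq_bits M1 M2 (addbits N (addbits T1 T2))].

Definition two_bits : bits := (true, false, false, false).

(* [M1], [M2], [T1], [T2], [T] stand for the square classes of m1, m2, t1, t2, t;
   the first branch is the case where i e is a square in k. *)
Definition cap_card (neg : bool) (M1 M2 T1 T2 T : bits) : nat :=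
  let D := addbits M1 M2 in
  let N := addbits two_bits T in
  if (N == nullbits) || (N == D) then (8 %/ (1 + adm_bits neg M1 M2 T1 T2 two_bits))%N
  else (8 %/ (1 + adm_bits neg M1 M2 T1 T2 T + adm_bits neg M1 M2 T1 T2 two_bits +
    adm_bits neg M1 M2 T1 T2 N))%N.

Lemma card_bool2 (P : bool * bool -> bool) :
  #|finset P| = (P (false, false) + P (false, true) + P (true, false) + P (true, true))%N.
Proof.
rewrite -sum1_card (eq_bigl P) => [|h]; last by rewrite finset.inE.
rewrite big_mkcond /=.
transitivity (\sum_(a : bool) \sum_(b : bool) (P (a, b) : nat))%N.
  by rewrite pair_bigA; apply: eq_bigr => -[a b] _ /=; case: (P _).
rewrite !big_bool /=.
by case: (P (true, true)); case: (P (true, false)); case: (P (false, true));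
  case: (P (false, false)).
Qed.

(** The case m1 = p1, m2 = p2 q. The unit e1 has norm -1, so [nullbits] fills the place of t1. T2
    has no p1 component, and T and T2 are nontrivial modulo D and M2 because fundamental units are
    not squares; the remaining values are enumerated. *)
Lemma cap_card_prime (T T2 : bits) :
  let M1 := (false, true, false, false) in let M2 := (false, false, true, true) in
  let D := (false, true, true, true) in
  let sqx C := (addbits (addbits two_bits C) T == nullbits) ||
               (addbits (addbits two_bits C) T == D) in
  let sqa := (addbits (addbits two_bits nullbits) T2 == nullbits) ||
             (addbits (addbits two_bits nullbits) T2 == M2) in
  let case_i := sqx nullbits && ~~ sqa in
  let case_ii := sqa && (sqx (true, true, false, false) || sqx M1) in
  ~~ T2.1.1.2 -> T != nullbits -> T != D -> T2 != nullbits -> T2 != M2 ->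
  [/\ case_i -> cap_card true M1 M2 nullbits T2 T = 8%N,
      case_ii -> cap_card true M1 M2 nullbits T2 T = 2%N
    & ~~ case_i && ~~ case_ii -> cap_card true M1 M2 nullbits T2 T = 4%N].
Proof.
by move: T T2 => [[[[] []] []] []] [[[u []] v] w] //=; case: u; case: v; case: w.
Qed.

(** The case m1 = p1 p2, m2 = q. The conditions leave 2 and 2 q for T2, and p1, p2, 2 p1 and 2 p2
    for T1 when e1 has norm 1. Hence 2 is always admissible, that is, i is always a norm. *)
Lemma cap_card_pair (neg : bool) (T T1 T2 : bits) :
  let M1 := (false, true, true, false) in let M2 := (false, false, false, true) in
  let D := (false, true, true, true) in
  let sqx C := (addbits (addbits two_bits C) T == nullbits) ||
               (addbits (addbits two_bits C) T == D) in
  ~~ T2.1.1.2 -> ~~ T2.1.2 -> T != nullbits -> T != D -> T2 != nullbits -> T2 != M2 ->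
  if neg then
    if sqx M2 || sqx (true, false, false, true) then cap_card true M1 M2 T1 T2 T = 2%N
    else cap_card true M1 M2 T1 T2 T = 4%N
  else
    ~~ T1.2 -> T1 != nullbits -> T1 != M1 -> T1 != two_bits -> T1 != addbits two_bits M1 ->
    if sqx nullbits then cap_card false M1 M2 T1 T2 T = 4%N
    else cap_card false M1 M2 T1 T2 T = 2%N.
Proof.
move: T2 => [[[u []] []] v] //=; case: neg.
  by move: T => [[[[] []] []] []]; case: u; case: v.
move: T1 => [[[u1 v1] w1] []] //=.
by move: T => [[[[] []] []] []]; case: u; case: v; case: u1; case: v1; case: w1.
Qed.

(** * Square classes supported at 2, p1, p2 and q *)

Section SquareClass.
Variables (p1 p2 q : nat).
Hypotheses (p1_prime : prime p1) (p2_prime : prime p2) (q_prime : prime q).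
Hypotheses (neq_p1p2 : p1 != p2) (neq_p1q : p1 != q) (neq_p2q : p2 != q).
Hypotheses (p1_neq2 : p1 != 2) (p2_neq2 : p2 != 2) (q_neq2 : q != 2).

Definition sqclass (n : nat) : bits :=
  (odd (logn 2 n), odd (logn p1 n), odd (logn p2 n), odd (logn q n)).

(** Even exponents elsewhere ensure that the four bits of [sqclass] decide whether n is a square. *)
Definition supported (n : nat) : Prop := (0 < n)%N /\
  forall l, prime l -> l \notin [:: 2; p1; p2; q] -> ~~ odd (logn l n).

Lemma sqclassM a b : (0 < a)%N -> (0 < b)%N ->
  sqclass (a * b) = addbits (sqclass a) (sqclass b).
Proof. by move=> a0 b0; rewrite /sqclass /addbits /= !lognM // !oddD. Qed.

Lemma sqclass1 : sqclass 1 = nullbits.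
Proof. by rewrite /sqclass !logn1. Qed.

Lemma sqclassX (b : bool) n : sqclass (n ^ b) = scalebits b (sqclass n).
Proof. by case: b; rewrite ?expn1 ?expn0 ?sqclass1. Qed.

Lemma supportedM a b : supported a -> supported b -> supported (a * b).
Proof.
move=> [a0 aS] [b0 bS]; split; first by rewrite muln_gt0 a0.
move=> l lp lS; rewrite lognM // oddD.
by rewrite (negbTE (aS l lp lS)) (negbTE (bS l lp lS)).
Qed.

Lemma supported1 : supported 1.
Proof. by split=> // l _ _; rewrite logn1. Qed.

Lemma supportedX (b : bool) n : supported n -> supported (n ^ b).
Proof. by case: b; rewrite ?expn1 ?expn0 // => _; exact: supported1. Qed.

Lemma supported_prime p : prime p -> p \in [:: 2; p1; p2; q] -> supported p.
Proof.
move=> pp pS; split=> [|l lp lS]; first exact: prime_gt0.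
rewrite logn_prime //; case: eqP => // lpE; by move: lS; rewrite lpE pS.
Qed.

Lemma natsq_sqclass n : supported n -> natsq n <-> sqclass n = nullbits.
Proof.
move=> [n0 nS]; rewrite natsq_logn //; split=> [h|].
  by rewrite /sqclass !(negbTE (h _ _)).
case=> h2 h1 h3 hq l lp; have [|lS] := boolP (l \in [:: 2; p1; p2; q]).
  by rewrite !inE => /orP[|/orP[|/orP[]]]/eqP->; rewrite ?h2 ?h1 ?h3 ?hq.
exact: nS.
Qed.

Lemma sqclass_2 : sqclass 2 = (true, false, false, false).
Proof.
by rewrite /sqclass !logn_prime // (negbTE p1_neq2) (negbTE p2_neq2) (negbTE q_neq2).
Qed.

Lemma sqclass_p1 : sqclass p1 = (false, true, false, false).
Proof.
rewrite /sqclass !logn_prime // eq_sym (negbTE p1_neq2) eqxx.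
by rewrite eq_sym (negbTE neq_p1p2) eq_sym (negbTE neq_p1q).
Qed.

Lemma sqclass_p2 : sqclass p2 = (false, false, true, false).
Proof.
rewrite /sqclass !logn_prime // eq_sym (negbTE p2_neq2) eqxx (negbTE neq_p1p2).
by rewrite eq_sym (negbTE neq_p2q).
Qed.

Lemma sqclass_q : sqclass q = (false, false, false, true).
Proof.
by rewrite /sqclass !logn_prime // eq_sym (negbTE q_neq2) eqxx (negbTE neq_p1q) (negbTE neq_p2q).
Qed.

Lemma nat_sq_classP m1 m2 n : supported m1 -> supported m2 -> supported n ->
  nat_sq_class m1 m2 n <-> sq_bits (sqclass m1) (sqclass m2) (sqclass n).
Proof.
move=> s1 s2 sn.
have key (x y : bool) : natsq (n * (m1 ^ x * m2 ^ y)) <->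
    sqclass n == addbits (scalebits x (sqclass m1)) (scalebits y (sqclass m2)).
  have sx := supportedX x s1; have sy := supportedX y s2.
  rewrite natsq_sqclass; last by apply: supportedM => //; exact: supportedM.
  rewrite !sqclassM ?muln_gt0 ?(proj1 sn) ?(proj1 sx) ?(proj1 sy) // !sqclassX.
  by rewrite -addbits_eq0; split=> /eqP.
have null u : addbits u nullbits = u by move: u => [[[[] []] []] []].
have null' u : addbits nullbits u = u by move: u => [[[[] []] []] []].
rewrite /sq_bits; split=> [[x [y /key]]|].
  by case: x; case: y; rewrite /= ?null ?null' => ->; rewrite ?orbT.
case/or4P => h; [exists false, false|exists true, false|exists false, true|exists true, true];
  by apply/key; rewrite /= ?null ?null'.
Qed.

Lemma adm_classP m1 m2 sigma e1 t1 t2 n : supported m1 -> supported m2 ->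
    supported t1 -> supported t2 -> supported n ->
  adm_class m1 m2 sigma e1 t1 t2 n <-> adm_bits (neg1 sigma e1) (sqclass m1) (sqclass m2)
     (sqclass t1) (sqclass t2) (sqclass n).
Proof.
move=> s1 s2 st1 st2 sn; set neg := neg1 _ _.
have key (a b : bool) : nat_sq_class m1 m2 (n * (t1 ^ a * t2 ^ b)) <->
    sq_bits (sqclass m1) (sqclass m2) (addbits (sqclass n)
      (addbits (scalebits a (sqclass t1)) (scalebits b (sqclass t2)))).
  have sa := supportedX a st1; have sb := supportedX b st2.
  rewrite nat_sq_classP //; last by apply: supportedM => //; exact: supportedM.
  by rewrite !sqclassM ?muln_gt0 ?(proj1 sn) ?(proj1 sa) ?(proj1 sb) // !sqclassX.
have null u : addbits u nullbits = u by move: u => [[[[] []] []] []].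
have null' u : addbits nullbits u = u by move: u => [[[[] []] []] []].
rewrite /adm_bits; split=> [[a [b [na /key]]]|].
  case: a na => na; case: b => /=; rewrite ?null ?null' => -> /=; rewrite ?orbT //.
    by rewrite -/neg in na; case: neg na => [/(_ isT)//|] _; rewrite !orbT.
  by rewrite -/neg in na; case: neg na => [/(_ isT)//|] _; rewrite !orbT.
case/or4P => [h|h|/andP[nn h]|/andP[nn h]].
- by exists false, false; split=> //; apply/key; rewrite /= !null.
- by exists false, true; split=> //; apply/key; rewrite /= null'.
- by exists true, false; split; [move=> n1; rewrite /neg n1 in nn|apply/key; rewrite /= null].
- by exists true, true; split; [move=> n1; rewrite /neg n1 in nn|apply/key].
Qed.

(** The sign [neg] is prescribed for every automorphism negating sqrt m1, because sigma is only
    chosen inside the proof. *)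
Theorem capitulation_bits m1 m2 e1 e2 e t1 t2 t (neg : bool) :
    (m1 %% 4 = 1)%N -> (m2 %% 4 = 3)%N -> coprime m1 m2 -> ~ natsq m1 ->
    supported m1 -> supported m2 -> supported t1 -> supported t2 -> supported t ->
    fundamental_unit m1 e1 -> fundamental_unit m2 e2 -> fundamental_unit (m1 * m2) e ->
    (forall sigma : {rmorphism algC -> algC},
       sigma (sqrtC m1%:R) = - sqrtC m1%:R -> neg1 sigma e1 = neg) ->
    (~~ neg -> (1 + e1) ^+ 2 = t1%:R * e1) -> (1 + e2) ^+ 2 = t2%:R * e2 ->
    (1 + e) ^+ 2 = t%:R * e ->
    (forall a b : bool, (neg -> ~~ a) -> sq_bits (sqclass m1) (sqclass m2)
       (addbits (scalebits a (sqclass t1)) (scalebits b (sqclass t2))) -> ~~ a && ~~ b) ->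
  has_card (capitulation_kernel (gen_field [set` [:: 'i; sqrtC (m1 * m2)%:R]])
      (gen_field [set` [:: 'i; sqrtC m1%:R; sqrtC m2%:R]]))
    (cap_card neg (sqclass m1) (sqclass m2) (sqclass t1) (sqclass t2) (sqclass t)).
Proof.
move=> h1 h2 cop nsq1 s1 s2 st1 st2 st f1 f2 f negP t1E t2E tE free.
have [sigma [tau [[si sr1 sr2] [ti tr1 tr2]]]] := biquad_auts h1 h2 nsq1.
have negE := negP sigma sr1.
have free' (a b : bool) : (neg1 sigma e1 -> ~~ a) ->
    nat_sq_class m1 m2 (t1 ^ a * t2 ^ b) -> ~~ a && ~~ b.
  have sa := supportedX a st1; have sb := supportedX b st2.
  rewrite negE => na /nat_sq_classP - /(_ s1 s2 (supportedM sa sb)).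
  rewrite sqclassM ?(proj1 sa) ?(proj1 sb) // !sqclassX; exact: free.
have t1E' : ~~ neg1 sigma e1 -> (1 + e1) ^+ 2 = t1%:R * e1 by rewrite negE.
have s_2 : supported 2 by apply: supported_prime; rewrite // inE eqxx.
have N2t : sqclass (2 * t) = addbits two_bits (sqclass t).
  by rewrite sqclassM ?(proj1 st) // sqclass_2.
have sqP1 : natsq (2 * t) <-> addbits two_bits (sqclass t) == nullbits.
  by rewrite natsq_sqclass ?N2t; [split=> /eqP|exact: supportedM].
have sqP2 : natsq (2 * t * (m1 * m2)) <->
    addbits two_bits (sqclass t) == addbits (sqclass m1) (sqclass m2).
  have s12 := supportedM s1 s2; have s2t := supportedM s_2 st.
  rewrite natsq_sqclass; last exact: supportedM.
  rewrite (sqclassM (proj1 s2t) (proj1 s12)) N2t (sqclassM (proj1 s1) (proj1 s2)).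
  by rewrite -addbits_eq0; split=> /eqP.
have admE n : supported n -> `[< adm_class m1 m2 sigma e1 t1 t2 n >] =
    adm_bits neg (sqclass m1) (sqclass m2) (sqclass t1) (sqclass t2) (sqclass n).
  by move=> sn; rewrite -negE; apply/asboolP/idP => /adm_classP; apply.
rewrite /cap_card; case: ifP => S.
  have := capitulation_square h1 h2 cop si sr1 sr2 ti tr1 tr2 f1 f2 f (proj1 st1) (proj1 st2)
    (proj1 st) t1E' t2E tE free'.
  rewrite (admE 2%N s_2) sqclass_2; apply.
  by case/orP: S => ?; [left; apply/sqP1|right; apply/sqP2].
have := capitulation_nonsquare h1 h2 cop si sr1 sr2 ti tr1 tr2 f1 f2 f (proj1 st1) (proj1 st2)
    (proj1 st) t1E' t2E tE free'.
rewrite card_bool2 /= !expn0 !expn1 !muln1 !mul1n !admE //; last 2 first.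
- exact: supportedM.
- exact: supported1.
rewrite sqclass1 sqclass_2 N2t.
(* The unit 1 is always a norm; this is the constant term in [cap_card]. *)
have -> : adm_bits neg (sqclass m1) (sqclass m2) (sqclass t1) (sqclass t2) nullbits.
  by rewrite /adm_bits /sq_bits eqxx.
apply; [move=> /sqP1 h|move=> /sqP2 h]; by rewrite h ?orbT in S.
Qed.

Lemma trace_supported m t c : (0 < m)%N -> (4 < t)%N -> (t * (t - 4) * m = c ^ 2)%N ->
  (forall l, prime l -> (l %| m)%N -> l \in [:: 2; p1; p2; q]) -> supported t.
Proof.
move=> m0 t4 tE mS; split=> [|l lp lS]; first exact: leq_trans t4.
apply: (trace_logn_even m0 t4 tE lp); rewrite Euclid_dvdM // negb_or dvdn_prime2 //.
apply/andP; split; first by move: lS; rewrite inE negb_or => /andP[].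
by apply: contra lS; exact: mS.
Qed.

Lemma square_pm_bits (m t c c0 : nat) (x : int) : supported m -> supported c0 ->
    supported t -> (4 < t)%N -> t%:Z = 2 * (x + 1) -> (t * (t - 4) * m = c ^ 2)%N ->
  square_pm c0%:Z x <->
    (addbits (addbits two_bits (sqclass c0)) (sqclass t) == nullbits) ||
    (addbits (addbits two_bits (sqclass c0)) (sqclass t) == sqclass m).
Proof.
move=> sm sc st t4 tx tE.
have s_2 : supported 2 by apply: supported_prime; rewrite // inE eqxx.
have s2c := supportedM s_2 sc; have s2ct := supportedM s2c st.
rewrite (square_pmP (proj1 sm) (proj1 sc) t4 tx tE).
rewrite !natsq_sqclass //; last exact: supportedM.
rewrite (sqclassM (proj1 s2ct) (proj1 sm)) (sqclassM (proj1 s2c) (proj1 st)).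
rewrite (sqclassM _ (proj1 sc)) // sqclass_2 -/two_bits -[X in _ || X]addbits_eq0.
by split=> [[]/eqP->|/orP[]/eqP]; rewrite ?orbT //; [left|right].
Qed.

(** * Capitulation in the extensions by sqrt p1 and by sqrt q *)

Hypotheses (p1_mod4 : (p1 %% 4 = 1)%N) (p2_mod4 : (p2 %% 4 = 1)%N) (q_mod4 : (q %% 4 = 3)%N).
Variables (x y : int).
Local Notation d := (p1 * p2 * q)%N.
Hypothesis fund : fundamental_unit d (quad_int d x y).

Let s_p1 : supported p1. Proof. by apply: supported_prime; rewrite // !inE eqxx ?orbT. Qed.
Let s_p2 : supported p2. Proof. by apply: supported_prime; rewrite // !inE eqxx ?orbT. Qed.
Let s_q : supported q. Proof. by apply: supported_prime; rewrite // !inE eqxx ?orbT. Qed.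
Let s_2 : supported 2. Proof. by apply: supported_prime; rewrite // !inE eqxx ?orbT. Qed.
Let s_p1p2 : supported (p1 * p2). Proof. exact: supportedM. Qed.
Let s_p2q : supported (p2 * q). Proof. exact: supportedM. Qed.
Let s_d : supported d. Proof. exact: supportedM. Qed.
Let p1_gt0 : (0 < p1)%N. Proof. exact: prime_gt0. Qed.
Let p2_gt0 : (0 < p2)%N. Proof. exact: prime_gt0. Qed.
Let q_gt0 : (0 < q)%N. Proof. exact: prime_gt0. Qed.
Let d_gt0 : (0 < d)%N. Proof. exact: proj1 s_d. Qed.
Let d_mod4 : (d %% 4 = 3)%N.
Proof. by rewrite -modnMm -(modnMm p1 p2) p1_mod4 p2_mod4 q_mod4. Qed.
Let p2q_mod4 : (p2 * q %% 4 = 3)%N. Proof. by rewrite -modnMm p2_mod4 q_mod4. Qed.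
Let p1p2_mod4 : (p1 * p2 %% 4 = 1)%N. Proof. by rewrite -modnMm p1_mod4 p2_mod4. Qed.

Let cl_p1p2 : sqclass (p1 * p2) = (false, true, true, false).
Proof. by rewrite sqclassM // sqclass_p1 sqclass_p2. Qed.
Let cl_p2q : sqclass (p2 * q) = (false, false, true, true).
Proof. by rewrite sqclassM // sqclass_p2 sqclass_q. Qed.
Let cl_d : sqclass d = (false, true, true, true).
Proof. by rewrite sqclassM ?muln_gt0 ?p1_gt0 // cl_p1p2 sqclass_q. Qed.

Lemma nonsquare_bits m t : supported m -> supported t ->
  ~ natsq t /\ ~ natsq (t * m) -> sqclass t != nullbits /\ sqclass t != sqclass m.
Proof.
move=> sm st [n1 n2]; split; apply/eqP => h.
  by apply: n1; apply/natsq_sqclass.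
apply: n2; apply/natsq_sqclass; first exact: supportedM.
by rewrite (sqclassM (proj1 st) (proj1 sm)) h; apply/eqP; rewrite addbits_eq0.
Qed.

Let prime_dvd_mem m l : prime l -> all prime m -> (l %| \prod_(p <- m) p)%N -> l \in m.
Proof.
move=> lp; elim: m => [|p m ih] /=; first by rewrite big_nil dvdn1 => _ /eqP l1; rewrite l1 in lp.
move=> /andP[pp pm]; rewrite big_cons Euclid_dvdM // => /orP[|/(ih pm)]; rewrite inE.
  by rewrite dvdn_prime2 // => ->.
by move=> ->; rewrite orbT.
Qed.

Lemma trace_class (s : seq nat) m t c : all prime s -> {subset s <= [:: p1; p2; q]} ->
    m = (\prod_(p <- s) p)%N -> (4 < t)%N -> (t * (t - 4) * m = c ^ 2)%N ->
  supported t /\ forall p, prime p -> p != 2 -> p \notin s -> ~~ odd (logn p t).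
Proof.
move=> sp ss mE t4 tE.
have m0 : (0 < m)%N.
  by rewrite mE big_seq_cond prodn_cond_gt0 // => p /andP[/(allP sp)/prime_gt0].
split.
  apply: (trace_supported m0 t4 tE) => l lp; rewrite mE => /(prime_dvd_mem lp sp)/ss h.
  by rewrite inE h orbT.
move=> p pp pN2 ps; apply: (trace_logn_even m0 t4 tE pp).
rewrite Euclid_dvdM // negb_or dvdn_prime2 // pN2 /=.
by apply: contra ps; rewrite mE; exact: prime_dvd_mem.
Qed.

(** Taken with m1 = p1 and m2 = p2 q. The fundamental unit of Q(sqrt p1) has norm -1 since p1 = 1
    mod 4, so 1 stands in for t1. *)
Lemma capitulation_adjoin_p1 (a b : int) :
    fundamental_unit (p2 * q) (quad_int (p2 * q) a b) ->
  let k := gen_field [set sqrtC d%:R; 'i] in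
  let kappa := capitulation_kernel k (adjoin k (sqrtC p1%:R)) in
  let case_i := square_pm 1 x /\ ~ square_pm 1 a in
  let case_ii := square_pm 1 a /\ (square_pm (2 * p1%:Z) x \/ square_pm p1%:Z x) in
  [/\ case_i -> has_card kappa 8, case_ii -> has_card kappa 2
    & ~ case_i /\ ~ case_ii -> has_card kappa 4].
Proof.
move=> fund2 k kappa case_i case_ii.
have [t [c [t4 tx tE cE]]] := quad_int_trace d_mod4 fund.
have [t2 [c2 [t24 ta t2E c2E]]] := quad_int_trace p2q_mod4 fund2.
have [st _] : supported t /\ forall p, prime p -> p != 2 -> p \notin [:: p1; p2; q] ->
    ~~ odd (logn p t).
  apply: (trace_class _ _ _ t4 cE) => //; first by rewrite /= p1_prime p2_prime q_prime.
  by rewrite !big_cons big_nil muln1 mulnA.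
have [st2 off2] : supported t2 /\ forall p, prime p -> p != 2 -> p \notin [:: p2; q] ->
    ~~ odd (logn p t2).
  apply: (trace_class _ _ _ t24 c2E); first by rewrite /= p2_prime q_prime.
    by move=> p; rewrite !inE => ->; rewrite orbT.
  by rewrite !big_cons big_nil muln1.
have nsq1 : ~ natsq p1.
  by move=> /natsq_logn - /(_ p1_gt0 p1 p1_prime); rewrite logn_prime // eqxx.
have [e1 fund1] := fundamental_unit_exists nsq1.
have dE : (p1 * (p2 * q) = d)%N by rewrite mulnA.
have fund' : fundamental_unit (p1 * (p2 * q)) (quad_int d x y) by rewrite dE.
have p2q_gt0 := proj1 s_p2q.
have [T0 TD] := nonsquare_bits s_d st (fund_unit_trace_nonsquare fund (proj1 st) d_gt0 tE).
have [T20 T2M] := nonsquare_bits s_p2q st2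
  (fund_unit_trace_nonsquare fund2 (proj1 st2) p2q_gt0 t2E).
have T2p1 : ~~ (sqclass t2).1.1.2.
  by apply: off2 => //; rewrite !inE negb_or neq_p1p2.
have cop : coprime p1 (p2 * q).
  by rewrite coprimeMr !prime_coprime // !dvdn_prime2 // neq_p1p2.
have [kE LE _] := adjoin_biquad p1_gt0 p2q_gt0.
have card : has_card kappa (cap_card true (sqclass p1) (sqclass (p2 * q)) (sqclass 1)
    (sqclass t2) (sqclass t)).
  rewrite /kappa /k -dE LE kE.
  apply: (capitulation_bits p1_mod4 p2q_mod4 cop nsq1 s_p1 s_p2q supported1 st2 st fund1
    fund2 fund') => //.
    by move=> sigma sp; rewrite /neg1 (prime_unit_norm p1_prime p1_mod4 fund1 sp) eqxx.
  move=> a' b' na; have -> : a' = false by apply/negbTE/na.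
  move: T20 T2M T2p1; rewrite sqclass_p1 cl_p2q; case: b' => //.
  by move: (sqclass t2) => [[[[] []] []] []].
have two_p1 : 2 * p1%:Z = (2 * p1)%N%:Z by rewrite PoszM.
have cl2p : sqclass (2 * p1) = (true, true, false, false).
  by rewrite sqclassM // sqclass_2 sqclass_p1.
have pm1 := square_pm_bits s_d supported1 st t4 tx cE.
have pmp := square_pm_bits s_d s_p1 st t4 tx cE.
have pm2p := square_pm_bits s_d (supportedM s_2 s_p1) st t4 tx cE.
have pma := square_pm_bits s_p2q supported1 st2 t24 ta c2E.
rewrite ?sqclass1 ?sqclass_p1 ?cl2p ?cl_d ?cl_p2q -?two_p1 in pm1 pmp pm2p pma card TD T2M.
have [ci cii ciii] := cap_card_prime T2p1 T0 TD T20 T2M.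
have iP : case_i -> has_card kappa 8.
  move=> [/pm1 h1 h2]; rewrite -ci //; apply/andP; split; first exact: h1.
  by apply/negP => /pma.
split=> //.
  move=> [/pma ha hx]; rewrite -cii //; apply/andP; split; first exact: ha.
  by case: hx => [/pm2p h|/pmp h]; rewrite h ?orbT.
move=> [ni nii]; rewrite -ciii //; apply/andP; split; apply/negP => /andP.
  by move=> [/pm1 h1 /negP h2]; apply: ni; split=> // /pma.
by move=> [/pma ha /orP[/pm2p h|/pmp h]]; apply: nii; split=> //; [left|right].
Qed.

(** Taken with m1 = p1 p2 and m2 = q. The unit e2 of Q(sqrt q) does not occur in the statement and
    is supplied by [fundamental_unit_exists]. The given unit may have half-integral coordinates,
    hence the rational r and s. *)
Lemma capitulation_adjoin_q (r s : rat) :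
    fundamental_unit (p1 * p2) (quad_rat (p1 * p2) r s) ->
  let k := gen_field [set sqrtC d%:R; 'i] in
  let kappa := capitulation_kernel k (adjoin k (sqrtC q%:R)) in
  (quad_norm (p1 * p2) r s = 1 ->
     (square_pm 1 x -> has_card kappa 4) /\ (~ square_pm 1 x -> has_card kappa 2)) /\
  (quad_norm (p1 * p2) r s = -1 ->
     let case_q := square_pm q%:Z x \/ square_pm (2 * q%:Z) x in
     (case_q -> has_card kappa 2) /\ (~ case_q -> has_card kappa 4)).
Proof.
move=> fund1 k kappa.
have [t [c [t4 tx tE cE]]] := quad_int_trace d_mod4 fund.
have [st _] : supported t /\ forall p, prime p -> p != 2 -> p \notin [:: p1; p2; q] ->
    ~~ odd (logn p t).
  apply: (trace_class _ _ _ t4 cE) => //; first by rewrite /= p1_prime p2_prime q_prime.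
  by rewrite !big_cons big_nil muln1 mulnA.
have nsqq : ~ natsq q.
  by move=> /natsq_logn - /(_ q_gt0 q q_prime); rewrite logn_prime // eqxx.
have nsq1 : ~ natsq (p1 * p2).
  by move=> /(natsq_sqclass s_p1p2); rewrite cl_p1p2.
have [e2 fund2] := fundamental_unit_exists nsqq.
have [nu nuq] := quad_conj_exists nsqq.
have [t2 [c2 [t24 t2E c2E]]] := fund_unit_trace fund2 nuq (fund_unit_norm3 fund2 nuq q_mod4).
have [st2 off2] : supported t2 /\ forall p, prime p -> p != 2 -> p \notin [:: q] ->
    ~~ odd (logn p t2).
  apply: (trace_class _ _ _ t24 c2E); first by rewrite /= q_prime.
    by move=> p; rewrite !inE => ->; rewrite !orbT.
  by rewrite !big_cons big_nil muln1.
have p1p2_gt0 := proj1 s_p1p2.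
have [T0 TD] := nonsquare_bits s_d st (fund_unit_trace_nonsquare fund (proj1 st) d_gt0 tE).
have [T20 T2M] := nonsquare_bits s_q st2
  (fund_unit_trace_nonsquare fund2 (proj1 st2) q_gt0 t2E).
have T2p1 : ~~ (sqclass t2).1.1.2 by apply: off2 => //; rewrite inE.
have T2p2 : ~~ (sqclass t2).1.2 by apply: off2 => //; rewrite inE.
have cop : coprime (p1 * p2) q.
  by rewrite coprimeMl !prime_coprime // !dvdn_prime2 // neq_p1q.
have [kE _ LE] := adjoin_biquad p1p2_gt0 q_gt0.
have negE (sigma : {rmorphism algC -> algC}) :
    sigma (sqrtC (p1 * p2)%:R) = - sqrtC (p1 * p2)%:R ->
    neg1 sigma (quad_rat (p1 * p2) r s) = (quad_norm (p1 * p2) r s == -1).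
  move=> sp; rewrite /neg1 quad_rat_norm //.
  by rewrite -(rmorphN1 (ratr : rat -> algC)) (inj_eq (fmorph_inj _)).
have cl2q : sqclass (2 * q) = (true, false, false, true).
  by rewrite sqclassM // sqclass_2 sqclass_q.
have two_q : 2 * q%:Z = (2 * q)%N%:Z by rewrite PoszM.
have pm1 := square_pm_bits s_d supported1 st t4 tx cE.
have pmq := square_pm_bits s_d s_q st t4 tx cE.
have pm2q := square_pm_bits s_d (supportedM s_2 s_q) st t4 tx cE.
rewrite ?sqclass1 ?sqclass_q ?cl2q ?cl_d -?two_q in pm1 pmq pm2q TD T2M.
split=> norm.
  have [nu1 nu1p] := quad_conj_exists nsq1.
  have norm1 : quad_rat (p1 * p2) r s * nu1 (quad_rat (p1 * p2) r s) = 1.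
    by rewrite quad_rat_norm // norm rmorph1.
  have [t1 [c1 [t14 t1E c1E]]] := fund_unit_trace fund1 nu1p norm1.
  have [st1 off1] : supported t1 /\ forall p, prime p -> p != 2 -> p \notin [:: p1; p2] ->
      ~~ odd (logn p t1).
    apply: (trace_class _ _ _ t14 c1E); first by rewrite /= p1_prime p2_prime.
      by move=> p; rewrite !inE => /orP[]->; rewrite ?orbT.
    by rewrite !big_cons big_nil muln1.
  have [T10 T1M] := nonsquare_bits s_p1p2 st1
    (fund_unit_trace_nonsquare fund1 (proj1 st1) p1p2_gt0 t1E).
  have T1q : ~~ (sqclass t1).2.
    by apply: off1 => //; rewrite !inE negb_or ![q == _]eq_sym neq_p1q.
  (* Together with T10, T1M and T1q, this leaves for t1 only the classes in which exactly one of p1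
     and p2 occurs. *)
  have [n3 n4] := trace_mod4 p1p2_mod4 t14 c1E.
  have s2t1 := supportedM s_2 st1.
  have T12 : sqclass t1 != two_bits.
    apply/eqP => h; apply: n3; apply/natsq_sqclass => //.
    by rewrite sqclassM ?(proj1 st1) // sqclass_2 h.
  have T12M : sqclass t1 != addbits two_bits (sqclass (p1 * p2)).
    apply/eqP => h; apply: n4; apply/natsq_sqclass; first exact: supportedM.
    by rewrite (sqclassM (proj1 s2t1) p1p2_gt0) sqclassM ?(proj1 st1) // sqclass_2 h cl_p1p2.
  have card : has_card kappa (cap_card false (sqclass (p1 * p2)) (sqclass q) (sqclass t1)
      (sqclass t2) (sqclass t)).
    rewrite /kappa /k LE kE.
    apply: (capitulation_bits p1p2_mod4 q_mod4 cop nsq1 s_p1p2 s_q st1 st2 st fund1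
      fund2 fund) => //.
      by move=> sigma sp; rewrite negE // norm.
    move=> a b _; move: T1q T2p1 T2p2 T10 T1M T12 T12M T20 T2M.
    rewrite ?cl_p1p2 ?sqclass_q; move: (sqclass t1) (sqclass t2) => [[[u v] w] []] //.
    move=> [[[u' []] []] w'] //.
    by case: u; case: v; case: w; case: u'; case: w'; case: a; case: b.
  rewrite ?cl_p1p2 ?sqclass_q in card T1M T12M.
  have h := @cap_card_pair false _ _ _ T2p1 T2p2 T0 TD T20 T2M T1q T10 T1M T12 T12M.
  split=> [/pm1 sq|nsq]; first by move: h; rewrite sq => <-.
  by move: h; case: ifP => [/pm1//|_ <-].
have card : has_card kappa (cap_card true (sqclass (p1 * p2)) (sqclass q) (sqclass 1)
    (sqclass t2) (sqclass t)).
  rewrite /kappa /k LE kE.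
  apply: (capitulation_bits p1p2_mod4 q_mod4 cop nsq1 s_p1p2 s_q supported1 st2 st fund1
    fund2 fund) => //.
    by move=> sigma sp; rewrite negE // norm.
  move=> a b na; have -> : a = false by apply/negbTE/na.
  move: T20 T2M T2p1 T2p2; rewrite cl_p1p2 sqclass_q; case: b => //.
  by move: (sqclass t2) => [[[[] []] []] []].
rewrite ?cl_p1p2 ?sqclass_q ?sqclass1 in card.
have h := @cap_card_pair true _ nullbits _ T2p1 T2p2 T0 TD T20 T2M.
move=> case_q; split=> [hq|nq].
  by move: h; rewrite ifT => [<-//|]; case: hq => [/pmq u|/pm2q u]; rewrite u ?orbT.
move: h; case: ifP => [/orP[/pmq u|/pm2q u]|_ <-] //; case: nq; [by left|by right].
Qed.

End SquareClass.

Theorem theorem5p2 (p1 p2 q : nat) (x y : int)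
    (p1_prime : prime p1) (p2_prime : prime p2) (q_prime : prime q)
    (neq_p1p2 : p1 <> p2) (neq_p1q : p1 <> q) (neq_p2q : p2 <> q)
    (p1_mod4 : (p1%:Z = 1 %[mod 4])%Z) (p2_mod4 : (p2%:Z = 1 %[mod 4])%Z)
    (q_mod4 : (- q%:Z = 1 %[mod 4])%Z)
    (unit_xy : fundamental_unit (p1 * p2 * q) (quad_int (p1 * p2 * q) x y)) :
  let k := gen_field [set sqrtC (p1 * p2 * q)%:R; 'i] in
  let K1 := adjoin k (sqrtC p1%:R) in
  let K2 := adjoin k (sqrtC p2%:R) in
  let K3 := adjoin k (sqrtC q%:R) in
  let kappa1 := capitulation_kernel k K1 in
  let kappa2 := capitulation_kernel k K2 in
  let kappa3 := capitulation_kernel k K3 in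
  [/\ (forall a b : int,
         fundamental_unit (p2 * q) (quad_int (p2 * q) a b) ->
         let case_i := square_pm 1 x /\ ~ square_pm 1 a in
         let case_ii := square_pm 1 a /\
           (square_pm (2 * p1%:Z) x \/ square_pm p1%:Z x) in
         [/\ case_i -> has_card kappa1 8,
             case_ii -> has_card kappa1 2
           & ~ case_i /\ ~ case_ii -> has_card kappa1 4]),
      (forall a b : int,
         fundamental_unit (p1 * q) (quad_int (p1 * q) a b) ->
         let case_i := square_pm 1 x /\ ~ square_pm 1 a in
         let case_ii := square_pm 1 a /\
           (square_pm (2 * p2%:Z) x \/ square_pm p2%:Z x) in
         [/\ case_i -> has_card kappa2 8,
             case_ii -> has_card kappa2 2
           & ~ case_i /\ ~ case_ii -> has_card kappa2 4])
    & (forall r s : rat,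
         fundamental_unit (p1 * p2) (quad_rat (p1 * p2) r s) ->
         (quad_norm (p1 * p2) r s = 1 ->
            (square_pm 1 x -> has_card kappa3 4) /\
            (~ square_pm 1 x -> has_card kappa3 2)) /\
         (quad_norm (p1 * p2) r s = -1 ->
            let case_q := square_pm q%:Z x \/ square_pm (2 * q%:Z) x in
            (case_q -> has_card kappa3 2) /\
            (~ case_q -> has_card kappa3 4)))].
Proof.
have h1 : (p1 %% 4 = 1)%N by lia.
have h2 : (p2 %% 4 = 1)%N by lia.
have hq : (q %% 4 = 3)%N by lia.
have n12 : p1 != p2 by apply/eqP.
have n1q : p1 != q by apply/eqP.
have n2q : p2 != q by apply/eqP.
have n1 : p1 != 2 by apply: contra_eq_neq h1 => ->.
have n2 : p2 != 2 by apply: contra_eq_neq h2 => ->.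
have nq : q != 2 by apply: contra_eq_neq hq => ->.
move=> k K1 K2 K3 kappa1 kappa2 kappa3; split.
- move=> a b fund1.
  exact: (capitulation_adjoin_p1 p1_prime p2_prime q_prime n12 n1q n2q n1 n2 nq h1 h2 hq
    unit_xy fund1).
(* Exchanging p1 and p2 reduces this case to the previous one. *)
- have unit_yx : fundamental_unit (p2 * p1 * q) (quad_int (p2 * p1 * q) x y).
    by rewrite [(p2 * p1)%N]mulnC.
  move=> a b fund2; rewrite eq_sym in n12.
  have := capitulation_adjoin_p1 p2_prime p1_prime q_prime n12 n2q n1q n2 n1 nq h2 h1 hq
    unit_yx fund2.
  by rewrite [(p2 * p1)%N]mulnC.
- move=> r s fund3.
  exact: (capitulation_adjoin_q p1_prime p2_prime q_prime n12 n1q n2q n1 n2 nq h1 h2 hq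
    unit_xy fund3).
Qed.
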